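(* Let $f:\mathbb{R}\to\mathbb{R}$ satisfy $|f(u)|\le C|u|^{p-1}$ for all $u\in\mathbb{R}$, for some $C>0$ and $p\in(2,4)$. Suppose that $f\in C^\infty(\mathbb{R})$ and that for any $R>0$ there exists $M>0$ such that $$|f^{(n)}(x)|\le M^{n+1}n!\qquad\text{for all }|x|<R,\ n\in\mathbb{N}.$$ Then any solution $\varphi\in\mathcal{Z}\cap H^\infty(\mathbb{R}^2)$ of $$-\varphi_x-\mathscr{H}\Delta\varphi+(f(\varphi))_x=0\quad\text{on }\mathbb{R}^2$$ is real analytic in $\mathbb{R}^2$.
   Context: $\Delta=\partial_x^2+\partial_y^2$, and $\mathscr{H}$ is the Hilbert transform in $x$, $\mathscr{H}u(x,y)=\frac1\pi\,\mathrm{p.v.}\int_{\mathbb{R}}\frac{u(z,y)}{x-z}\,dz$ (Fourier symbol $-i\,\mathrm{sgn}\,\xi$). With $(D_x^{\pm1/2}u)^{\wedge}(\xi,\eta)=|\xi|^{\pm1/2}\widehat{u}(\xi,\eta)$, $\mathcal{Z}=\{u\in L^2(\mathbb{R}^2): D_x^{1/2}u,\ D_x^{-1/2}u_y\in L^2(\mathbb{R}^2)\}$ (real-valued functions). Solutions are understood in the weak sense: $$\int_{\mathbb{R}^2}\big(\varphi\chi+D_x^{1/2}\varphi\,D_x^{1/2}\chi+D_x^{-1/2}\varphi_y\,D_x^{-1/2}\chi_y\big)\,dx\,dy=\int_{\mathbb{R}^2}f(\varphi)\chi\,dx\,dy\quad\text{for all }\chi\in\mathcal{Z}.$$ Such $\varphi$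 is the profile of a solitary wave $u(x,y,t)=\varphi(x-t,y)$ (speed $c=1$) of $u_t-\mathscr{H}\Delta u+(f(u))_x=0$. $H^\infty(\mathbb{R}^2)=\bigcap_{s\ge0}H^s(\mathbb{R}^2)$. *)

(* Defs.v *)
From HB Require Import structures.
From mathcomp Require Import all_boot all_order all_algebra.
From mathcomp Require Import all_classical all_reals all_analysis.
From mathcomp.real_closed Require Import complex.

Set Implicit Arguments.
Unset Strict Implicit.
Unset Printing Implicit Defensive.

Import Order.TTheory GRing.Theory Num.Theory.
Import numFieldNormedType.Exports.

Local Open Scope classical_set_scope.
Local Open Scope complex_scope.
Local Open Scope ring_scope.

Notation mu2 R :=
  (@lebesgue_measure R \x @lebesgue_measure R)%E (only parsing).

(* Elements of L^2 are represented by functions; every notion below that takes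
   them as arguments is invariant under modification on a null set. *)
Definition L2 (R : realType) (u : R * R -> R) : Prop :=
  u \in Lfun (mu2 R) 2%:E.

Definition L2C (R : realType) (U : R * R -> R[i]) : Prop :=
  L2 (fun z => complex.Re (U z)) /\ L2 (fun z => complex.Im (U z)).

Definition box (R : realType) (n : nat) : set (R * R) :=
  `[- n%:R, n%:R]%classic `*` `[- n%:R, n%:R]%classic.

(* \int_(z in box n) u(z) exp(- i <z, w>) dz *)
Definition fourier_box (R : realType) (u : R * R -> R) (n : nat) (w : R * R) :
    R[i] :=
  (\int[mu2 R]_(z in box n) (u z * cos (z.1 * w.1 + z.2 * w.2)))
  -i* (\int[mu2 R]_(z in box n) (u z * sin (z.1 * w.1 + z.2 * w.2))).

Definition sqdistc (R : realType) (a b : R[i]) : R :=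
  (complex.Re a - complex.Re b) ^+ 2 + (complex.Im a - complex.Im b) ^+ 2.

(* U is the Fourier-Plancherel transform of the real-valued u in L^2(R^2), as
   the L^2-limit of the transforms of the truncations of u. *)
Definition is_fourier (R : realType) (u : R * R -> R) (U : R * R -> R[i]) :
    Prop :=
  [/\ L2 u, L2C U &
    (fun n => \int[mu2 R]_w (sqdistc (U w) (fourier_box u n w))%:E)%E
      @ \oo --> 0%E].

(* v is in L^2(R^2) and has Fourier transform m * \hat u; the value of m on a
   null set is irrelevant. *)
Definition is_multiplier (R : realType) (m : R * R -> R[i])
    (u v : R * R -> R) : Prop :=
  exists U V : R * R -> R[i],
    [/\ is_fourier u U, is_fourier v V &
        {ae mu2 R, forall w, V w = m w * U w}].

(* v = D_x^{1/2} u *)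
Definition is_Dx_half (R : realType) : (R * R -> R) -> (R * R -> R) -> Prop :=
  is_multiplier (fun w => (`|w.1| `^ (2^-1))%:C).

(* v = D_x^{-1/2} u_y, where u_y has Fourier transform i w.2 \hat u *)
Definition is_Dx_mhalf_dy (R : realType) :
    (R * R -> R) -> (R * R -> R) -> Prop :=
  is_multiplier (fun w => 'i%C * (w.2 * `|w.1| `^ (- 2^-1))%:C).

Definition in_Z (R : realType) (u : R * R -> R) : Prop :=
  [/\ L2 u, exists v, is_Dx_half u v & exists v, is_Dx_mhalf_dy u v].

Definition in_Hs (R : realType) (s : R) (u : R * R -> R) : Prop :=
  exists2 U, is_fourier u U &
    L2C (fun w => ((1 + w.1 ^+ 2 + w.2 ^+ 2) `^ (s / 2))%:C * U w).

Definition in_Hoo (R : realType) (u : R * R -> R) : Prop :=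
  forall s : R, 0 <= s -> in_Hs s u.

(* Weak solution of - phi_x - H (Delta phi) + (f(phi))_x = 0. *)
Definition weak_solution (R : realType) (f : R -> R) (phi : R * R -> R) :
    Prop :=
  forall phi1 phi2 chi chi1 chi2 : R * R -> R,
    is_Dx_half phi phi1 -> is_Dx_mhalf_dy phi phi2 ->
    in_Z chi -> is_Dx_half chi chi1 -> is_Dx_mhalf_dy chi chi2 ->
    (\int[mu2 R]_z
       (phi z * chi z + phi1 z * chi1 z + phi2 z * chi2 z)%:E =
     \int[mu2 R]_z (f (phi z) * chi z)%:E)%E.

Definition smooth (R : realType) (f : R -> R) : Prop :=
  forall (n : nat) (x : R), derivable (derive1n n f) x 1.

(* The double power series with coefficients c centred at a converges
   absolutely at z, with sum s; under absolute convergence the sum may be taken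
   along squares. *)
Definition has_power_sum (R : realType) (c : nat -> nat -> R) (a z : R * R)
    (s : R) : Prop :=
  let t i j := c i j * (z.1 - a.1) ^+ i * (z.2 - a.2) ^+ j in
  summable [set: nat * nat] (fun k => (t k.1 k.2)%:E) /\
  (fun N : nat => \sum_(i < N) \sum_(j < N) t i j) @ \oo --> s.

Definition real_analytic (R : realType) (g : R * R -> R) : Prop :=
  forall a : R * R, exists2 r : R, 0 < r &
    exists c : nat -> nat -> R, forall z : R * R,
      `|z.1 - a.1| < r -> `|z.2 - a.2| < r -> has_power_sum c a z (g z).

(* Main.v *)
(* On the Fourier side the equation reads U = q^-1 V_0, where U is the transform
   of phi, V_0 that of f(phi) and q = 1 + |xi| + eta^2 / |xi|, so that U and
   xi U, eta U are dominated by V_0.  Since U has moments, phi agrees almost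
   everywhere with the continuous function g = (2 pi)^-2 \int U(w) e^{i w.z} dw.
   Let R_k = f^(k)(g) - f^(k)(0) - f^(k+1)(0) g, an integrable function, and
   V_k its transform.  Differentiating R_k in a coordinate direction e gives
     |w_e| |V_k(w)| <= C \int (|V_{k+1}(v)| + |f^(k+2)(0)| |U(v)|)
                              |(w - v)_e| |U(w - v)| dv,
   in which no power of w is lost on the right thanks to the domination by V_0.
   Iterating a few times in the sup norm gives \int |V_k| <= K B^k k!, and
   iterating in the L^1 norm gives
     \int |w_e|^n |V_k| <= K L^n B^k (n + k)! / (n + 1)^2.
   The case k = 0 bounds the n-th moments of U by K L^n n!, hence U decays
   exponentially in mean and g is the sum of its Taylor series. *)

Require Import Defs.
From HB Require Import structures.
From mathcomp Require Import all_boot all_order all_algebra.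
From mathcomp Require Import all_classical all_reals all_analysis.
From mathcomp Require Import measurable_realfun.
From mathcomp.real_closed Require Import complex.
From mathcomp Require Import ring lra.

Set Implicit Arguments.
Unset Strict Implicit.
Unset Printing Implicit Defensive.

Import Order.TTheory GRing.Theory Num.Theory.
Import numFieldNormedType.Exports.

Local Open Scope classical_set_scope.
Local Open Scope complex_scope.
Local Open Scope ring_scope.

(** * Real and complex integrals *)

(** The induction closes because each step trades one power of |w_e| for one derivative of f: the
    pair (n + 1, k) is controlled by (i, k + 1) and (i, 0) with i <= n. The sum n + k is kept, so (n
    + k)! is the natural size, and the binomial coefficients cancel against the factorials; L
    absorbs all constants. The linear Taylor part of f^(k)(g) is removed because g is only known to
    be bounded and square integrable, whereas the remainder is O(g^2). The growth condition with p >
    2 gives f(0) = f'(0) = 0, so that R_0 = f(g). The sup-norm rounds provide the start of the L^1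
    induction: a plain bound on V_k is not integrable on the plane, but bounds with the weights
    |xi|^4 and |eta|^4 give decay like 1 / ((1 + xi^2)(1 + eta^2)). They use the moments of U up to
    order 4, which H^8 supplies. The Fourier analysis rests on one explicit pair, e^{-e|x|} and the
    Poisson kernel: Plancherel and injectivity come from letting e tend to 0, inversion from the
    case e = 1. *)

Lemma normM_le_sqrD (R : realType) (a b : R) : `|a * b| <= a ^+ 2 + b ^+ 2.
Proof.
by rewrite ler_norml; apply/andP; split;
  have := sqr_ge0 (a - b); have := sqr_ge0 (a + b); nra.
Qed.

Definition rint d (T : measurableType d) (R : realType)
  (mu : {measure set T -> \bar R}) (f : T -> R) := mu.-integrable setT (EFin \o f).

Section real_integral.
Context d (T : measurableType d) (R : realType) (mu : {measure set T -> \bar R}).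
Implicit Types f g : T -> R.

Lemma ae_imp (P Q : T -> Prop) : {ae mu, forall x, P x} ->
  (forall x, P x -> Q x) -> {ae mu, forall x, Q x}.
Proof. by move=> aP PQ; apply: filterS aP. Qed.

Lemma ae_imp2 (P Q S : T -> Prop) : {ae mu, forall x, P x} ->
  {ae mu, forall x, Q x} -> (forall x, P x -> Q x -> S x) ->
  {ae mu, forall x, S x}.
Proof. by move=> aP aQ PQ; apply: filterS2 aP aQ. Qed.

Lemma ae_and (P Q : T -> Prop) : {ae mu, forall x, P x} ->
  {ae mu, forall x, Q x} -> {ae mu, forall x, P x /\ Q x}.
Proof. by move=> aP aQ; exact: (ae_imp2 aP aQ). Qed.

Lemma rint_meas f : rint mu f -> measurable_fun setT f.
Proof. by move/measurable_int/measurable_EFinP. Qed.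

Lemma rint_le f g : measurable_fun setT f -> rint mu g ->
  (forall x, `|f x| <= g x) -> rint mu f.
Proof.
move=> mf ig fg; apply: (le_integrable measurableT _ _ ig).
  exact/measurable_EFinP.
by move=> x _ /=; rewrite lee_fin (le_trans (fg x))// ler_norm.
Qed.

Lemma rintD f g : rint mu f -> rint mu g -> rint mu (fun x => f x + g x).
Proof. by move=> fi gi; exact: (integrableD measurableT fi gi). Qed.

Lemma rintB f g : rint mu f -> rint mu g -> rint mu (fun x => f x - g x).
Proof. by move=> fi gi; exact: (integrableB measurableT fi gi). Qed.

Lemma rintN f : rint mu f -> rint mu (fun x => - f x).
Proof. by move=> fi; exact: (integrableN fi). Qed.

Lemma rintZ a f : rint mu f -> rint mu (fun x => a * f x).
Proof. by move=> fi; exact: (integrableZl measurableT a fi). Qed.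

Lemma rint_norm f : rint mu f -> rint mu (fun x => `|f x|).
Proof. exact: integrable_norm. Qed.

Lemma rint0 : rint mu (fun=> 0).
Proof. exact: integrable0. Qed.

Lemma rint_EFin f : rint mu f ->
  (\int[mu]_x (f x)%:E = (\int[mu]_x f x)%:E)%E.
Proof. by move=> fi; rewrite /Rintegral fineK//; exact: integrable_fin_num. Qed.

Lemma rint_ge0P f : measurable_fun setT f -> (forall x, 0 <= f x) ->
  rint mu f <-> (\int[mu]_x (f x)%:E < +oo)%E.
Proof.
move=> mf f0; split=> [/integrableP[_]|h].
  by under eq_integral => x _ do rewrite /= ger0_norm//.
apply/integrableP; split; first exact/measurable_EFinP.
by under eq_integral => x _ do rewrite /= ger0_norm//.
Qed.

Lemma rint_ae_eq f g : {ae mu, forall x, f x = g x} ->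
  measurable_fun setT f -> measurable_fun setT g ->
  \int[mu]_x f x = \int[mu]_x g x.
Proof.
move=> fg mf mg; rewrite /Rintegral; congr fine.
apply: (@ae_eq_integral _ _ _ mu setT (EFin \o g) (EFin \o f)) => //.
- exact/measurable_EFinP.
- exact/measurable_EFinP.
- by apply: filterS fg => x /= ->.
Qed.

Lemma rint_ae f g : {ae mu, forall x, f x = g x} ->
  measurable_fun setT g -> rint mu f -> rint mu g.
Proof.
move=> fg mg fi; apply/integrableP; split; first exact/measurable_EFinP.
have /integrableP[mf] := fi.
rewrite (@ae_eq_integral _ _ _ mu setT (fun x => `|(EFin \o g) x|%E))//.
- exact: measurableT_comp.
- by apply: measurableT_comp => //; exact/measurable_EFinP.
- by apply: filterS fg => x /= ->.
Qed.

(* AM-GM in place of the Cauchy-Schwarz inequality *)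
Lemma rint_sqr_mul f g : measurable_fun setT f -> measurable_fun setT g ->
  rint mu (fun x => f x ^+ 2) -> rint mu (fun x => g x ^+ 2) ->
  rint mu (fun x => f x * g x).
Proof.
move=> mf mg fi gi; apply: (rint_le _ (rintD fi gi)).
  exact: measurable_funM.
by move=> x; exact: normM_le_sqrD.
Qed.

Lemma rint_indic (A : set T) : measurable A -> (mu A < +oo)%E -> rint mu (\1_A).
Proof.
move=> mA Aoo; apply/rint_ge0P => //.
by rewrite integral_indic// setIT.
Qed.

Lemma rint_restrict (D : set T) f : measurable D -> rint mu f ->
  rint mu (fun x => f x * \1_D x).
Proof.
move=> mD fi; apply: (rint_le _ (rint_norm fi)).
  by apply: measurable_funM; [exact: rint_meas fi|exact: measurable_indic].
move=> x; rewrite normrM ler_piMr//.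
by rewrite indicE; case: (_ \in _); rewrite ?normr1 ?normr0.
Qed.

Lemma rintegral_restrict (D : set T) f : measurable D ->
  \int[mu]_(x in D) f x = \int[mu]_x (f x * \1_D x).
Proof.
move=> mD; rewrite Rintegral_mkcond; apply: eq_Rintegral => x _.
by rewrite patchE indicE; case: (_ \in _); rewrite ?mulr1 ?mulr0.
Qed.

Lemma rdct (F : nat -> T -> R) (f g : T -> R) :
  (forall n, measurable_fun setT (F n)) -> measurable_fun setT f ->
  {ae mu, forall x, F n x @[n --> \oo] --> f x} -> rint mu g ->
  (forall n x, `|F n x| <= g x) ->
  [/\ rint mu f, \int[mu]_x `|F n x - f x| @[n --> \oo] --> 0 &
      \int[mu]_x F n x @[n --> \oo] --> \int[mu]_x f x].
Proof.
move=> mF mf cF ig Fg.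
have [] := @dominated_convergence _ _ _ mu setT measurableT
  (fun n x => (F n x)%:E) (EFin \o f) (EFin \o g).
- by move=> n; exact/measurable_EFinP.
- exact/measurable_EFinP.
- apply: filterS cF => x Fx _; apply: cvg_EFin; first exact: nearW.
  exact: Fx.
- exact: ig.
- by apply: nearW => x n _ /=; rewrite lee_fin.
move=> fi h1 h2; split => //.
- rewrite /Rintegral; have -> : 0 = fine (0 : \bar R)%E by [].
  apply: fine_cvg; apply: cvg_trans h1; apply: near_eq_cvg; apply: nearW => n.
  exact: eq_integral.
- rewrite /Rintegral; apply: fine_cvg.
  rewrite fineK; last exact: integrable_fin_num.
  exact: h2.
Qed.

Lemma rdct_cvg (F : nat -> T -> R) (f g : T -> R) :
  (forall n, measurable_fun setT (F n)) -> measurable_fun setT f ->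
  {ae mu, forall x, F n x @[n --> \oo] --> f x} -> rint mu g ->
  (forall n x, `|F n x| <= g x) ->
  \int[mu]_x F n x @[n --> \oo] --> \int[mu]_x f x.
Proof. by move=> mF mf cF ig Fg; have [] := rdct mF mf cF ig Fg. Qed.

(** An integrable extended-real function is finite almost everywhere, so [fine] alters it on a null
    set only. This turns the extended-real Fubini statements into real ones. *)
Lemma rint_fine (F : T -> \bar R) : mu.-integrable setT F ->
  rint mu (fine \o F) /\ \int[mu]_x (fine (F x)) = fine (\int[mu]_x F x)%E.
Proof.
move=> Fi; have mF := measurable_int _ Fi.
have mR : measurable_fun setT (EFin \o (fine \o F)).
  by apply/measurable_EFinP; exact: measurableT_comp.
have aeE : ae_eq mu setT F (EFin \o (fine \o F)).
  have := integrable_ae measurableT Fi.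
  by apply: filterS => x /= /(_ I) h _; rewrite fineK.
split.
  apply/integrableP; split => //.
  have /integrableP[_] := Fi.
  by rewrite (@ae_eq_integral _ _ _ mu setT (abse \o (EFin \o (fine \o F)))
    (abse \o F))//; [exact: measurableT_comp|exact: measurableT_comp|
    exact: ae_eq_abse].
rewrite /Rintegral; congr fine; apply/esym.
exact: (@ae_eq_integral _ _ _ mu setT (EFin \o (fine \o F)) F).
Qed.

End real_integral.

Section fubini_real.
Context d1 d2 (T1 : measurableType d1) (T2 : measurableType d2) (R : realType).
Variables (m1 : {sigma_finite_measure set T1 -> \bar R})
          (m2 : {sigma_finite_measure set T2 -> \bar R}).
Implicit Type f : T1 * T2 -> R.

Lemma rfubini1 f : rint (m1 \x m2)%E f ->
  rint m1 (fun x => \int[m2]_y f (x, y)) /\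
  \int[m1]_x (\int[m2]_y f (x, y)) = \int[(m1 \x m2)%E]_z f z.
Proof.
move=> fi; have [h1 h2] := rint_fine (integrable_fubini_F fi).
by split; [exact: h1|rewrite [LHS]h2 integral12_prod_meas1].
Qed.

Lemma integrable_fubini_G (f : T1 * T2 -> \bar R) :
  (m1 \x m2)%E.-integrable setT f -> m2.-integrable setT (fubini_G m1 f).
Proof.
move=> fi; have mf := measurable_int _ fi.
have /(integrable21ltyP _ _ mf) fi' := fi.
have mn : measurable_fun setT (fun y => \int[m1]_x `|f (x, y)|)%E.
  apply: (measurable_fun_fubini_tonelli_G (abse \o f)) => //=.
  exact: measurableT_comp.
have mG := measurable_fubini_G fi.
apply/integrableP; split; first exact: mG.
apply: le_lt_trans fi'; apply: ge0_le_integral => //.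
- by apply: measurableT_comp mG.
- move=> y _; apply: le_abse_integral => //.
  exact: measurableT_comp mf (pair2_measurable y).
Qed.

Lemma rfubini2 f : rint (m1 \x m2)%E f ->
  rint m2 (fun y => \int[m1]_x f (x, y)) /\
  \int[m2]_y (\int[m1]_x f (x, y)) = \int[(m1 \x m2)%E]_z f z.
Proof.
move=> fi; have [h1 h2] := rint_fine (integrable_fubini_G fi).
by split; [exact: h1|rewrite [LHS]h2 integral21_prod_meas1].
Qed.

Lemma rfubini f : rint (m1 \x m2)%E f ->
  \int[m1]_x (\int[m2]_y f (x, y)) = \int[m2]_y (\int[m1]_x f (x, y)).
Proof. by move=> fi; rewrite (rfubini1 fi).2 (rfubini2 fi).2. Qed.

Lemma rint_prod (f : T1 -> R) (g : T2 -> R) : rint m1 f -> rint m2 g ->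
  rint (m1 \x m2)%E (fun z => f z.1 * g z.2).
Proof.
move=> fi gi.
have mfg : measurable_fun setT (fun z : T1 * T2 => f z.1 * g z.2).
  apply: measurable_funM.
    exact: (measurableT_comp (rint_meas fi)).
  exact: (measurableT_comp (rint_meas gi)).
apply/integrable12ltyP; first exact/measurable_EFinP.
have mng : measurable_fun setT (fun y => `|g y|%:E).
  by apply/measurable_EFinP; exact: measurableT_comp (rint_meas gi).
have mnf : measurable_fun setT (fun x => `|f x|%:E).
  by apply/measurable_EFinP; exact: measurableT_comp (rint_meas fi).
rewrite (eq_integral (fun x => (\int[m2]_y `|g y|)%:E * `|f x|%:E)%E); last first.
  move=> x _ /=; under eq_integral do rewrite normrM EFinM.
  by rewrite ge0_integralZl// (rint_EFin (rint_norm gi)) muleC.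
rewrite ge0_integralZl//; last by rewrite lee_fin; exact: Rintegral_ge0.
by rewrite (rint_EFin (rint_norm fi)) -EFinM ltry.
Qed.

Lemma rintegral_prod (f : T1 -> R) (g : T2 -> R) : rint m1 f -> rint m2 g ->
  \int[(m1 \x m2)%E]_z (f z.1 * g z.2) = (\int[m1]_x f x) * (\int[m2]_y g y).
Proof.
move=> fi gi; rewrite -(rfubini1 (rint_prod fi gi)).2 /=.
under eq_Rintegral do rewrite RintegralZl//.
by rewrite RintegralZr.
Qed.

End fubini_real.

(** * Complex numbers through their real and imaginary parts *)

Section complex_algebra.
Context (R : realType).
Implicit Types z w : R[i].

(** The l^1 norm of the components, equivalent to the modulus, so that integrability and integral
    inequalities follow component by component. It is only submultiplicative, and a character
    [expi t] is bounded by 2 in it: hence the factors 2 in later estimates. The squared modulus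
    [csq] serves where exact identities are needed. *)
Definition cnorm1 z : R := `|complex.Re z| + `|complex.Im z|.

Definition csq z : R := complex.Re z ^+ 2 + complex.Im z ^+ 2.

Definition expi (t : R) : R[i] := cos t +i* sin t.

Lemma cReM z w : complex.Re (z * w) =
  complex.Re z * complex.Re w - complex.Im z * complex.Im w.
Proof. by case: z w => a b [c d]. Qed.

Lemma cImM z w : complex.Im (z * w) =
  complex.Re z * complex.Im w + complex.Im z * complex.Re w.
Proof. by case: z w => a b [c d]. Qed.

Lemma cReD z w : complex.Re (z + w) = complex.Re z + complex.Re w.
Proof. by case: z w => a b [c d]. Qed.

Lemma cImD z w : complex.Im (z + w) = complex.Im z + complex.Im w.
Proof. by case: z w => a b [c d]. Qed.

Lemma cReN z : complex.Re (- z) = - complex.Re z.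
Proof. by case: z. Qed.

Lemma cImN z : complex.Im (- z) = - complex.Im z.
Proof. by case: z. Qed.

Lemma complex_ext z w : complex.Re z = complex.Re w ->
  complex.Im z = complex.Im w -> z = w.
Proof. by case: z w => a b [c d] /= -> ->. Qed.

Lemma cnorm1_ge0 z : 0 <= cnorm1 z.
Proof. by rewrite addr_ge0. Qed.

Lemma cnorm1_0 : cnorm1 0 = 0.
Proof. by rewrite /cnorm1 /= normr0 addr0. Qed.

Lemma Re_le_cnorm1 z : `|complex.Re z| <= cnorm1 z.
Proof. by rewrite lerDl. Qed.

Lemma Im_le_cnorm1 z : `|complex.Im z| <= cnorm1 z.
Proof. by rewrite lerDr. Qed.

Lemma cnorm1M z w : cnorm1 (z * w) <= cnorm1 z * cnorm1 w.
Proof.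
rewrite /cnorm1 cReM cImM.
apply: le_trans (lerD (ler_normB _ _) (ler_normD _ _)) _.
by rewrite !normrM; lra.
Qed.

Lemma cnorm1D z w : cnorm1 (z + w) <= cnorm1 z + cnorm1 w.
Proof.
rewrite /cnorm1 cReD cImD; apply: le_trans (lerD (ler_normD _ _) (ler_normD _ _)) _.
by lra.
Qed.

Lemma cnorm1ZR (a : R) z : cnorm1 (a%:C * z) = `|a| * cnorm1 z.
Proof. by rewrite /cnorm1 cReM cImM /= !mul0r subr0 addr0 !normrM mulrDr. Qed.

Lemma cnorm1_iM z : cnorm1 ('i%C * z) = cnorm1 z.
Proof. by rewrite /cnorm1 cReM cImM /= !mul0r !mul1r sub0r add0r normrN addrC. Qed.

Lemma cnorm1_real (a : R) : cnorm1 a%:C = `|a|.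
Proof. by rewrite /cnorm1 /= normr0 addr0. Qed.

Lemma cnorm1_conj z : cnorm1 z^*%C = cnorm1 z.
Proof. by case: z => a b; rewrite /cnorm1 /= normrN. Qed.

Lemma csq_ge0 z : 0 <= csq z.
Proof. by rewrite addr_ge0 ?sqr_ge0. Qed.

Lemma csqM z w : csq (z * w) = csq z * csq w.
Proof. by rewrite /csq cReM cImM; ring. Qed.

Lemma csqZR (a : R) z : csq (a%:C * z) = a ^+ 2 * csq z.
Proof. by rewrite /csq cReM cImM /=; ring. Qed.

Lemma csq_conj z : csq z^*%C = csq z.
Proof. by case: z => a b; rewrite /csq /= sqrrN. Qed.

Lemma csq_real (a : R) : csq a%:C = a ^+ 2.
Proof. by rewrite /csq /= expr0n /= addr0. Qed.

Lemma csq_eq0 z : csq z = 0 -> z = 0.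
Proof.
move/eqP; rewrite paddr_eq0 ?sqr_ge0// !sqrf_eq0 => /andP[/eqP a0 /eqP b0].
exact: complex_ext.
Qed.

Lemma csq_le_cnorm1 z : csq z <= cnorm1 z ^+ 2.
Proof.
rewrite /csq /cnorm1 sqrrD !real_normK ?num_real//.
by rewrite lerD2r lerDl mulrn_wge0// mulr_ge0.
Qed.

Lemma cnorm1_le_csq z : cnorm1 z ^+ 2 <= 2 * csq z.
Proof.
have := sqr_ge0 (`|complex.Re z| - `|complex.Im z|).
rewrite /csq /cnorm1 sqrrB sqrrD !real_normK ?num_real//; lra.
Qed.

Lemma csq_mulJ z : z * z^*%C = (csq z)%:C.
Proof.
by case: z => a b; apply: complex_ext; rewrite ?cReM ?cImM /csq /=; ring.
Qed.

Lemma cRe_conj z : complex.Re z^*%C = complex.Re z.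
Proof. by case: z. Qed.

Lemma cIm_conj z : complex.Im z^*%C = - complex.Im z.
Proof. by case: z. Qed.

Lemma cconjM z w : (z * w)^*%C = z^*%C * w^*%C.
Proof. by apply: complex_ext; rewrite ?(cReM, cImM, cRe_conj, cIm_conj); ring. Qed.

Lemma expi0 : expi 0 = 1.
Proof. by rewrite /expi cos0 sin0. Qed.

Lemma expiD s t : expi (s + t) = expi s * expi t.
Proof.
apply: complex_ext; rewrite ?cReM ?cImM /= ?cosD ?sinD//.
by rewrite addrC [X in X + _]mulrC [X in _ + X]mulrC addrC mulrC [X in _ + X]mulrC.
Qed.

Lemma expiN t : expi (- t) = (expi t)^*%C.
Proof. by apply: complex_ext; rewrite /= ?cosN ?sinN. Qed.

Lemma csq_expi t : csq (expi t) = 1.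
Proof. exact: cos2Dsin2. Qed.

Lemma cnorm1_expi t : cnorm1 (expi t) <= 2.
Proof.
rewrite -[2]/(1 + 1) lerD// ler_norml; apply/andP; split.
- exact: cos_geN1.
- exact: cos_le1.
- exact: sin_geN1.
- exact: sin_le1.
Qed.

End complex_algebra.

Section complex_integral.
Context d (T : measurableType d) (R : realType).
Implicit Types F G : T -> R[i].

Definition cmfun F := measurable_fun setT (fun x => complex.Re (F x)) /\
  measurable_fun setT (fun x => complex.Im (F x)).

Definition cinteg (mu : {measure set T -> \bar R}) F :=
  rint mu (fun x => complex.Re (F x)) /\ rint mu (fun x => complex.Im (F x)).

Definition cint (mu : {measure set T -> \bar R}) F : R[i] :=
  (\int[mu]_x complex.Re (F x)) +i* (\int[mu]_x complex.Im (F x)).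

Lemma cmfunM F G : cmfun F -> cmfun G -> cmfun (fun x => F x * G x).
Proof.
move=> [rF iF] [rG iG]; split.
- under eq_fun do rewrite cReM.
  by apply: measurable_funB; apply: measurable_funM.
- under eq_fun do rewrite cImM.
  by apply: measurable_funD; apply: measurable_funM.
Qed.

Lemma cmfunD F G : cmfun F -> cmfun G -> cmfun (fun x => F x + G x).
Proof.
move=> [rF iF] [rG iG]; split.
- by under eq_fun do rewrite cReD; apply: measurable_funD.
- by under eq_fun do rewrite cImD; apply: measurable_funD.
Qed.

Lemma cmfunN F : cmfun F -> cmfun (fun x => - F x).
Proof.
move=> [rF iF]; split.
- by under eq_fun do rewrite cReN; apply: measurableT_comp.
- by under eq_fun do rewrite cImN; apply: measurableT_comp.
Qed.

Lemma cmfunB F G : cmfun F -> cmfun G -> cmfun (fun x => F x - G x).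
Proof. by move=> mF mG; apply: cmfunD => //; exact: cmfunN. Qed.

Lemma cmfun_conj F : cmfun F -> cmfun (fun x => (F x)^*%C).
Proof.
move=> [rF iF]; split.
- by under eq_fun do rewrite cRe_conj.
- by under eq_fun do rewrite cIm_conj; apply: measurableT_comp.
Qed.

Lemma cmfun_cst z : cmfun (fun=> z).
Proof. by split; exact: measurable_cst. Qed.

Lemma cmfun_real (f : T -> R) : measurable_fun setT f ->
  cmfun (fun x => (f x)%:C).
Proof. by move=> mf; split => //=; exact: measurable_cst. Qed.

Lemma cmfun_expi (f : T -> R) : measurable_fun setT f ->
  cmfun (fun x => expi (f x)).
Proof.
move=> mf; split => /=; apply: measurableT_comp mf; apply: continuous_measurable_fun.
- exact: continuous_cos.
- exact: continuous_sin.
Qed.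

Lemma cmfun_cnorm1 F : cmfun F -> measurable_fun setT (fun x => cnorm1 (F x)).
Proof.
by move=> [rF iF]; apply: measurable_funD; exact: measurableT_comp.
Qed.

Lemma cmfun_csq F : cmfun F -> measurable_fun setT (fun x => csq (F x)).
Proof.
by move=> [rF iF]; apply: measurable_funD; exact: measurable_funX.
Qed.

Section one_measure.
Variable mu : {measure set T -> \bar R}.

Lemma cinteg_meas F : cinteg mu F -> cmfun F.
Proof. by move=> [/rint_meas ? /rint_meas ?]. Qed.

Lemma cinteg_cnorm1 F : cinteg mu F -> rint mu (fun x => cnorm1 (F x)).
Proof. by move=> [rF iF]; apply: rintD; exact: rint_norm. Qed.

Lemma cinteg_le F g : cmfun F -> rint mu g -> (forall x, cnorm1 (F x) <= g x) ->
  cinteg mu F.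
Proof.
move=> [rF iF] ig Fg; split; apply: (rint_le _ ig) => // x.
- exact: le_trans (Re_le_cnorm1 _) (Fg _).
- exact: le_trans (Im_le_cnorm1 _) (Fg _).
Qed.

Lemma cinteg_real (f : T -> R) : rint mu f -> cinteg mu (fun x => (f x)%:C).
Proof. by move=> fi; split => //=; exact: rint0. Qed.

Lemma cintegM_bnd F G M : cinteg mu F -> cmfun G ->
  (forall x, cnorm1 (G x) <= M) -> cinteg mu (fun x => F x * G x).
Proof.
move=> iF mG GM; apply: (cinteg_le _ (rintZ M (cinteg_cnorm1 iF))).
  by apply: cmfunM => //; exact: cinteg_meas iF.
move=> x; rewrite (le_trans (cnorm1M _ _))// mulrC ler_wpM2r//.
exact: cnorm1_ge0.
Qed.

Lemma cinteg_expi F (f : T -> R) : cinteg mu F -> measurable_fun setT f ->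
  cinteg mu (fun x => F x * expi (f x)).
Proof.
move=> iF mf; apply: (cintegM_bnd iF (cmfun_expi mf)) => x.
exact: cnorm1_expi.
Qed.

Lemma cintegD F G : cinteg mu F -> cinteg mu G ->
  cinteg mu (fun x => F x + G x).
Proof.
move=> [rF iF] [rG iG]; split.
- by under eq_fun do rewrite cReD; apply: rintD.
- by under eq_fun do rewrite cImD; apply: rintD.
Qed.

Lemma cintegN F : cinteg mu F -> cinteg mu (fun x => - F x).
Proof.
move=> [rF iF]; split.
- by under eq_fun do rewrite cReN; apply: rintN.
- by under eq_fun do rewrite cImN; apply: rintN.
Qed.

Lemma cintegB F G : cinteg mu F -> cinteg mu G ->
  cinteg mu (fun x => F x - G x).
Proof. by move=> iF iG; apply: cintegD => //; exact: cintegN. Qed.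

Lemma cintegZ z F : cinteg mu F -> cinteg mu (fun x => z * F x).
Proof.
move=> iF; under eq_fun do rewrite mulrC.
by apply: (@cintegM_bnd F (fun=> z) (cnorm1 z)) => //; exact: cmfun_cst.
Qed.

Lemma cinteg_conj F : cinteg mu F -> cinteg mu (fun x => (F x)^*%C).
Proof.
move=> [rF iF]; split.
- by under eq_fun do rewrite cRe_conj.
- by under eq_fun do rewrite cIm_conj; exact: rintN.
Qed.

Lemma cintD F G : cinteg mu F -> cinteg mu G ->
  cint mu (fun x => F x + G x) = cint mu F + cint mu G.
Proof.
move=> [rF iF] [rG iG]; apply: complex_ext; rewrite /cint/=.
- by under eq_Rintegral do rewrite cReD; rewrite RintegralD.
- by under eq_Rintegral do rewrite cImD; rewrite RintegralD.
Qed.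

Lemma cintZ z F : cinteg mu F -> cint mu (fun x => z * F x) = z * cint mu F.
Proof.
move=> [rF iF]; apply: complex_ext; rewrite ?cReM ?cImM /cint/=.
- under eq_Rintegral do rewrite cReM.
  by rewrite RintegralB ?RintegralZl//; exact: rintZ.
- under eq_Rintegral do rewrite cImM.
  by rewrite RintegralD ?RintegralZl//; exact: rintZ.
Qed.

Lemma cintZr z F : cinteg mu F -> cint mu (fun x => F x * z) = cint mu F * z.
Proof. by move=> iF; rewrite mulrC -cintZ//; under eq_fun do rewrite mulrC. Qed.

Lemma cintN F : cinteg mu F -> cint mu (fun x => - F x) = - cint mu F.
Proof.
by move=> iF; under eq_fun do rewrite -mulN1r; rewrite cintZ// mulN1r.
Qed.

Lemma cintB F G : cinteg mu F -> cinteg mu G ->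
  cint mu (fun x => F x - G x) = cint mu F - cint mu G.
Proof. by move=> iF iG; rewrite cintD ?cintN//; exact: cintegN. Qed.

Lemma cint_conj F : cinteg mu F ->
  cint mu (fun x => (F x)^*%C) = (cint mu F)^*%C.
Proof.
move=> [rF iF]; apply: complex_ext; rewrite /cint/=.
- by under eq_Rintegral do rewrite cRe_conj.
- under eq_Rintegral do rewrite cIm_conj -mulN1r.
  by rewrite RintegralZl// mulN1r.
Qed.

Lemma cnorm1_cint F : cinteg mu F ->
  cnorm1 (cint mu F) <= \int[mu]_x cnorm1 (F x).
Proof.
move=> [rF iF]; rewrite RintegralD//; [|exact: rint_norm|exact: rint_norm].
by rewrite /cnorm1/= lerD//; exact: le_normr_Rintegral.
Qed.

Lemma cint_ae_eq F G : {ae mu, forall x, F x = G x} -> cmfun F -> cmfun G ->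
  cint mu F = cint mu G.
Proof.
move=> FG [rF iF] [rG iG]; congr (_ +i* _); apply: rint_ae_eq => //.
- by apply: filterS FG => x ->.
- by apply: filterS FG => x ->.
Qed.

Lemma cint_real (f : T -> R) : cint mu (fun x => (f x)%:C) = (\int[mu]_x f x)%:C.
Proof.
by apply: complex_ext => //=; rewrite Rintegral_cst// mul0r.
Qed.

Lemma cint_sum (I : Type) (s : seq I) (F : I -> T -> R[i]) :
  (forall i, cinteg mu (F i)) ->
  cinteg mu (fun x => \sum_(i <- s) F i x) /\
  cint mu (fun x => \sum_(i <- s) F i x) = \sum_(i <- s) cint mu (F i).
Proof.
move=> iF; elim: s => [|i s [ih1 ih2]].
  under eq_fun do rewrite big_nil.
  split; first by split; exact: rint0.
  by rewrite big_nil (cint_real (fun=> 0)) Rintegral_cst// mul0r.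
under eq_fun do rewrite big_cons; split; first exact: cintegD.
by rewrite cintD// ih2 big_cons.
Qed.

(** Convergence of complex sequences is expressed throughout by that of both parts; [cnorm1]
    dominates each of them. *)
Lemma cdct (F : nat -> T -> R[i]) (f : T -> R[i]) (g : T -> R) :
  (forall n, cmfun (F n)) -> cmfun f ->
  {ae mu, forall x, complex.Re (F n x) @[n --> \oo] --> complex.Re (f x) /\
    complex.Im (F n x) @[n --> \oo] --> complex.Im (f x)} -> rint mu g ->
  (forall n x, cnorm1 (F n x) <= g x) ->
  complex.Re (cint mu (F n)) @[n --> \oo] --> complex.Re (cint mu f) /\
  complex.Im (cint mu (F n)) @[n --> \oo] --> complex.Im (cint mu f).
Proof.
move=> mF mf cF ig Fg; rewrite /cint/=; split.
- apply: (rdct_cvg _ _ _ ig).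
  + by move=> n; case: (mF n).
  + by case: mf.
  + by apply: filterS cF => x [].
  + by move=> n x; exact: le_trans (Re_le_cnorm1 _) (Fg _ _).
- apply: (rdct_cvg _ _ _ ig).
  + by move=> n; case: (mF n).
  + by case: mf.
  + by apply: filterS cF => x [].
  + by move=> n x; exact: le_trans (Im_le_cnorm1 _) (Fg _ _).
Qed.

End one_measure.
End complex_integral.

Lemma cmfun_comp d1 d2 (T1 : measurableType d1) (T2 : measurableType d2)
    (R : realType) (F : T2 -> R[i]) (h : T1 -> T2) :
  cmfun F -> measurable_fun setT h -> cmfun (fun x => F (h x)).
Proof.
by move=> [rF iF] mh; split; [exact: measurableT_comp rF mh
                             |exact: measurableT_comp iF mh].
Qed.

Section fubini_complex.
Context d1 d2 (T1 : measurableType d1) (T2 : measurableType d2) (R : realType).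
Variables (m1 : {sigma_finite_measure set T1 -> \bar R})
          (m2 : {sigma_finite_measure set T2 -> \bar R}).
Implicit Type F : T1 * T2 -> R[i].

Lemma cfubini1 F : cinteg (m1 \x m2)%E F ->
  cinteg m1 (fun x => cint m2 (fun y => F (x, y))) /\
  cint m1 (fun x => cint m2 (fun y => F (x, y))) = cint (m1 \x m2)%E F.
Proof.
move=> [/rfubini1[rF1 rF2] /rfubini1[iF1 iF2]].
by split => //; congr (_ +i* _).
Qed.

Lemma cfubini2 F : cinteg (m1 \x m2)%E F ->
  cinteg m2 (fun y => cint m1 (fun x => F (x, y))) /\
  cint m2 (fun y => cint m1 (fun x => F (x, y))) = cint (m1 \x m2)%E F.
Proof.
move=> [/rfubini2[rF1 rF2] /rfubini2[iF1 iF2]].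
by split => //; congr (_ +i* _).
Qed.

Lemma cfubini F : cinteg (m1 \x m2)%E F ->
  cint m1 (fun x => cint m2 (fun y => F (x, y))) =
  cint m2 (fun y => cint m1 (fun x => F (x, y))).
Proof. by move=> iF; rewrite (cfubini1 iF).2 (cfubini2 iF).2. Qed.

Lemma cinteg_prod (F : T1 -> R[i]) (G : T2 -> R[i]) :
  cinteg m1 F -> cinteg m2 G -> cinteg (m1 \x m2)%E (fun z => F z.1 * G z.2).
Proof.
move=> iF iG.
apply: (cinteg_le _ (rint_prod (cinteg_cnorm1 iF) (cinteg_cnorm1 iG))).
  apply: cmfunM.
    exact: cmfun_comp (cinteg_meas iF) measurable_fst.
  exact: cmfun_comp (cinteg_meas iG) measurable_snd.
by move=> z; exact: cnorm1M.
Qed.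

Lemma cint_prod (F : T1 -> R[i]) (G : T2 -> R[i]) :
  cinteg m1 F -> cinteg m2 G ->
  cint (m1 \x m2)%E (fun z => F z.1 * G z.2) = cint m1 F * cint m2 G.
Proof.
move=> iF iG; rewrite -(cfubini1 (cinteg_prod iF iG)).2 /=.
by under eq_fun do rewrite cintZ//; rewrite cintZr.
Qed.

End fubini_complex.

(** * Lebesgue measure on the plane *)

(** Products of two increasing exhaustions work: a point entering the first at stage n and the
    second at stage k has entered both at stage [maxn n k]. *)
Lemma sigma_finite_product_measure1 d1 d2 (T1 : measurableType d1)
    (T2 : measurableType d2) (R : realType)
    (m1 : {sigma_finite_measure set T1 -> \bar R})
    (m2 : {sigma_finite_measure set T2 -> \bar R}) :
  sigma_finite setT (m1 \x m2)%E.
Proof.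
have /sigma_finiteP[F [TF ndF Foo]] := sigma_finiteT m1.
have /sigma_finiteP[G [TG ndG Goo]] := sigma_finiteT m2.
exists (fun n => F n `*` G n).
  rewrite -setXTT TF TG predeqE => -[x y]; split.
    move=> [/= [n _ Fnx] [k _ Gky]]; exists (maxn n k) => //; split.
    - by move: x Fnx; exact/subsetPset/ndF/leq_maxl.
    - by move: y Gky; exact/subsetPset/ndG/leq_maxr.
  by move=> [n _ []/= ? ?]; split; exists n.
move=> k; have [? ?] := Foo k; have [? ?] := Goo k.
split; first exact: measurableX.
by rewrite product_measure1E// lte_mul_pinfty// ge0_fin_numE.
Qed.

(* mu2 R, which it is convertible to, packed with sigma-finiteness *)
Definition lebesgue2 (R : realType) :
    {sigma_finite_measure set (measurableTypeR R * measurableTypeR R)%type -> \bar R} :=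
  HB.pack (mu2 R) (Measure_isSigmaFinite.Build _ _ _ (mu2 R)
    (sigma_finite_product_measure1 _ _)).

Section affine_change_of_variables.
Context {R : realType}.
Notation leb := (@lebesgue_measure R).

Definition affine_map (a b : R) (x : measurableTypeR R) : measurableTypeR R :=
  b + a * x.

Lemma measurable_affine_map a b : measurable_fun setT (affine_map a b).
Proof. by apply: measurable_funD => //; exact: measurable_funM. Qed.

Let push a b : {measure set (measurableTypeR R) -> \bar R} :=
  measure_function_pushforward__canonical__measure_function_Measure leb
    (measurable_affine_map a b).

(** By uniqueness of Lebesgue measure it suffices to compare half-open intervals. For a < 0 the
    preimage of an interval open on the left is one open on the right, which has the same measure as
    its mirror image. *)
Lemma lebesgue_measure_affine (a b : R) (A : set R) : a != 0 -> measurable A ->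
  leb A = mscale (`|a|%:nng) (push a b) A.
Proof.
move=> a0 mA; apply: lebesgue_measure_unique => // _ [[c d]] _ <-.
rewrite -[RHS]/(`|a|%:E * leb (affine_map a b @^-1` `]c, d]))%E.
have [ap|an] : (0 < a) \/ (a < 0).
  by case: (ltgtP a 0) a0 => //; [right|left].
- rewrite [X in (_ * leb X)%E](_ : _ = `](c - b) / a, (d - b) / a]%classic); last first.
    apply/seteqP; split=> x /=; rewrite /affine_map !in_itv/=.
      by rewrite ltr_pdivrMr// ler_pdivlMr// ltrBlDl lerBrDl ![_ * a]mulrC.
    by rewrite ltr_pdivrMr// ler_pdivlMr// ltrBlDl lerBrDl ![_ * a]mulrC.
  rewrite !lebesgue_measure_itv/= !lte_fin ltr_pM2r ?invr_gt0// ltrD2r.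
  case: ifP => _; last by rewrite mule0.
  rewrite -EFinD -EFinM gtr0_norm//; congr (_%:E).
  by rewrite mulrBr !mulrA ![a * _]mulrC !mulfK//; ring.
- rewrite [X in (_ * leb X)%E](_ : _ = `[(d - b) / a, (c - b) / a[%classic); last first.
    apply/seteqP; split=> x /=; rewrite /affine_map !in_itv/=.
      by rewrite ler_ndivrMr// ltr_ndivlMr// ltrBlDl lerBrDl ![_ * a]mulrC andbC.
    by rewrite ler_ndivrMr// ltr_ndivlMr// ltrBlDl lerBrDl ![_ * a]mulrC andbC.
  rewrite !lebesgue_measure_itv/= !lte_fin ltr_nM2r ?invr_lt0// ltrD2r.
  case: ifP => _; last by rewrite mule0.
  rewrite -EFinD -EFinM ltr0_norm//; congr (_%:E).
  by field.
Qed.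

Lemma ge0_integral_affine (a b : R) (f : R -> \bar R) : a != 0 ->
  measurable_fun setT f -> (forall x, 0 <= f x)%E ->
  (`|a|%:E * \int[leb]_x f (b + a * x)%R = \int[leb]_x f x)%E.
Proof.
move=> a0 mf f0.
rewrite [RHS](@eq_measure_integral _ _ _ _
  (mscale (`|a|%:nng) (push a b))); last first.
  by move=> A mA _; exact: lebesgue_measure_affine.
rewrite ge0_integral_mscale//= ge0_integral_pushforward//.
exact: measurable_affine_map.
Qed.

Lemma ge0_integral_affine2 (a : R) (b : R * R) (f : R * R -> \bar R) : a != 0 ->
  measurable_fun setT f -> (forall x, 0 <= f x)%E ->
  ((a ^+ 2)%:E * \int[mu2 R]_z f ((b.1 + a * z.1)%R, (b.2 + a * z.2)%R) =
   \int[mu2 R]_z f z)%E.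
Proof.
move=> a0 mf f0.
have mg : measurable_fun setT (fun z : R * R => f (b.1 + a * z.1, b.2 + a * z.2)).
  apply: measurableT_comp mf _; apply/measurable_fun_pairP; split => /=.
    by apply: measurable_funD => //; apply: measurable_funM.
  by apply: measurable_funD => //; apply: measurable_funM.
rewrite !fubini_tonelli1//=.
have m1 x : measurable_fun setT (fun y => f (x, y)).
  exact: measurableT_comp mf (pair1_measurable x).
have mF : measurable_fun setT (fun x => \int[leb]_y f (x, y))%E.
  exact: measurable_fun_fubini_tonelli_F.
rewrite -(@ge0_integral_affine a b.1 (fun x => \int[leb]_y f (x, y))%E)//; last first.
  by move=> x; exact: integral_ge0.
rewrite -(normr_idP (sqr_ge0 a)) normrX expr2 EFinM -muleA; congr (_ * _)%E.
rewrite -ge0_integralZl//=.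
- by apply: eq_integral => x _; exact: (@ge0_integral_affine a b.2 (fun y => f (_, y))).
- exact: (@measurable_fun_fubini_tonelli_F _ _ (measurableTypeR R)
    (measurableTypeR R) R leb _ mg (fun _ => f0 _)).
- by move=> x _; exact: integral_ge0.
Qed.

End affine_change_of_variables.

Section affine_real.
Context {R : realType}.
Notation m2 := (lebesgue2 R).
Implicit Type f : R * R -> R.

(** A dilation followed by a translation. With [a = -1] it is the difference [b - z] of a
    convolution, with [a = 1] a translation, and with small [a] a point near [b]. *)
Definition aff2 (a : R) (b z : R * R) : R * R := (b.1 + a * z.1, b.2 + a * z.2).

Lemma measurable_aff2 a b : measurable_fun setT (aff2 a b).
Proof.
apply/measurable_fun_pairP; split => /=.
  by apply: measurable_funD => //; apply: measurable_funM.
by apply: measurable_funD => //; apply: measurable_funM.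
Qed.

Lemma rint_aff2 a b f : a != 0 -> rint m2 f -> rint m2 (f \o aff2 a b).
Proof.
move=> a0 fi; have mf := rint_meas fi.
have mfa := measurableT_comp mf (measurable_aff2 a b).
have mnf : measurable_fun setT (fun z => `|f z|%:E).
  by apply/measurable_EFinP; exact: measurableT_comp.
have h := ge0_integral_affine2 b a0 mnf (fun=> normr_ge0 _).
have /integrableP[_ fy] := fi.
apply/integrableP; split; first exact/measurable_EFinP.
rewrite ltNge leye_eq; apply/negP => /eqP hy.
move: fy; rewrite [X in (X < _)%E](_ : _ = +oo%E)// -h.
rewrite [X in (_ * X)%E](_ : _ = +oo%E)// gt0_muley// lte_fin.
by rewrite exprn_even_gt0.
Qed.

(** The rule for nonnegative functions is transferred through f = ((|f| + f) - (|f| - f)) / 2. *)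
Lemma rintegral_aff2 a b f : a != 0 -> rint m2 f ->
  a ^+ 2 * \int[m2]_z f (aff2 a b z) = \int[m2]_z f z.
Proof.
move=> a0 fi.
have ge0 g : rint m2 g -> (forall z, 0 <= g z) ->
    a ^+ 2 * \int[m2]_z g (aff2 a b z) = \int[m2]_z g z.
  move=> gi g0; have mg := rint_meas gi.
  have mgE : measurable_fun setT (EFin \o g) by exact/measurable_EFinP.
  have h := ge0_integral_affine2 b a0 mgE (fun=> g0 _).
  rewrite /Rintegral -h fineM//.
  exact: integrable_fin_num (rint_aff2 b a0 gi).
have pi : rint m2 (fun z => `|f z| + f z) by apply: rintD => //; exact: rint_norm.
have ni : rint m2 (fun z => `|f z| - f z) by apply: rintB => //; exact: rint_norm.
have fE g : rint m2 g -> \int[m2]_z g z =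
    2^-1 * (\int[m2]_z (`|g z| + g z) - \int[m2]_z (`|g z| - g z)).
  move=> gi; have gni := rint_norm gi.
  by rewrite RintegralD// RintegralB//; field.
rewrite [RHS]fE// (fE (f \o aff2 a b)); last exact: rint_aff2.
rewrite -(ge0 _ pi); last by move=> z; rewrite -lerBlDr sub0r ler_normr lexx orbT.
rewrite -(ge0 _ ni); last by move=> z; rewrite subr_ge0 ler_norm.
by rewrite /=; ring.
Qed.

Lemma cinteg_aff2 a b (F : R * R -> R[i]) : a != 0 -> cinteg m2 F ->
  cinteg m2 (fun z => F (aff2 a b z)).
Proof.
move=> a0 [rF iF]; split.
- exact: (rint_aff2 b a0 rF).
- exact: (rint_aff2 b a0 iF).
Qed.

Lemma cint_aff2 a b (F : R * R -> R[i]) : a != 0 -> cinteg m2 F ->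
  (a ^+ 2)%:C * cint m2 (fun z => F (aff2 a b z)) = cint m2 F.
Proof.
move=> a0 [rF iF]; apply: complex_ext; rewrite ?cReM ?cImM /cint/= mul0r.
- by rewrite subr0 (rintegral_aff2 b a0 rF).
- by rewrite addr0 (rintegral_aff2 b a0 iF).
Qed.

Lemma rint_aff1 (a b : R) (f : R -> R) : a != 0 -> rint (@lebesgue_measure R) f ->
  rint (@lebesgue_measure R) (fun x => f (b + a * x)).
Proof.
move=> a0 fi; have mf := rint_meas fi.
have mfa : measurable_fun setT (fun x => f (b + a * x)).
  exact: measurableT_comp mf (measurable_affine_map a b).
have mnf : measurable_fun setT (fun z => `|f z|%:E).
  by apply/measurable_EFinP; exact: measurableT_comp.
have h := ge0_integral_affine b a0 mnf (fun=> normr_ge0 _).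
have /integrableP[_ fy] := fi.
apply/integrableP; split; first exact/measurable_EFinP.
rewrite ltNge leye_eq; apply/negP => /eqP hy.
move: fy; rewrite [X in (X < _)%E](_ : _ = +oo%E)// -h.
rewrite [X in (_ * X)%E](_ : _ = +oo%E)// gt0_muley// lte_fin.
by rewrite normr_gt0.
Qed.

Lemma rintegral_aff1 (a b : R) (f : R -> R) : a != 0 ->
  rint (@lebesgue_measure R) f ->
  `|a| * \int[@lebesgue_measure R]_x f (b + a * x) =
  \int[@lebesgue_measure R]_x f x.
Proof.
move=> a0 fi.
have ge0 g : rint (@lebesgue_measure R) g -> (forall z, 0 <= g z) ->
    `|a| * \int[@lebesgue_measure R]_z g (b + a * z) =
    \int[@lebesgue_measure R]_z g z.
  move=> gi g0; have mg := rint_meas gi.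
  have mgE : measurable_fun setT (EFin \o g) by exact/measurable_EFinP.
  have h := ge0_integral_affine b a0 mgE (fun=> g0 _).
  rewrite /Rintegral -h fineM//.
  exact: integrable_fin_num (rint_aff1 b a0 gi).
have pi : rint (@lebesgue_measure R) (fun z => `|f z| + f z).
  by apply: rintD => //; exact: rint_norm.
have ni : rint (@lebesgue_measure R) (fun z => `|f z| - f z).
  by apply: rintB => //; exact: rint_norm.
have fE g : rint (@lebesgue_measure R) g -> \int[@lebesgue_measure R]_z g z =
    2^-1 * (\int[@lebesgue_measure R]_z (`|g z| + g z) -
            \int[@lebesgue_measure R]_z (`|g z| - g z)).
  move=> gi; have gni := rint_norm gi.
  by rewrite RintegralD// RintegralB//; field.
rewrite [RHS]fE// (fE (fun x => f (b + a * x))); last exact: rint_aff1.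
rewrite -(ge0 _ pi); last by move=> z; rewrite -lerBlDr sub0r ler_normr lexx orbT.
rewrite -(ge0 _ ni); last by move=> z; rewrite subr_ge0 ler_norm.
by rewrite /=; ring.
Qed.

End affine_real.

(** * Square-integrable functions on the plane *)

Section square_integrable.
Context {R : realType}.
Notation m2 := (lebesgue2 R).

Lemma L2P (u : R * R -> R) :
  L2 u <-> measurable_fun setT u /\ rint m2 (fun z => u z ^+ 2).
Proof.
split=> [uL|[mu iu]].
  split; last exact: Lfun2_integrable_sqr.
  by move: uL; rewrite /L2 inE => /andP[]; rewrite inE.
rewrite /L2 inE; apply/andP; split; rewrite inE//= /finite_norm unlock /=.
apply: poweR_lty.
have /integrableP[_] := iu; apply: le_lt_trans; apply: ge0_le_integral => //=.
- apply/measurable_EFinP => /=.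
  apply: (@measurableT_comp _ _ _ _ _ _ (fun x : R => x `^ 2)) => //.
  exact: measurableT_comp.
- by apply/measurable_EFinP; apply: measurableT_comp => //; exact: measurable_funX.
- by move=> z _; rewrite lee_fin normrX powR_mulrn.
Qed.

Lemma L2CP (U : R * R -> R[i]) :
  L2C U <-> cmfun U /\ rint m2 (fun z => csq (U z)).
Proof.
split=> [[/L2P[mr ir] /L2P[mi ii]]|[[mr mi] iU]].
  by split => //; exact: rintD.
split; apply/L2P; split => //; apply: (rint_le _ iU); try exact: measurable_funX.
- by move=> z; rewrite ger0_norm ?sqr_ge0// lerDl sqr_ge0.
- by move=> z; rewrite ger0_norm ?sqr_ge0// lerDr sqr_ge0.
Qed.

Lemma L2C_real (u : R * R -> R) : L2 u -> L2C (fun z => (u z)%:C).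
Proof.
move=> /L2P[mu iu]; apply/L2CP; split; first exact: cmfun_real.
by under eq_fun do rewrite csq_real.
Qed.

Lemma cinteg_L2M (F G : R * R -> R[i]) : L2C F -> L2C G ->
  cinteg m2 (fun z => F z * G z).
Proof.
move=> /L2CP[mF iF] /L2CP[mG iG].
apply: (cinteg_le _ (rintD (rintZ 2 iF) (rintZ 2 iG))); first exact: cmfunM.
move=> z; apply: le_trans (cnorm1M _ _) _.
have := cnorm1_le_csq (F z); have := cnorm1_le_csq (G z).
have := normM_le_sqrD (cnorm1 (F z)) (cnorm1 (G z)).
by rewrite ger0_norm ?mulr_ge0 ?cnorm1_ge0//; lra.
Qed.

Lemma L2C_bnd (F G : R * R -> R[i]) M : L2C F -> cmfun G ->
  (forall z, cnorm1 (G z) <= M) -> L2C (fun z => F z * G z).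
Proof.
move=> /L2CP[mF iF] mG GM; apply/L2CP; split; first exact: cmfunM.
apply: (rint_le _ (rintZ (M ^+ 2) iF)).
  by apply: cmfun_csq; exact: cmfunM.
move=> z; rewrite ger0_norm ?csq_ge0// csqM mulrC ler_wpM2r ?csq_ge0//.
apply: le_trans (csq_le_cnorm1 _) _.
by rewrite lerXn2r// nnegrE ?cnorm1_ge0// (le_trans (cnorm1_ge0 _) (GM z)).
Qed.

Lemma L2C_of_cinteg (F : R * R -> R[i]) M : cinteg m2 F ->
  (forall z, cnorm1 (F z) <= M) -> L2C F.
Proof.
move=> iF FM; apply/L2CP; split; first exact: cinteg_meas iF.
apply: (rint_le _ (rintZ M (cinteg_cnorm1 iF))).
  exact: cmfun_csq (cinteg_meas iF).
move=> z; rewrite ger0_norm ?csq_ge0//; apply: le_trans (csq_le_cnorm1 _) _.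
by rewrite expr2 ler_wpM2r ?cnorm1_ge0.
Qed.

Lemma measurable_box n : measurable (@box R n).
Proof. exact: measurableX. Qed.

Lemma rint_box n : rint m2 (\1_(@box R n)).
Proof.
apply: rint_indic; first exact: measurable_box.
pose I : set R := `[- n%:R, n%:R]%classic.
have h : (lebesgue_measure I < +oo)%E.
  by rewrite lebesgue_measure_itv/=; case: ifP => _; rewrite // -EFinD ltry.
rewrite [X in (X < _)%E](_ : _ = lebesgue_measure I * lebesgue_measure I)%E;
  last exact: product_measure1E.
by rewrite lte_mul_pinfty// ge0_fin_numE.
Qed.

Lemma rint_L2_box (u : R * R -> R) n : L2 u ->
  rint m2 (fun z => u z * \1_(box n) z).
Proof.
move=> /L2P[mu iu]; apply: rint_sqr_mul => //.
- by apply: measurable_indic; exact: measurable_box.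
- apply: (rint_le _ (rint_box n)).
    by apply: measurable_funX; apply: measurable_indic; exact: measurable_box.
  by move=> z; rewrite indicE; case: (_ \in _); rewrite ?expr1n ?expr0n ?normr1 ?normr0.
Qed.

End square_integrable.

(** * The Fourier transform *)

Section derivation_rules.
Context {R : realType}.
Implicit Types f g : R -> R.

Lemma is_derive_mul f g (x df dg : R) : is_derive x 1 f df ->
  is_derive x 1 g dg ->
  is_derive x 1 (fun y => f y * g y) (f x * dg + g x * df).
Proof. by move=> hf hg; exact: (is_deriveM hf hg). Qed.

Lemma is_derive_add f g (x df dg : R) : is_derive x 1 f df ->
  is_derive x 1 g dg -> is_derive x 1 (fun y => f y + g y) (df + dg).
Proof. by move=> hf hg; exact: (is_deriveD hf hg). Qed.

Lemma is_derive_sub f g (x df dg : R) : is_derive x 1 f df ->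
  is_derive x 1 g dg -> is_derive x 1 (fun y => f y - g y) (df - dg).
Proof. by move=> hf hg; exact: (is_deriveB hf hg). Qed.

Lemma is_derive_scale f (a x df : R) : is_derive x 1 f df ->
  is_derive x 1 (fun y => a * f y) (a * df).
Proof. by move=> hf; exact: (is_deriveZ a hf). Qed.

Lemma is_derive_comp f g (x df dg : R) : is_derive (g x) 1 f df ->
  is_derive x 1 g dg -> is_derive x 1 (fun y => f (g y)) (df * dg).
Proof. by move=> hf hg; exact: is_derive1_comp hf hg. Qed.

Lemma is_derive_linear (a x : R) : is_derive x 1 (fun y : R => a * y) a.
Proof.
have := is_derive_scale a (is_derive_id x (1 : R)).
by move=> h; apply: is_derive_eq h _; rewrite mulr1.
Qed.

Lemma is_derive_continuous f (x df : R) : is_derive x 1 f df ->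
  {for x, continuous f}.
Proof. by move=> h; apply: differentiable_continuous; exact/derivable1_diffP. Qed.

End derivation_rules.

(** * The Poisson kernel as the transform of the two-sided exponential *)

Section poisson_kernel_1d.
Context {R : realType}.
Notation leb := (@lebesgue_measure R).

Definition expabs (e x : R) := expR (- (e * `|x|)).

(** The Fourier transform of [expabs e]; an approximate identity of total mass 2 pi as [e] tends to
    0. *)
Definition poisson (e t : R) := 2 * e / (e ^+ 2 + t ^+ 2).

Lemma continuous_expabs e : continuous (expabs e).
Proof.
move=> x; apply: continuous_comp; last exact: continuous_expR.
by apply: cvgN; apply: cvgM; [exact: cvg_cst|exact: norm_continuous].
Qed.

Lemma measurable_expabs e : measurable_fun setT (expabs e).
Proof. apply: continuous_measurable_fun; exact: continuous_expabs. Qed.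

Lemma expabs_ge0 e x : 0 <= expabs e x.
Proof. exact: expR_ge0. Qed.

Lemma expabs_le1 e x : 0 <= e -> expabs e x <= 1.
Proof. by move=> e0; rewrite -expR0 ler_expR oppr_le0 mulr_ge0. Qed.

Lemma cvg_expR_decay (e : R) : 0 < e -> expR (- (e * x)) @[x --> +oo%R] --> 0.
Proof.
move=> e0; apply: (@cvg_comp _ _ _ (fun x => e * x) (fun x => expR (- x)) _ (pinfty_nbhs R)).
  by apply: gt0_cvgMry => //; exact: cvg_id.
exact: cvgr_expR.
Qed.

(** Adding 1 to the cosine makes the integrand nonnegative, as the fundamental theorem of calculus
    on a half-line requires. The integral of the cosine alone is recovered afterwards by
    subtraction. *)
Lemma integral_expabs_1cos (e t : R) : 0 < e ->
  (\int[leb]_x (expabs e x * (1 + cos (t * x)))%:E =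
   (2 * (e^-1 + e / (e ^+ 2 + t ^+ 2)))%:E)%E.
Proof.
move=> e0; have d0 : e ^+ 2 + t ^+ 2 != 0.
  by rewrite gt_eqF// ltr_pwDl ?sqr_ge0// exprn_gt0.
have cost0 x : 0 <= 1 + cos (t * x) by rewrite -lerBlDl sub0r cos_geN1.
have cct : continuous (fun x : R => 1 + cos (t * x)).
  move=> x; apply: cvgD; first exact: cvg_cst.
  apply: continuous_comp; last exact: continuous_cos.
  by apply: cvgM; [exact: cvg_cst|exact: cvg_id].
rewrite ge0_symfun_integralT; last 3 first.
- by move=> x; rewrite mulr_ge0// expabs_ge0.
- by move=> x; apply: cvgM; [exact: continuous_expabs|exact: cct].
- by move=> x /=; rewrite /expabs normrN mulrN cosN.
(* The first summand, multiplied by e^{-ex}, is an antiderivative of e^{-ex} cos(tx), and - 1/e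
   yields one of e^{-ex}. *)
pose g (x : R) := (t * sin (t * x) - e * cos (t * x)) / (e ^+ 2 + t ^+ 2) - e^-1.
pose F (x : R) := expR (- (e * x)) * g x.
have dE (x : R) : is_derive x 1 (fun y : R => expR (- (e * y)))
    (expR (- (e * x)) * - e).
  have hl : is_derive x 1 (fun y : R => - (e * y)) (- e).
    have := is_derive_linear (- e) x; congr (is_derive _ _ _ _).
    by apply/funext => y; rewrite mulNr.
  exact: (is_derive_comp (g := fun y => - (e * y)) (is_derive_expR _) hl).
have dsin (x : R) : is_derive x 1 (fun y : R => sin (t * y)) (cos (t * x) * t).
  exact: (is_derive_comp (g := fun y => t * y) (is_derive_sin _)
    (is_derive_linear t x)).
have dcos (x : R) : is_derive x 1 (fun y : R => cos (t * y)) (- sin (t * x) * t).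
  exact: (is_derive_comp (g := fun y => t * y) (is_derive_cos _)
    (is_derive_linear t x)).
have dg (x : R) : is_derive x 1 g
    ((e ^+ 2 + t ^+ 2)^-1 * (t * (cos (t * x) * t) - e * (- sin (t * x) * t))).
  have := is_derive_sub (is_derive_scale (e ^+ 2 + t ^+ 2)^-1 (is_derive_sub
    (is_derive_scale t (dsin x)) (is_derive_scale e (dcos x))))
    (is_derive_cst (e^-1 : R) x 1).
  rewrite subr0; congr (is_derive _ _ _ _).
  by apply/funext => y; rewrite /g mulrC.
have dF (x : R) : is_derive x 1 F (expR (- (e * x)) * (1 + cos (t * x))).
  apply: is_derive_eq (is_derive_mul (dE x) (dg x)) _.
  by rewrite /g; field; rewrite d0 gt_eqF.
have Fle (x : R) : `|F x| <= expR (- (e * x)) *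
    ((`|t| + e) / (e ^+ 2 + t ^+ 2) + e^-1).
  rewrite /F normrM ger0_norm ?expR_ge0// ler_wpM2l ?expR_ge0// /g.
  apply: le_trans (ler_normB _ _) _; rewrite [`|e^-1|]gtr0_norm ?invr_gt0//.
  rewrite lerD2r normrM [`|_^-1|]ger0_norm ?invr_ge0 ?addr_ge0 ?sqr_ge0//.
  rewrite ler_wpM2r ?invr_ge0 ?addr_ge0 ?sqr_ge0//.
  apply: le_trans (ler_normB _ _) _; rewrite !normrM lerD//.
    by apply: ler_piMr => //; rewrite ler_norml sin_geN1 sin_le1.
  rewrite gtr0_norm//; apply: ler_piMr; first exact: ltW.
  by rewrite ler_norml cos_geN1 cos_le1.
rewrite -set_itvcy (@ge0_continuous_FTC2y _ _ F 0 0).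
- rewrite /F /g !mulr0 oppr0 expR0 sin0 cos0 -EFinD -EFinM; congr (_%:E).
  by field; rewrite d0 gt_eqF.
- by move=> x _; rewrite mulr_ge0// expabs_ge0.
- apply: continuous_subspaceT => x.
  by apply: cvgM; [exact: continuous_expabs|exact: cct].
- apply/cvgr0Pnorm_le => eps eps0.
  have M0 : 0 < (`|t| + e) / (e ^+ 2 + t ^+ 2) + e^-1.
    by apply: ltr_wpDl; [rewrite divr_ge0 ?addr_ge0 ?sqr_ge0// ltW|rewrite invr_gt0].
  have := cvg_expR_decay e0.
  move/cvgr0Pnorm_le => /(_ _ (divr_gt0 eps0 M0)); apply: filterS => x.
  rewrite ger0_norm ?expR_ge0// ler_pdivlMr// => h.
  exact: le_trans (Fle x) h.
- by move=> x _; case: (dF x).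
- apply: cvg_at_right_filter; exact: is_derive_continuous (dF 0).
- move=> x; rewrite in_itv/= andbT => x0; rewrite derive1E.
  case: (dF x) => _ ->; by rewrite /expabs gtr0_norm.
Qed.

Lemma rint_expabs (e : R) : 0 < e -> rint leb (expabs e).
Proof.
move=> e0.
have mf : measurable_fun setT (fun x : R => expabs e x * (1 + cos (0 * x))).
  apply: measurable_funM; first exact: measurable_expabs.
  under eq_fun do rewrite mul0r.
  exact: measurable_cst.
have gi : rint leb (fun x => expabs e x * (1 + cos (0 * x))).
  apply/rint_ge0P => //.
    by move=> x; rewrite mul0r cos0 mulr_ge0 ?expabs_ge0// addr_ge0.
  by rewrite integral_expabs_1cos// ltry.
apply: (rint_le _ gi); first exact: measurable_expabs.
move=> x; rewrite mul0r cos0 ger0_norm ?expabs_ge0// ler_peMr ?expabs_ge0//.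
by rewrite lerDl.
Qed.

Lemma rint_expabs_cos (e t : R) : 0 < e ->
  rint leb (fun x => expabs e x * cos (t * x)).
Proof.
move=> e0; apply: (rint_le _ (rint_expabs e0)).
  apply: measurable_funM; first exact: measurable_expabs.
  apply: measurableT_comp; last exact: measurable_funM.
  by apply: continuous_measurable_fun; exact: continuous_cos.
move=> x; rewrite normrM (ger0_norm (expabs_ge0 _ _)) ler_piMr ?expabs_ge0//.
by rewrite ler_norml cos_geN1 cos_le1.
Qed.

Lemma rintegral_expabs_cos (e t : R) : 0 < e ->
  \int[leb]_x (expabs e x * cos (t * x)) = poisson e t.
Proof.
move=> e0.
have h s : \int[leb]_x (expabs e x) + \int[leb]_x (expabs e x * cos (s * x)) =
    2 * (e^-1 + e / (e ^+ 2 + s ^+ 2)).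
  rewrite -RintegralD//; [|exact: rint_expabs|exact: rint_expabs_cos].
  rewrite -[RHS]/(fine (2 * (e^-1 + e / (e ^+ 2 + s ^+ 2)))%:E).
  rewrite -integral_expabs_1cos// /Rintegral; congr fine.
  by apply: eq_integral => x _; rewrite mulrDr mulr1.
(* At [s = 0] the cosine is 1 and [h 0] isolates the integral of [expabs e], to be subtracted from
   [h t]. *)
have h0 : \int[leb]_x (expabs e x) = 2 / e.
  have := h 0; under [X in _ + X]eq_Rintegral do rewrite mul0r cos0 mulr1.
  rewrite expr0n addr0 => h1.
  have : \int[leb]_x (expabs e x) = e^-1 + e / e ^+ 2 by lra.
  by move=> ->; field; rewrite gt_eqF.
have d0 : e ^+ 2 + t ^+ 2 != 0.
  by rewrite gt_eqF// ltr_pwDl ?sqr_ge0// exprn_gt0.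
have := h t; rewrite h0 => /(canRL (addKr _)) ->; rewrite /poisson.
by field; rewrite d0 gt_eqF.
Qed.

Lemma rintegral_odd (f : R -> R) : rint leb f -> (forall x, f (- x) = - f x) ->
  \int[leb]_x f x = 0.
Proof.
move=> fi fo; have N10 : -1 != 0 :> R by rewrite oppr_eq0 oner_eq0.
have := rintegral_aff1 0 N10 fi; rewrite normrN1 mul1r.
under eq_Rintegral do rewrite add0r mulN1r fo -mulN1r.
by rewrite RintegralZl//; lra.
Qed.

Lemma rintegral_expabs_sin (e t : R) : 0 < e ->
  rint leb (fun x => expabs e x * sin (t * x)) /\
  \int[leb]_x (expabs e x * sin (t * x)) = 0.
Proof.
move=> e0.
have si : rint leb (fun x => expabs e x * sin (t * x)).
  apply: (rint_le _ (rint_expabs e0)).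
    apply: measurable_funM; first exact: measurable_expabs.
    apply: measurableT_comp; last exact: measurable_funM.
    by apply: continuous_measurable_fun; exact: continuous_sin.
  move=> x; rewrite normrM (ger0_norm (expabs_ge0 _ _)) ler_piMr ?expabs_ge0//.
  by rewrite ler_norml sin_geN1 sin_le1.
split => //; apply: rintegral_odd => // x.
by rewrite /expabs normrN mulrN sinN mulrN.
Qed.

Lemma poisson_ge0 e t : 0 <= e -> 0 <= poisson e t.
Proof. by move=> e0; rewrite divr_ge0 ?addr_ge0 ?sqr_ge0// mulr_ge0. Qed.

Lemma poissonN e t : poisson e (- t) = poisson e t.
Proof. by rewrite /poisson sqrrN. Qed.

Lemma continuous_poisson e : 0 < e -> continuous (poisson e).
Proof.
move=> e0 x; apply: cvgM; first exact: cvg_cst.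
apply: cvgV.
  by rewrite gt_eqF// ltr_pwDl ?sqr_ge0// exprn_gt0.
by apply: cvgD; [exact: cvg_cst|exact: exprn_continuous].
Qed.

Lemma integral_poisson (e : R) : 0 < e ->
  (\int[leb]_t (poisson e t)%:E = (2 * pi)%:E)%E.
Proof.
move=> e0; rewrite ge0_symfun_integralT; last 3 first.
- by move=> x; exact/poisson_ge0/ltW.
- exact: continuous_poisson.
- by move=> x /=; rewrite poissonN.
have dF (x : R) : is_derive x 1 (fun y => 2 * atan (e^-1 * y)) (poisson e x).
  apply: is_derive_eq (is_derive_scale 2 (is_derive_comp
    (g := fun y => e^-1 * y) (is_derive1_atan _) (is_derive_linear e^-1 x))) _.
  have e1 : e != 0 by rewrite gt_eqF.
  have d0 : e ^+ 2 + x ^+ 2 != 0.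
    by rewrite gt_eqF// ltr_pwDl ?sqr_ge0// exprn_gt0.
  have d1 : 1 + (e^-1 * x) ^+ 2 != 0 by rewrite gt_eqF// ltr_pwDl ?sqr_ge0.
  have -> : (1 + (e^-1 * x) ^+ 2)^-1 = e ^+ 2 / (e ^+ 2 + x ^+ 2).
    by apply: (mulfI d1); rewrite mulfV//; field; rewrite d0 e1.
  by rewrite /poisson; field; rewrite d0 e1.
rewrite -set_itvcy (@ge0_continuous_FTC2y _ _ (fun y => 2 * atan (e^-1 * y)) 0 pi).
- by rewrite mulr0 atan0 mulr0 -EFinB subr0 -EFinM.
- by move=> x _; exact/poisson_ge0/ltW.
- by apply: continuous_subspaceT => x; exact: continuous_poisson.
- have -> : pi = 2 * (pi / 2) :> R by field.
  apply: cvgM; first exact: cvg_cst.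
  apply: (@cvg_comp _ _ _ (fun x => e^-1 * x) atan _ (pinfty_nbhs R)).
    by apply: gt0_cvgMry; [rewrite invr_gt0|exact: cvg_id].
  exact: cvgy_atan.
- by move=> x _; case: (dF x).
- apply: cvg_at_right_filter; exact: is_derive_continuous (dF 0).
- by move=> x _; rewrite derive1E; case: (dF x).
Qed.

Lemma rint_poisson (e : R) : 0 < e -> rint leb (poisson e).
Proof.
move=> e0; apply/rint_ge0P.
- by apply: continuous_measurable_fun; exact: continuous_poisson.
- by move=> x; exact/poisson_ge0/ltW.
- by rewrite integral_poisson// ltry.
Qed.

Lemma rintegral_poisson (e : R) : 0 < e -> \int[leb]_t poisson e t = 2 * pi.
Proof. by move=> e0; rewrite /Rintegral integral_poisson. Qed.

Lemma cint_expabs (e t : R) : 0 < e ->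
  cint leb (fun x => (expabs e x)%:C * expi (t * x)) = (poisson e t)%:C.
Proof.
move=> e0; apply: complex_ext; rewrite /cint/=.
- under eq_Rintegral do rewrite mul0r subr0.
  exact: rintegral_expabs_cos.
- under eq_Rintegral do rewrite mul0r addr0.
  exact: (rintegral_expabs_sin t e0).2.
Qed.

End poisson_kernel_1d.

(** * The transform of integrable functions *)

Section fourier_L1.
Context {R : realType}.
Notation leb := (@lebesgue_measure R).
Notation m2 := (lebesgue2 R).
Notation m4 := (lebesgue2 R \x lebesgue2 R)%E.
Implicit Types X Y : R * R -> R[i].

Definition dot (z w : R * R) : R := z.1 * w.1 + z.2 * w.2.

Definition expw (e : R) (z : R * R) : R := expabs e z.1 * expabs e z.2.

Definition pois2 (e : R) (z : R * R) : R := poisson e z.1 * poisson e z.2.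

(** There is no normalising factor, so Plancherel and inversion carry the constant (2 pi)^2. *)
Definition ft X (z : R * R) : R[i] := cint m2 (fun w => X w * expi (- dot z w)).

Lemma measurable_dot d (T : measurableType d) (f g : T -> R * R) :
  measurable_fun setT f -> measurable_fun setT g ->
  measurable_fun setT (fun x => dot (f x) (g x)).
Proof.
move=> mf mg; apply: measurable_funD; apply: measurable_funM.
- exact: measurableT_comp measurable_fst mf.
- exact: measurableT_comp measurable_fst mg.
- exact: measurableT_comp measurable_snd mf.
- exact: measurableT_comp measurable_snd mg.
Qed.

Lemma measurable_aff2_fun d (T : measurableType d) a (f g : T -> R * R) :
  measurable_fun setT f -> measurable_fun setT g ->
  measurable_fun setT (fun x => aff2 a (f x) (g x)).
Proof.
move=> mf mg; apply/measurable_fun_pairP; split => /=.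
- apply: measurable_funD; first exact: measurableT_comp measurable_fst mf.
  by apply: measurable_funM => //; exact: measurableT_comp measurable_fst mg.
- apply: measurable_funD; first exact: measurableT_comp measurable_snd mf.
  by apply: measurable_funM => //; exact: measurableT_comp measurable_snd mg.
Qed.

Lemma rint_expw e : 0 < e -> rint m2 (expw e).
Proof. by move=> e0; exact: rint_prod (rint_expabs e0) (rint_expabs e0). Qed.

Lemma measurable_expw e : measurable_fun setT (expw e).
Proof.
apply: measurable_funM.
- exact: measurableT_comp (measurable_expabs e) measurable_fst.
- exact: measurableT_comp (measurable_expabs e) measurable_snd.
Qed.

Lemma expw_gt0 e z : 0 < expw e z.
Proof. by rewrite mulr_gt0// expR_gt0. Qed.

Lemma expw_ge0 e z : 0 <= expw e z.
Proof. exact: ltW (expw_gt0 _ _). Qed.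

Lemma expw_le1 e z : 0 <= e -> expw e z <= 1.
Proof. by move=> e0; rewrite mulr_ile1 ?expabs_ge0 ?expabs_le1. Qed.

Lemma rint_pois2 e : 0 < e -> rint m2 (pois2 e).
Proof. by move=> e0; exact: rint_prod (rint_poisson e0) (rint_poisson e0). Qed.

Lemma rintegral_pois2 e : 0 < e -> \int[m2]_z pois2 e z = (2 * pi) ^+ 2.
Proof.
move=> e0; rewrite (rintegral_prod (rint_poisson e0) (rint_poisson e0)).
by rewrite rintegral_poisson.
Qed.

Lemma pois2_ge0 e z : 0 <= e -> 0 <= pois2 e z.
Proof. by move=> e0; rewrite mulr_ge0 ?poisson_ge0. Qed.

Lemma cint_expw e w : 0 < e ->
  cint m2 (fun z => (expw e z)%:C * expi (dot z w)) = (pois2 e w)%:C.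
Proof.
move=> e0; have ie t : cinteg leb (fun x => (expabs e x)%:C * expi (t * x)).
  apply: cinteg_expi; last exact: measurable_funM.
  exact: cinteg_real (rint_expabs e0).
transitivity (cint m2 (fun z : R * R => ((expabs e z.1)%:C * expi (w.1 * z.1)) *
    ((expabs e z.2)%:C * expi (w.2 * z.2)))).
  congr cint; apply/funext => z; rewrite /expw /dot expiD rmorphM /=.
  by rewrite [_ * w.1]mulrC [_ * w.2]mulrC; ring.
by rewrite (cint_prod (ie _) (ie _)) !cint_expabs// -rmorphM.
Qed.

Lemma cinteg_ft X z : cinteg m2 X -> cinteg m2 (fun w => X w * expi (- dot z w)).
Proof.
move=> iX; apply: cinteg_expi => //; apply: measurableT_comp => //.
exact: measurable_dot.
Qed.

Lemma cinteg_kernel X Y (h : (R * R) * (R * R) -> R) : cinteg m2 X -> cinteg m2 Y ->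
  measurable_fun setT h -> cinteg m4 (fun p => X p.1 * Y p.2 * expi (h p)).
Proof. by move=> iX iY mh; apply: cinteg_expi => //; exact: cinteg_prod. Qed.

Lemma measurable_dot12 : measurable_fun setT
  (fun p : (R * R) * (R * R) => dot p.1 p.2).
Proof. exact: measurable_dot measurable_fst measurable_snd. Qed.

Lemma measurable_Ndot12 : measurable_fun setT
  (fun p : (R * R) * (R * R) => - dot p.1 p.2).
Proof. by apply: measurableT_comp => //; exact: measurable_dot12. Qed.

Lemma ft_bound X z : cinteg m2 X ->
  cnorm1 (ft X z) <= 2 * \int[m2]_w cnorm1 (X w).
Proof.
move=> iX; apply: le_trans (cnorm1_cint (cinteg_ft z iX)) _.
have iN := cinteg_cnorm1 iX.
rewrite -RintegralZl//; apply: le_Rintegral => //.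
- exact: cinteg_cnorm1 (cinteg_ft z iX).
- exact: rintZ.
- move=> w _; apply: le_trans (cnorm1M _ _) _; rewrite mulrC ler_wpM2r ?cnorm1_ge0//.
  exact: cnorm1_expi.
Qed.

(** The kernel is not integrable in both variables jointly. Weighting it by [expw 1 z] makes it so;
    Fubini then gives measurability of the weighted transform, and the positive weight is divided
    out. *)
Lemma ft_meas X : cinteg m2 X -> cmfun (ft X).
Proof.
move=> iX; have h := cinteg_kernel (cinteg_real (rint_expw ltr01)) iX
  measurable_Ndot12.
have /cinteg_meas mF := (cfubini1 h).1.
have mE : measurable_fun setT (fun z : R * R => (expw 1 z)^-1).
  have -> : (fun z : R * R => (expw 1 z)^-1) =
      (fun z => expR `|z.1| * expR `|z.2|).
    by apply/funext => z; rewrite /expw /expabs invfM -!expRN !opprK !mul1r.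
  apply: measurable_funM; apply: measurableT_comp => //.
    by apply: measurableT_comp => //; exact: measurable_fst.
  by apply: measurableT_comp => //; exact: measurable_snd.
have -> : ft X = (fun z => ((expw 1 z)^-1)%:C *
    cint m2 (fun w => (expw 1 z)%:C * X w * expi (- dot z w))).
  apply/funext => z; under [X in _ = _ * cint _ X]eq_fun do rewrite -mulrA.
  rewrite cintZ; last exact: cinteg_ft.
  by rewrite mulrA -rmorphM mulVf ?gt_eqF ?expw_gt0// mul1r.
by apply: cmfunM => //; exact: cmfun_real.
Qed.

(** Fubini, by symmetry of the kernel. This formula lets a transform be tested against another one
    and is the main tool for every later identity between transforms. *)
Lemma L1_multiplication X Y : cinteg m2 X -> cinteg m2 Y ->
  cint m2 (fun z => X z * ft Y z) = cint m2 (fun w => ft X w * Y w).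
Proof.
move=> iX iY; have iF := cinteg_kernel iX iY
  measurable_Ndot12.
transitivity (cint m2 (fun z => cint m2 (fun w => X z * Y w * expi (- dot z w)))).
  congr cint; apply/funext => z; rewrite /ft -cintZ; last exact: cinteg_ft.
  by congr cint; apply/funext => w; rewrite mulrA.
rewrite (cfubini iF); congr cint; apply/funext => w /=.
rewrite /ft -cintZr; last exact: cinteg_ft.
congr cint; apply/funext => z; rewrite mulrAC; congr (_ * expi (- _) * _).
by rewrite /dot [w.1 * _]mulrC [w.2 * _]mulrC.
Qed.

(** The substitution of -w for w turns the transform of a hermitian function into its conjugate. *)
Lemma ft_hermitian X z : cinteg m2 X -> (forall w, X (- w.1, - w.2) = (X w)^*%C) ->
  complex.Im (ft X z) = 0.
Proof.
move=> iX hX; have N10 : -1 != 0 :> R by rewrite oppr_eq0 oner_eq0.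
have h : ft X z = (ft X z)^*%C.
  rewrite [LHS]/ft -(cint_aff2 (0, 0) N10 (cinteg_ft z iX)).
  rewrite sqrrN expr1n mul1r -cint_conj; last exact: cinteg_ft.
  congr cint; apply/funext => w; rewrite cconjM -expiN opprK.
  have -> : aff2 (-1) (0, 0) w = (- w.1, - w.2) by rewrite /aff2 /= !add0r !mulN1r.
  by rewrite hX /dot /= !mulrN -opprD opprK.
have := congr1 (@complex.Im R) h; rewrite cIm_conj; lra.
Qed.

(** Integrating in [p.2] first, translation invariance replaces the inner integral by a constant.
    Together with [rint_conv2], where [f] sits on the other variable, it evaluates both squares in
    the proof of [plancherel_le]. *)
Lemma rint_conv1 (f g : R * R -> R) : rint m2 f -> rint m2 g ->
  rint m4 (fun p => f p.1 * g (aff2 (-1) p.1 p.2)) /\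
  \int[m4]_p (f p.1 * g (aff2 (-1) p.1 p.2)) =
    (\int[m2]_x f x) * (\int[m2]_x g x).
Proof.
move=> fi gi; have N10 : -1 != 0 :> R by rewrite oppr_eq0 oner_eq0.
have mfg : measurable_fun setT
    (fun p : (R * R) * (R * R) => f p.1 * g (aff2 (-1) p.1 p.2)).
  apply: measurable_funM.
    exact: measurableT_comp (rint_meas fi) measurable_fst.
  apply: measurableT_comp (rint_meas gi) _.
  exact: measurable_aff2_fun measurable_fst measurable_snd.
have h : rint m4 (fun p => f p.1 * g (aff2 (-1) p.1 p.2)).
  apply/integrable12ltyP; first exact/measurable_EFinP.
  have mng : measurable_fun setT (fun y => `|g y|%:E).
    by apply/measurable_EFinP; exact: measurableT_comp (rint_meas gi).
  have mnf : measurable_fun setT (fun x => `|f x|%:E).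
    by apply/measurable_EFinP; exact: measurableT_comp (rint_meas fi).
  apply: (@le_lt_trans _ _ (\int[m2]_x ((\int[m2]_y `|g y|)%:E * `|f x|%:E)))%E.
    rewrite le_eqVlt; apply/orP; left; apply/eqP.
    apply: eq_integral => x _ /=; under eq_integral do rewrite normrM EFinM.
    rewrite ge0_integralZl//; last first.
      apply/measurable_EFinP; apply: measurableT_comp => //.
      exact: measurableT_comp (rint_meas gi) (measurable_aff2 _ _).
    rewrite -(rint_EFin (rint_norm gi)) muleC; congr (_ * _)%E.
    rewrite -(ge0_integral_affine2 x N10 mng (fun=> normr_ge0 _)).
    by rewrite sqrrN expr1n mul1e.
  rewrite ge0_integralZl//; last by rewrite lee_fin; exact: Rintegral_ge0.
  by rewrite (rint_EFin (rint_norm fi)) -EFinM ltry.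
split => //; rewrite -(rfubini1 h).2 /=.
under eq_Rintegral => x _.
  rewrite RintegralZl//; last exact: (rint_aff2 x N10 gi).
  have := rintegral_aff2 x N10 gi; rewrite sqrrN expr1n mul1r => ->.
  over.
by rewrite RintegralZr.
Qed.

Lemma rint_conv2 (f g : R * R -> R) : rint m2 f -> rint m2 g ->
  rint m4 (fun p => f p.2 * g (aff2 (-1) p.1 p.2)) /\
  \int[m4]_p (f p.2 * g (aff2 (-1) p.1 p.2)) =
    (\int[m2]_x f x) * (\int[m2]_x g x).
Proof.
move=> fi gi; have n10 : 1 != 0 :> R by rewrite oner_eq0.
have affE (x y : R * R) : aff2 (-1) x y = aff2 1 (- y.1, - y.2) x.
  by rewrite /aff2 /= !mulN1r !mul1r; congr pair; rewrite addrC.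
have mfg : measurable_fun setT
    (fun p : (R * R) * (R * R) => f p.2 * g (aff2 (-1) p.1 p.2)).
  apply: measurable_funM.
    exact: measurableT_comp (rint_meas fi) measurable_snd.
  apply: measurableT_comp (rint_meas gi) _.
  exact: measurable_aff2_fun measurable_fst measurable_snd.
have h : rint m4 (fun p => f p.2 * g (aff2 (-1) p.1 p.2)).
  apply/integrable21ltyP; first exact/measurable_EFinP.
  have mng : measurable_fun setT (fun y => `|g y|%:E).
    by apply/measurable_EFinP; exact: measurableT_comp (rint_meas gi).
  have mnf : measurable_fun setT (fun x => `|f x|%:E).
    by apply/measurable_EFinP; exact: measurableT_comp (rint_meas fi).
  apply: (@le_lt_trans _ _ (\int[m2]_y ((\int[m2]_x `|g x|)%:E * `|f y|%:E)))%E.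
    rewrite le_eqVlt; apply/orP; left; apply/eqP.
    apply: eq_integral => y _ /=; under eq_integral do rewrite normrM EFinM affE.
    rewrite ge0_integralZl//; last first.
      apply/measurable_EFinP; apply: measurableT_comp => //.
      exact: measurableT_comp (rint_meas gi) (measurable_aff2 _ _).
    rewrite -(rint_EFin (rint_norm gi)) muleC; congr (_ * _)%E.
    rewrite -(ge0_integral_affine2 (- y.1, - y.2) n10 mng (fun=> normr_ge0 _)).
    by rewrite expr1n mul1e.
  rewrite ge0_integralZl//; last by rewrite lee_fin; exact: Rintegral_ge0.
  by rewrite (rint_EFin (rint_norm fi)) -EFinM ltry.
split => //; rewrite -(rfubini2 h).2 /=.
under eq_Rintegral => y _.
  under eq_Rintegral do rewrite affE.
  rewrite RintegralZl//; last exact: (rint_aff2 _ n10 gi).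
  have := rintegral_aff2 (- y.1, - y.2) n10 gi; rewrite expr1n mul1r => ->.
  over.
by rewrite RintegralZr.
Qed.

End fourier_L1.

(** Packed as sigma-finite so that Fubini applies on R^2 x R^4, when a frequency variable is
    integrated against a double integral. *)
Definition lebesgue4 (R : realType) : {sigma_finite_measure set ((measurableTypeR R * measurableTypeR R) *
    (measurableTypeR R * measurableTypeR R))%type -> \bar R} :=
  HB.pack (lebesgue2 R \x lebesgue2 R)%E (Measure_isSigmaFinite.Build _ _ _ (lebesgue2 R \x lebesgue2 R)%E
    (sigma_finite_product_measure1 (lebesgue2 R) (lebesgue2 R))).

(** * Plancherel's inequality and equality *)

Section plancherel.
Context {R : realType}.
Notation m2 := (lebesgue2 R).
Notation m4 := (lebesgue2 R \x lebesgue2 R)%E.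
Implicit Types X Y : R * R -> R[i].

(** A transform times its conjugate, each written with its own variable, is a double integral whose
    two exponents combine into the difference of the variables. *)
Lemma csq_ft X z : cinteg m2 X -> (csq (ft X z))%:C =
  cint m4 (fun p => (X p.1)^*%C * X p.2 * expi (dot z (aff2 (-1) p.1 p.2))).
Proof.
move=> iX; have iXz := cinteg_ft z iX.
have iXc : cinteg m2 (fun w => (X w)^*%C * expi (dot z w)).
  by apply: cinteg_expi; [exact: cinteg_conj|exact: measurable_dot].
have -> : (csq (ft X z))%:C = cint m2 (fun w => (X w)^*%C * expi (dot z w)) * ft X z.
  rewrite -csq_mulJ mulrC; congr (_ * _); rewrite /ft -cint_conj//.
  by congr cint; apply/funext => w; rewrite cconjM -expiN opprK.
rewrite -(cint_prod iXc iXz); congr cint; apply/funext => p /=.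
have -> : dot z (aff2 (-1) p.1 p.2) = dot z p.1 + - dot z p.2.
  by rewrite /dot /aff2 /=; ring.
by rewrite expiD; ring.
Qed.

Lemma cinteg_sesqui X : cinteg m2 X -> cinteg m4 (fun p => (X p.1)^*%C * X p.2).
Proof. by move=> iX; exact: (cinteg_prod (cinteg_conj iX) iX). Qed.

Lemma measurable_csq_ft X : cinteg m2 X -> measurable_fun setT (fun z => csq (ft X z)).
Proof. by move=> iX; apply: cmfun_csq; exact: ft_meas. Qed.

Lemma ft_csq_bound X z : cinteg m2 X ->
  csq (ft X z) <= (2 * \int[m2]_w cnorm1 (X w)) ^+ 2.
Proof.
move=> iX; apply: le_trans (csq_le_cnorm1 _) _.
have h := ft_bound z iX.
by rewrite lerXn2r// nnegrE ?cnorm1_ge0// (le_trans (cnorm1_ge0 _) h).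
Qed.

Lemma rint_expw_csq_ft X e : 0 < e -> cinteg m2 X ->
  rint m2 (fun z => expw e z * csq (ft X z)).
Proof.
move=> e0 iX; have iE := rint_expw e0.
pose B := (2 * \int[m2]_w cnorm1 (X w)) ^+ 2.
have iB : rint m2 (fun z => B * expw e z) by exact: rintZ.
apply: (rint_le _ iB).
  by apply: measurable_funM; [exact: rint_meas iE|exact: measurable_csq_ft].
move=> z; rewrite ger0_norm; last by apply: mulr_ge0; [exact: expw_ge0|exact: csq_ge0].
by rewrite mulrC ler_wpM2r ?expw_ge0// ft_csq_bound.
Qed.

(* Abel summation: the weight e^{-e|z|_1} turns the squared transform into a
   double integral against the Poisson kernel *)
Lemma ft_poisson X e : 0 < e -> cinteg m2 X ->
  cinteg m4 (fun p => (X p.1)^*%C * X p.2 * (pois2 e (aff2 (-1) p.1 p.2))%:C) /\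
  (\int[m2]_z (expw e z * csq (ft X z)))%:C =
  cint m4 (fun p => (X p.1)^*%C * X p.2 * (pois2 e (aff2 (-1) p.1 p.2))%:C).
Proof.
move=> e0 iX.
have mdiff : measurable_fun setT (fun q : (R * R) * ((R * R) * (R * R)) =>
    dot q.1 (aff2 (-1) q.2.1 q.2.2)).
  apply: measurable_dot; first exact: measurable_fst.
  apply: measurable_aff2_fun.
    exact: measurableT_comp measurable_fst measurable_snd.
  exact: measurableT_comp measurable_snd measurable_snd.
have iH : cinteg (m2 \x (lebesgue4 R))%E (fun q => (expw e q.1)%:C *
    ((X q.2.1)^*%C * X q.2.2) * expi (dot q.1 (aff2 (-1) q.2.1 q.2.2))).
  apply: cinteg_expi => //.
  exact: (cinteg_prod (m1 := m2) (m2 := lebesgue4 R) (cinteg_real (rint_expw e0))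
    (cinteg_sesqui iX)).
have inner p : cint m2 (fun z => (expw e z)%:C * ((X p.1)^*%C * X p.2) *
    expi (dot z (aff2 (-1) p.1 p.2))) =
    (X p.1)^*%C * X p.2 * (pois2 e (aff2 (-1) p.1 p.2))%:C.
  rewrite -(cint_expw _ e0) -cintZ; last first.
    apply: cinteg_expi; first exact: cinteg_real (rint_expw e0).
    exact: measurable_dot.
  by congr cint; apply/funext => z; ring.
split.
  have [+ _] := cfubini2 iH; congr (cinteg _ _); apply/funext => p /=.
  exact: inner.
have -> : (\int[m2]_z (expw e z * csq (ft X z)))%:C =
    cint m2 (fun z => cint m4 (fun p => (expw e z)%:C *
    ((X p.1)^*%C * X p.2) * expi (dot z (aff2 (-1) p.1 p.2)))).
  rewrite -cint_real; congr cint; apply/funext => z.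
  rewrite rmorphM /= csq_ft// -cintZ.
    by congr cint; apply/funext => p; ring.
  apply: cinteg_expi; first exact: cinteg_sesqui.
  apply: measurable_dot => //.
  exact: measurable_aff2_fun measurable_fst measurable_snd.
rewrite [LHS](cfubini iH); congr cint; apply/funext => p; exact: inner.
Qed.

Lemma expw_le (e e' : R) z : e' <= e -> expw e z <= expw e' z.
Proof.
move=> ee; rewrite /expw ler_pM ?expabs_ge0// ler_expR lerN2 ler_wpM2r//.
Qed.

Lemma cvg_expw (z : R * R) : expw n.+1%:R^-1 z @[n --> \oo] --> (1 : R).
Proof.
have h (x : R) : expabs n.+1%:R^-1 x @[n --> \oo] --> (1 : R).
  have h0 : n.+1%:R^-1 * `|x| @[n --> \oo] --> 0 * `|x|.
    by apply: cvgM; [exact: (@cvg_harmonic R)|exact: cvg_cst].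
  have h1 := cvgN h0; rewrite mul0r oppr0 in h1.
  have h2 : expR (- (n.+1%:R^-1 * `|x|)) @[n --> \oo] --> expR (0 : R).
    by apply: continuous_cvg; [exact: continuous_expR|exact: h1].
  by rewrite expR0 in h2.
by rewrite -[X in _ --> X]mulr1; apply: cvgM; exact: h.
Qed.

(** In the Poisson double integral, Re of the conjugate of X(p.1) times X(p.2) is at most half the
    sum of the squared moduli; each square integrates against the kernel to (2 pi)^2 times its mass.
    This bound is uniform in [e], and monotone convergence removes the weight. No continuity of [X]
    enters. *)
Lemma plancherel_le X : cinteg m2 X -> L2C X ->
  rint m2 (fun z => csq (ft X z)) /\
  \int[m2]_z csq (ft X z) <= (2 * pi) ^+ 2 * \int[m2]_w csq (X w).
Proof.
move=> iX /L2CP[mX qX].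
set B := (2 * pi) ^+ 2 * _.
have bound e : 0 < e -> \int[m2]_z (expw e z * csq (ft X z)) <= B.
  move=> e0; have [iK hK] := ft_poisson e0 iX.
  have [i1 E1] := rint_conv1 qX (rint_pois2 e0).
  have [i2 E2] := rint_conv2 qX (rint_pois2 e0).
  have -> : \int[m2]_z (expw e z * csq (ft X z)) = complex.Re
      (cint m4 (fun p => (X p.1)^*%C * X p.2 * (pois2 e (aff2 (-1) p.1 p.2))%:C)).
    by rewrite -hK.
  rewrite rintegral_pois2// in E1 E2.
  have -> : B = \int[m4]_p (2^-1 * (csq (X p.1) * pois2 e (aff2 (-1) p.1 p.2) +
      csq (X p.2) * pois2 e (aff2 (-1) p.1 p.2))).
    rewrite RintegralZl//; last exact: rintD.
    by rewrite RintegralD// E1 E2 /B; field.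
  apply: le_Rintegral => //; first by case: iK.
    by apply: rintZ; exact: rintD.
  move=> p _; rewrite -mulrDl mulrA cReM /= mulr0 subr0.
  rewrite ler_wpM2r ?pois2_ge0 ?(ltW e0)// cReM cRe_conj cIm_conj /csq.
  have := sqr_ge0 (complex.Re (X p.1) - complex.Re (X p.2)).
  have := sqr_ge0 (complex.Im (X p.1) - complex.Im (X p.2)).
  by rewrite !sqrrB; lra.
have mq := measurable_csq_ft iX.
have mE n : measurable_fun setT (fun z => expw n.+1%:R^-1 z * csq (ft X z)).
  by apply: measurable_funM => //; exact: measurable_expw.
have : (\int[m2]_z (expw n.+1%:R^-1 z * csq (ft X z))%:E @[n --> \oo] -->
    \int[m2]_z (csq (ft X z))%:E)%E.
  have := @cvg_monotone_convergence _ _ _ m2 setT measurableT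
    (fun n z => (expw n.+1%:R^-1 z * csq (ft X z))%:E).
  have limE : (fun z => limn (fun n => (expw n.+1%:R^-1 z * csq (ft X z))%:E)) =
      (fun z => (csq (ft X z))%:E).
    apply/funext => z; apply/cvg_lim => //; apply: cvg_EFin; first exact: nearW.
    rewrite -[X in _ --> X]mul1r; apply: cvgM; [exact: cvg_expw|exact: cvg_cst].
  rewrite limE; apply.
  - by move=> n /=; apply/measurable_EFinP; exact: mE.
  - by move=> n z _; rewrite lee_fin; apply: mulr_ge0; [exact: expw_ge0|exact: csq_ge0].
  - move=> z _ n m nm; rewrite lee_fin ler_wpM2r ?csq_ge0//.
    by apply: expw_le; rewrite lef_pV2 ?posrE// ler_nat.
move=> h.
have leB : (\int[m2]_z (csq (ft X z))%:E <= B%:E)%E.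
  rewrite -(cvg_lim _ h)//; apply: lime_le; first by apply/cvg_ex; eexists; exact: h.
  apply: nearW => n; rewrite rint_EFin; last exact: rint_expw_csq_ft.
  by rewrite lee_fin; apply: bound.
have rq : rint m2 (fun z => csq (ft X z)).
  apply/rint_ge0P => //; first by move=> z; exact: csq_ge0.
  by rewrite (le_lt_trans leB)// ltry.
by split => //; rewrite -lee_fin -rint_EFin.
Qed.

Lemma L2C_ft X : cinteg m2 X -> L2C X -> L2C (ft X).
Proof.
move=> iX lX; apply/L2CP; split; first exact: ft_meas.
exact: (plancherel_le iX lX).1.
Qed.

(** Continuity along the points w + v / (n + 1) for fixed [w] and [v]: exactly the pointwise
    convergence that dominated convergence asks for in [plancherel]. *)
Definition ray_continuous X := forall w v,
  complex.Re (X (aff2 n.+1%:R^-1 w v)) @[n --> \oo] --> complex.Re (X w) /\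
  complex.Im (X (aff2 n.+1%:R^-1 w v)) @[n --> \oo] --> complex.Im (X w).

Lemma pois2_scale (e : R) v : 0 < e -> e ^+ 2 * pois2 e (aff2 e (0, 0) v) = pois2 1 v.
Proof.
move=> e0; rewrite /pois2 /poisson /aff2 /= !add0r.
have e1 : e != 0 by rewrite gt_eqF.
have h (x : R) : e ^+ 2 + (e * x) ^+ 2 = e ^+ 2 * (1 + x ^+ 2) by ring.
have h0 (x : R) : 1 + x ^+ 2 != 0 by rewrite gt_eqF// ltr_pwDl ?sqr_ge0.
by rewrite !h expr1n; field; rewrite !h0 e1.
Qed.

(* Equality: substitute p.2 = p.1 + e v in the Poisson double integral and let
   e tend to 0 *)
Lemma plancherel X M : cinteg m2 X -> (forall w, cnorm1 (X w) <= M) ->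
  ray_continuous X ->
  \int[m2]_z csq (ft X z) = (2 * pi) ^+ 2 * \int[m2]_w csq (X w).
Proof.
move=> iX XM cX.
have M0 : 0 <= M by exact: le_trans (cnorm1_ge0 _) (XM (0, 0)).
have lX : L2C X by exact: L2C_of_cinteg iX XM.
have mX := cinteg_meas iX.
have [_ qX] := (L2CP X).1 lX.
have [rq _] := plancherel_le iX lX.
have mq := measurable_csq_ft iX.
(* The weights tend to 1 and the integrands stay below [csq (ft X z)], which is integrable by the
   inequality already proved. *)
have h1 : \int[m2]_z (expw n.+1%:R^-1 z * csq (ft X z)) @[n --> \oo] -->
    \int[m2]_z csq (ft X z).
  apply: (rdct_cvg _ _ _ rq) => //.
  - by move=> n; apply: measurable_funM => //; exact: measurable_expw.
  - apply: nearW => z; rewrite -[X in _ --> X]mul1r.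
    by apply: cvgM; [exact: cvg_expw|exact: cvg_cst].
  - move=> n z; rewrite ger0_norm; last first.
      by apply: mulr_ge0; [exact: expw_ge0|exact: csq_ge0].
    by rewrite ler_piMl ?csq_ge0// expw_le1.
(* The integrand after the substitution: the kernel has lost its dependence on [e], and the
   domination by [iD] is uniform in [e]. *)
pose G (e : R) (p : (R * R) * (R * R)) :=
  (X p.1)^*%C * X (aff2 e p.1 p.2) * (pois2 1 p.2)%:C.
have iD : rint m4 (fun p => M * (cnorm1 (X p.1) * pois2 1 p.2)).
  by apply: rintZ; exact: (rint_prod (cinteg_cnorm1 iX) (rint_pois2 ltr01)).
have mG e : cmfun (G e).
  apply: cmfunM.
    apply: cmfunM.
      by apply: cmfun_conj; exact: cmfun_comp mX measurable_fst.
    apply: cmfun_comp mX _.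
    exact: measurable_aff2_fun measurable_fst measurable_snd.
  apply: cmfun_real; apply: measurableT_comp (rint_meas (rint_pois2 ltr01)) _.
  exact: measurable_snd.
have GM e p : cnorm1 (G e p) <= M * (cnorm1 (X p.1) * pois2 1 p.2).
  rewrite /G mulrC cnorm1ZR ger0_norm ?pois2_ge0// mulrA [leRHS]mulrC.
  rewrite ler_wpM2l ?pois2_ge0//; apply: le_trans (cnorm1M _ _) _.
  by rewrite cnorm1_conj mulrC ler_wpM2r ?cnorm1_ge0.
have iG e : cinteg m4 (G e) by apply: (cinteg_le _ iD); [exact: mG|exact: GM].
have E e : 0 < e -> (\int[m2]_z (expw e z * csq (ft X z)))%:C = cint m4 (G e).
  move=> e0; have e1 : e != 0 by rewrite gt_eqF.
  have [iK ->] := ft_poisson e0 iX.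
  rewrite -(cfubini1 iK).2 -(cfubini1 (iG e)).2.
  congr cint; apply/funext => w /=.
  have iw : cinteg m2 (fun v => (X w)^*%C * X v * (pois2 e (aff2 (-1) w v))%:C).
    have N10 : -1 != 0 :> R by rewrite oppr_eq0 oner_eq0.
    have ip := cinteg_real (rint_aff2 w N10 (rint_pois2 e0)).
    under eq_fun do rewrite -mulrA [X in _ * X]mulrC.
    apply: cintegZ; exact: (cintegM_bnd ip mX XM).
  rewrite -(cint_aff2 w e1 iw) -cintZ; last exact: (cinteg_aff2 w e1 iw).
  congr cint; apply/funext => v; rewrite /G /=.
  have -> : pois2 e (aff2 (-1) w (aff2 e w v)) = pois2 e (aff2 e (0, 0) v).
    rewrite /pois2 /aff2 /= !add0r -[in RHS]poissonN -[in X in _ = _ * X]poissonN.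
    by congr (poisson _ _ * poisson _ _); ring.
  by rewrite -(pois2_scale v e0) rmorphM; ring.
have [h2 _] : complex.Re (cint m4 (G n.+1%:R^-1)) @[n --> \oo] -->
    complex.Re (cint m4 (G 0)) /\
    complex.Im (cint m4 (G n.+1%:R^-1)) @[n --> \oo] -->
    complex.Im (cint m4 (G 0)).
  have h := @cdct _ _ R m4 (fun n => G n.+1%:R^-1) (G 0) _ (fun n => mG _) (mG 0)
    _ iD (fun n p => GM _ p).
  apply: h.
  - apply: nearW; case=> w v.
    have [cr ci] := cX w v.
    have E0 : aff2 0 w v = w by rewrite /aff2 !mul0r !addr0; case: (w).
    rewrite /G /= E0; split.
      under eq_fun do rewrite cReM /= mulr0 subr0 cReM.
      rewrite cReM /= mulr0 subr0 cReM.
      apply: cvgM; last exact: cvg_cst.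
      by apply: cvgB; apply: cvgM => //; exact: cvg_cst.
    under eq_fun do rewrite cImM /= mulr0 add0r cImM.
    rewrite cImM /= mulr0 add0r cImM.
    apply: cvgM; last exact: cvg_cst.
    by apply: cvgD; apply: cvgM => //; exact: cvg_cst.
have E0 : complex.Re (cint m4 (G 0)) = (2 * pi) ^+ 2 * \int[m2]_w csq (X w).
  have -> : G 0 = (fun p => (csq (X p.1))%:C * (pois2 1 p.2)%:C).
    apply/funext => -[w v]; rewrite /G /=.
    have -> : aff2 0 w v = w by rewrite /aff2 !mul0r !addr0; case: (w).
    by rewrite -csq_mulJ; ring.
  rewrite (cint_prod (cinteg_real qX) (cinteg_real (rint_pois2 ltr01))).
  by rewrite !cint_real -rmorphM /= rintegral_pois2// mulrC.
transitivity (complex.Re (cint m4 (G 0))); last exact: E0.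
have h1E : (fun n => \int[m2]_z (expw n.+1%:R^-1 z * csq (ft X z))) =
    (fun n => complex.Re (cint m4 (G n.+1%:R^-1))).
  by apply/funext => n; rewrite -E.
rewrite h1E in h1.
by rewrite -(cvg_lim _ h1)// (cvg_lim _ h2).
Qed.

End plancherel.

(** * The transform on L^2 as a limit of transforms of truncations *)

Section fourier_L2.
Context {R : realType}.
Notation m2 := (lebesgue2 R).
Implicit Types (u : R * R -> R) (U V X : R * R -> R[i]).

Lemma ccvg_cnorm1 (a : nat -> R[i]) (b : R[i]) :
  cnorm1 (b - a n) @[n --> \oo] --> (0 : R) ->
  complex.Re (a n) @[n --> \oo] --> complex.Re b /\
  complex.Im (a n) @[n --> \oo] --> complex.Im b.
Proof.
move=> h; split; apply/cvgrPdist_le => /= e e0;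
  move/cvgr0Pnorm_le : h => /(_ _ e0); apply: filterS => n;
  rewrite ger0_norm ?cnorm1_ge0//; apply: le_trans.
- by rewrite -cReN -cReD Re_le_cnorm1.
- by rewrite -cImN -cImD Im_le_cnorm1.
Qed.

Lemma L2C_sub U V : L2C U -> L2C V -> L2C (fun w => U w - V w).
Proof.
move=> /L2CP[mU iU] /L2CP[mV iV]; apply/L2CP; split; first exact: cmfunB.
apply: (rint_le _ (rintD (rintZ 2 iU) (rintZ 2 iV))).
  by apply: cmfun_csq; exact: cmfunB.
move=> z; rewrite ger0_norm ?csq_ge0// /csq !(cReD, cImD, cReN, cImN).
have := sqr_ge0 (complex.Re (U z) + complex.Re (V z)).
have := sqr_ge0 (complex.Im (U z) + complex.Im (V z)).
by nra.
Qed.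

Lemma L2C_rint U : L2C U -> rint m2 (fun w => csq (U w)).
Proof. by move=> /L2CP[]. Qed.

Lemma L2C_cmfun U : L2C U -> cmfun U.
Proof. by move=> /L2CP[]. Qed.

(** Cauchy-Schwarz is replaced by ab <= t a^2 + b^2 / t up to a constant: a large [t] makes the term
    in [X] small, and then a large n makes the error term small. *)
Lemma cint_L2_cvg (F : nat -> R * R -> R[i]) U X :
  (forall n, L2C (F n)) -> L2C U -> L2C X ->
  \int[m2]_w csq (U w - F n w) @[n --> \oo] --> (0 : R) ->
  complex.Re (cint m2 (fun w => F n w * X w)) @[n --> \oo] -->
    complex.Re (cint m2 (fun w => U w * X w)) /\
  complex.Im (cint m2 (fun w => F n w * X w)) @[n --> \oo] -->
    complex.Im (cint m2 (fun w => U w * X w)).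
Proof.
move=> lF lU lX FU; apply: ccvg_cnorm1.
have lD n := L2C_sub lU (lF n).
have bnd n (t : R) : 0 < t -> cnorm1 (cint m2 (fun w => U w * X w) -
    cint m2 (fun w => F n w * X w)) <=
    t * \int[m2]_w csq (U w - F n w) + t^-1 * \int[m2]_w csq (X w).
  move=> t0.
  rewrite -cintB; [|exact: cinteg_L2M|exact: cinteg_L2M].
  have iDX : cinteg m2 (fun w => U w * X w - F n w * X w).
    by apply: cintegB; exact: cinteg_L2M.
  apply: le_trans (cnorm1_cint iDX) _.
  rewrite -!RintegralZl//; [|exact: L2C_rint|exact: L2C_rint (lD n)].
  rewrite -RintegralD//; [|exact: rintZ (L2C_rint (lD n))|exact: rintZ (L2C_rint lX)].
  apply: le_Rintegral => //; first exact: cinteg_cnorm1.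
    by apply: rintD; apply: rintZ; [exact: L2C_rint (lD n)|exact: L2C_rint].
  move=> w _; rewrite -mulrBl; apply: le_trans (cnorm1M _ _) _.
  set a := cnorm1 _; set b := cnorm1 _.
  have ha : a ^+ 2 <= 2 * csq (U w - F n w) by exact: cnorm1_le_csq.
  have hb : b ^+ 2 <= 2 * csq (X w) by exact: cnorm1_le_csq.
  have h0 : 0 <= t^-1 * (t * a - b) ^+ 2.
    by rewrite mulr_ge0 ?sqr_ge0// invr_ge0 ltW.
  have h1 : t^-1 * (t * a - b) ^+ 2 = t * a ^+ 2 + t^-1 * b ^+ 2 - 2 * (a * b).
    by field; rewrite gt_eqF.
  have h2 : t * a ^+ 2 <= t * (2 * csq (U w - F n w)) by rewrite ler_pM2l.
  have h3 : t^-1 * b ^+ 2 <= t^-1 * (2 * csq (X w)) by rewrite ler_pM2l ?invr_gt0.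
  by lra.
set B := \int[m2]_w csq (X w) in bnd *.
have B0 : 0 <= B by apply: Rintegral_ge0 => w _; exact: csq_ge0.
apply/cvgr0Pnorm_le => e e0.
(* Chosen so that t^-1 B is at most e / 2; the + 1 keeps [t] positive when [B] is zero. *)
pose t := 2 * (B + 1) / e.
have t0 : 0 < t by rewrite divr_gt0// mulr_gt0// ltr_wpDl.
have d0 : 0 < e / 2 / t by apply: divr_gt0 => //; apply: divr_gt0.
move/cvgr0Pnorm_le : FU => /(_ _ d0); apply: filterS => n.
rewrite ger0_norm; last by apply: Rintegral_ge0 => w _; exact: csq_ge0.
move=> hn; rewrite ger0_norm ?cnorm1_ge0//; apply: le_trans (bnd n t t0) _.
have h1 : t * \int[m2]_w csq (U w - F n w) <= e / 2.
  by rewrite mulrC -ler_pdivlMr.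
have h2 : t^-1 * B <= e / 2.
  rewrite /t invf_div mulrAC ler_pdivrMr ?mulr_gt0 ?ltr_wpDl//.
  have -> : e / 2 * (2 * (B + 1)) = e * (B + 1) by field.
  by rewrite ler_pM2l// lerDl.
by lra.
Qed.

Definition trunc u n (z : R * R) : R[i] := (u z * \1_(box n) z)%:C.

Lemma cinteg_trunc u n : L2 u -> cinteg m2 (trunc u n).
Proof. by move=> lu; apply: cinteg_real; exact: rint_L2_box. Qed.

Lemma indic_box_sqr n (z : R * R) : \1_(box n) z ^+ 2 = \1_(box n) z :> R.
Proof. by rewrite indicE; case: (_ \in _); rewrite ?expr1n ?expr0n. Qed.

Lemma rint_trunc_sqr u n : L2 u -> rint m2 (fun z => u z ^+ 2 * \1_(box n) z).
Proof.
by move=> /L2P[_ iu]; apply: rint_restrict => //; exact: measurable_box.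
Qed.

Lemma csq_trunc u n z : csq (trunc u n z) = u z ^+ 2 * \1_(box n) z.
Proof. by rewrite csq_real exprMn indic_box_sqr. Qed.

Lemma L2C_trunc u n : L2 u -> L2C (trunc u n).
Proof.
move=> lu; apply/L2CP; split; first exact: cinteg_meas (cinteg_trunc n lu).
by under eq_fun do rewrite csq_trunc; exact: rint_trunc_sqr.
Qed.

Lemma fourier_boxE u n w : L2 u -> fourier_box u n w = ft (trunc u n) w.
Proof.
move=> lu; apply: complex_ext; rewrite /fourier_box /ft /cint /=.
  rewrite rintegral_restrict; last exact: measurable_box.
  apply: eq_Rintegral => z _; rewrite mul0r subr0 cosN /dot.
  by rewrite [w.1 * _]mulrC [w.2 * _]mulrC mulrAC.
rewrite rintegral_restrict; last exact: measurable_box.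
rewrite -[LHS]mulN1r -(@RintegralZl _ _ _ m2)//; last first.
  have [_] := cinteg_ft w (cinteg_trunc n lu).
  move=> /rintN; congr (rint _ _); apply/funext => z /=.
  rewrite mul0r addr0 sinN /dot mulrN opprK.
  by rewrite [w.1 * _]mulrC [w.2 * _]mulrC mulrAC.
apply: eq_Rintegral => z _; rewrite mul0r addr0 sinN /dot.
by rewrite [w.1 * _]mulrC [w.2 * _]mulrC mulrAC mulrN mulN1r.
Qed.

Lemma sqdistcE (a b : R[i]) : sqdistc a b = csq (a - b).
Proof. by rewrite /csq cReD cImD cReN cImN. Qed.

Lemma is_fourier_cvg u U : is_fourier u U ->
  \int[m2]_w csq (U w - ft (trunc u n) w) @[n --> \oo] --> (0 : R).
Proof.
move=> [lu lU h].
have lD n : rint m2 (fun w => csq (U w - ft (trunc u n) w)).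
  apply: L2C_rint; apply: L2C_sub => //.
  by apply: L2C_ft; [exact: cinteg_trunc|exact: L2C_trunc].
rewrite /Rintegral; have -> : 0 = fine (0 : \bar R)%E by [].
apply: fine_cvg; apply: cvg_trans h; apply: near_eq_cvg; apply: nearW => n.
by apply: eq_integral => w _; rewrite sqdistcE fourier_boxE.
Qed.

Lemma is_fourier_intro u U : L2 u -> L2C U ->
  \int[m2]_w csq (U w - ft (trunc u n) w) @[n --> \oo] --> (0 : R) ->
  is_fourier u U.
Proof.
move=> lu lU h; split => //.
have lD n : rint m2 (fun w => csq (U w - ft (trunc u n) w)).
  apply: L2C_rint; apply: L2C_sub => //.
  by apply: L2C_ft; [exact: cinteg_trunc|exact: L2C_trunc].
have : ((\int[m2]_w csq (U w - ft (trunc u n) w))%:E @[n --> \oo] --> 0%:E)%E.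
  by apply: cvg_EFin; first exact: nearW.
apply: cvg_trans; apply: near_eq_cvg; apply: nearW => n.
rewrite -rint_EFin//; apply: eq_integral => w _.
by rewrite sqdistcE fourier_boxE.
Qed.

(** The formula holds for the integrable truncations of [u]. One side passes to the limit by
    dominated convergence, the other by L^2 convergence of the truncated transforms. *)
Lemma fourier_multiplication u U X : is_fourier u U -> cinteg m2 X -> L2C X ->
  cint m2 (fun z => (u z)%:C * ft X z) = cint m2 (fun w => U w * X w).
Proof.
move=> fuU iX lX; have [lu lU _] := fuU.
have lft := L2C_ft iX lX.
have lFn n : L2C (ft (trunc u n)).
  by apply: L2C_ft; [exact: cinteg_trunc|exact: L2C_trunc].
have [r1 i1] := cint_L2_cvg lFn lU lX (is_fourier_cvg fuU).
have E n : cint m2 (fun w => ft (trunc u n) w * X w) =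
    cint m2 (fun z => trunc u n z * ft X z).
  by rewrite L1_multiplication//; exact: cinteg_trunc.
have iuX := cinteg_L2M (L2C_real lu) lft.
have [r2 i2] : complex.Re (cint m2 (fun z => trunc u n z * ft X z)) @[n --> \oo] -->
      complex.Re (cint m2 (fun z => (u z)%:C * ft X z)) /\
    complex.Im (cint m2 (fun z => trunc u n z * ft X z)) @[n --> \oo] -->
      complex.Im (cint m2 (fun z => (u z)%:C * ft X z)).
  have h mF mf cF := @cdct _ _ R m2 (fun n z => trunc u n z * ft X z)
    (fun z => (u z)%:C * ft X z) _ mF mf cF (cinteg_cnorm1 iuX).
  apply: h.
  - move=> n; apply: cmfunM; first exact: cinteg_meas (cinteg_trunc n lu).
    exact: L2C_cmfun.
  - exact: cinteg_meas iuX.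
  - apply: nearW => z.
    have bz : \forall n \near \oo, trunc u n z = (u z)%:C.
      near=> n; rewrite /trunc indicE mem_set ?mulr1// /box /=.
      have : `|z.1| + `|z.2| <= n%:R.
        by near: n; exact: nbhs_infty_ger.
      move=> zn; split => /=; rewrite in_itv/= -ler_norml;
        by apply: le_trans zn; rewrite ?lerDl ?lerDr.
    split; apply: cvg_near_cst; apply: filterS bz => n ->; reflexivity.
  - move=> n z; rewrite /trunc !cnorm1ZR normrM ler_wpM2r ?cnorm1_ge0//.
    rewrite ler_piMr// indicE; case: (_ \in _); rewrite ?normr1 ?normr0//.
have EE : (fun n => cint m2 (fun w => ft (trunc u n) w * X w)) =
    (fun n => cint m2 (fun z => trunc u n z * ft X z)) by exact/funext.
apply: complex_ext.
- rewrite -(cvg_lim _ r2)// -(cvg_lim _ r1)//; congr (lim _).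
  by under [in RHS]eq_fun do rewrite E.
- rewrite -(cvg_lim _ i2)// -(cvg_lim _ i1)//; congr (lim _).
  by under [in RHS]eq_fun do rewrite E.
Unshelve. all: by end_near. Qed.

(** Both transforms are L^2 limits of the same sequence, and |U - V|^2 is at most twice the sum of
    the two squared distances to it. *)
Lemma is_fourier_unique u U V : is_fourier u U -> is_fourier u V ->
  {ae m2, forall w, U w = V w}.
Proof.
move=> fU fV; have [lu lU _] := fU; have [_ lV _] := fV.
have lFn n : L2C (ft (trunc u n)).
  by apply: L2C_ft; [exact: cinteg_trunc|exact: L2C_trunc].
have q := L2C_rint (L2C_sub lU lV).
have le0 : \int[m2]_w csq (U w - V w) <= 0.
  have c : 2 * \int[m2]_w csq (U w - ft (trunc u n) w) +
      2 * \int[m2]_w csq (V w - ft (trunc u n) w) @[n --> \oo] --> (2 * 0 + 2 * 0 : R).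
    apply: cvgD; apply: cvgM; try exact: cvg_cst; exact: is_fourier_cvg.
  rewrite -(_ : 2 * 0 + 2 * 0 = 0 :> R); last by ring.
  rewrite -(cvg_lim _ c)//; apply: limr_ge; first by apply/cvg_ex; eexists; exact: c.
  apply: nearW => n.
  have r1 := L2C_rint (L2C_sub lU (lFn n)); have r2 := L2C_rint (L2C_sub lV (lFn n)).
  rewrite -!RintegralZl// -RintegralD//; [|exact: rintZ r1|exact: rintZ r2].
  apply: le_Rintegral => //; first exact: rintD (rintZ 2 r1) (rintZ 2 r2).
  move=> w _; rewrite /csq !(cReD, cImD, cReN, cImN).
  set a := complex.Re (U w); set b := complex.Re (V w); set c1 := complex.Re (ft _ _).
  set a' := complex.Im (U w); set b' := complex.Im (V w); set c2 := complex.Im (ft _ _).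
  have := sqr_ge0 ((a - c1) + (b - c1)); have := sqr_ge0 ((a' - c2) + (b' - c2)).
  by nra.
have e0 : (\int[m2]_w `|(csq (U w - V w))%:E| = 0)%E.
  under eq_integral do rewrite gee0_abs ?lee_fin ?csq_ge0//.
  rewrite rint_EFin//; congr (_%:E); apply/le_anti/andP; split => //.
  by apply: Rintegral_ge0 => w _; exact: csq_ge0.
have mD : measurable_fun setT (fun w => (csq (U w - V w))%:E).
  by apply/measurable_EFinP; exact: rint_meas q.
have := (ae_eq_integral_abs m2 measurableT mD).1 e0.
apply: filterS => w /(_ I) [h]; apply/eqP; rewrite -subr_eq0; apply/eqP.
exact: csq_eq0.
Qed.

Lemma ft_real X z : cinteg m2 X -> (forall w, X (- w.1, - w.2) = (X w)^*%C) ->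
  ft X z = (complex.Re (ft X z))%:C.
Proof. by move=> iX hX; apply: complex_ext => //=; exact: ft_hermitian. Qed.

(* By Plancherel's equality for X and its inequality for the truncations of
   ft X, the squared L^2 error is at most a multiple of the mass of ft X
   outside of the box. *)
Lemma is_fourier_ft X M : cinteg m2 X -> (forall w, cnorm1 (X w) <= M) ->
  ray_continuous X -> (forall w, X (- w.1, - w.2) = (X w)^*%C) ->
  is_fourier (fun z => complex.Re (ft X z)) (fun w => ((2 * pi) ^+ 2)%:C * (X w)^*%C).
Proof.
move=> iX XM cX hX; set c4 := (2 * pi) ^+ 2.
have lX : L2C X by exact: L2C_of_cinteg iX XM.
have lft := L2C_ft iX lX.
set u := fun z => complex.Re (ft X z).
have uE z : ft X z = (u z)%:C by exact: ft_real.
have lu : L2 u by case: lft.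
have lY : L2C (fun w => c4%:C * (X w)^*%C).
  apply/L2CP; split.
    by apply: cmfunM; [exact: cmfun_cst|exact: cmfun_conj (L2C_cmfun lX)].
  by under eq_fun do rewrite csqZR csq_conj; exact: rintZ (L2C_rint lX).
apply: is_fourier_intro => //.
have qu : rint m2 (fun z => u z ^+ 2) by case/L2P : lu.
have mu : measurable_fun setT u by case/L2P : lu.
have c0 : 0 <= c4 by exact: sqr_ge0.
have bnd n : \int[m2]_w csq (c4%:C * (X w)^*%C - ft (trunc u n) w) <=
    c4 * (\int[m2]_z u z ^+ 2 - \int[m2]_z (u z ^+ 2 * \1_(box n) z)).
  have it := cinteg_trunc n lu; have lt := L2C_trunc n lu.
  have [qt let_] := plancherel_le it lt.
  have qX := L2C_rint lX.
  have iXt : cinteg m2 (fun w => X w * ft (trunc u n) w).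
    by apply: cinteg_L2M => //; exact: L2C_ft.
  have -> : (fun w => csq (c4%:C * (X w)^*%C - ft (trunc u n) w)) =
      (fun w => c4 ^+ 2 * csq (X w) + csq (ft (trunc u n) w) -
        2 * c4 * complex.Re (X w * ft (trunc u n) w)).
    apply/funext => w; rewrite /csq !(cReM, cImM, cReD, cImD, cReN, cImN) cRe_conj cIm_conj /=.
    ring.
  have iR := rintZ (2 * c4) iXt.1.
  rewrite RintegralB//; last first.
    by apply: rintD => //; exact: rintZ.
  rewrite RintegralD//; last exact: rintZ.
  rewrite !RintegralZl//; last exact: iXt.1.
  (* The cross term: the multiplication formula moves the transform onto [X], where it gives [u],
     and the truncation leaves the mass of [u ^+ 2] inside the box. *)
  have -> : \int[m2]_w complex.Re (X w * ft (trunc u n) w) =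
      \int[m2]_z (u z ^+ 2 * \1_(box n) z).
    rewrite -[LHS]/(complex.Re (cint m2 (fun w => X w * ft (trunc u n) w))).
    rewrite L1_multiplication//; apply: eq_Rintegral => z _.
    by rewrite uE /trunc -rmorphM /= mulrA expr2.
  have -> : \int[m2]_z u z ^+ 2 = c4 * \int[m2]_w csq (X w).
    rewrite -(plancherel iX XM cX); apply: eq_Rintegral => z _.
    by rewrite uE csq_real.
  move: let_; under eq_Rintegral do idtac.
  have -> : \int[m2]_w csq (trunc u n w) = \int[m2]_z (u z ^+ 2 * \1_(box n) z).
    by apply: eq_Rintegral => z _; rewrite csq_trunc.
  rewrite -/c4; set A := \int[m2]_w csq (X w); set B := \int[m2]_z (_ * _).
  by move=> h; nra.
have cv : c4 * (\int[m2]_z u z ^+ 2 - \int[m2]_z (u z ^+ 2 * \1_(box n) z))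
    @[n --> \oo] --> (0 : R).
  rewrite -[X in _ --> X](mulr0 c4) -[X in _ --> c4 * X](subrr (\int[m2]_z u z ^+ 2)).
  apply: cvgM; first exact: cvg_cst.
  apply: cvgB; first exact: cvg_cst.
  apply: (rdct_cvg _ _ _ qu).
  - by move=> n; exact: rint_meas (rint_trunc_sqr n lu).
  - exact: measurable_funX.
  - apply: nearW => z; apply: cvg_near_cst; near=> n.
    rewrite indicE mem_set ?mulr1// /box /=.
    have : `|z.1| + `|z.2| <= n%:R by near: n; exact: nbhs_infty_ger.
    move=> zn; split => /=; rewrite in_itv/= -ler_norml;
      by apply: le_trans zn; rewrite ?lerDl ?lerDr.
  - move=> n z; rewrite normrM (ger0_norm (sqr_ge0 _)) ler_piMr ?sqr_ge0//.
    by rewrite indicE; case: (_ \in _); rewrite ?normr1 ?normr0.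
apply: (squeeze_cvgr _ (cvg_cst 0) cv); apply: nearW => n; rewrite bnd andbT.
by apply: Rintegral_ge0 => w _; exact: csq_ge0.
Unshelve. all: by end_near. Qed.

End fourier_L2.

(** * Injectivity of the transform on L^1 *)

Section fourier_uniqueness.
Context {R : realType}.
Notation leb := (@lebesgue_measure R).
Notation m2 := (lebesgue2 R).
Notation m4 := (lebesgue2 R \x lebesgue2 R)%E.

(** Lebesgue differentiation: almost everywhere [g] is the derivative of its primitive, which is
    constant. *)
Lemma ae_eq0_integral_Nyc (g : R -> R) : rint leb g ->
  (forall x, \int[leb]_(t in `]-oo, x]) g t = 0) -> {ae leb, forall x, g x = 0}.
Proof.
move=> ig g0.
have h1 y : leb.-integrable `]-oo, y] (EFin \o g) by exact: integrableS ig.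
have h2 : locally_integrable setT g by apply: open_integrable_locally => //; exact: openT.
have := FTC1Ny h1 h2; apply: filterS.
  exact: (ae_filter_ringOfSetsType leb).
move=> x [_ <-].
have -> : (fun y => \int[leb]_(t in [set` `]-oo, y]]) g t) = cst 0.
  by apply/funext => y; rewrite g0.
by rewrite derive1_cst.
Qed.

Lemma ae_eq0_integral_measurable (D : R * R -> R) : rint m2 D ->
  (forall A, measurable A -> \int[m2]_(z in A) D z = 0) ->
  {ae m2, forall z, D z = 0}.
Proof.
move=> iD D0.
have := @integral_ae_eq _ _ _ m2 setT measurableT (cst 0%E) (EFin \o D) iD.
move=> /(_ (measurable_cst _)) h.
have {h} : ae_eq m2 setT (EFin \o D) (cst 0%E).
  apply: h => E _ mE; rewrite integral0.
  have iE : m2.-integrable E (EFin \o D) by exact: integrableS iD.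
  by rewrite -[LHS]fineK ?(integrable_fin_num _ iE)//; congr (_%:E); exact: D0.
by apply: filterS => z /(_ I) [].
Qed.

(** Half-lines are upgraded to measurable sets one coordinate at a time: integrating out the other
    coordinate leaves a function of one variable whose integrals over all half-lines vanish, hence a
    function null almost everywhere. *)
Lemma rintegral_setX_eq0 (D : R * R -> R) : rint m2 D ->
  (forall b d, \int[m2]_z (D z * (\1_`]-oo, b] z.1 * \1_`]-oo, d] z.2)) = 0) ->
  forall A B : set R, measurable A -> measurable B ->
  \int[m2]_z (D z * (\1_A z.1 * \1_B z.2)) = 0.
Proof.
move=> iD D0.
have rect (A B : set R) : measurable A -> measurable B ->
    rint m2 (fun z => D z * (\1_A z.1 * \1_B z.2)).
  move=> mA mB; apply: (rint_le _ (rint_norm iD)).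
    apply: measurable_funM; first exact: rint_meas iD.
    apply: measurable_funM.
      exact: measurableT_comp (measurable_indic mA) measurable_fst.
    exact: measurableT_comp (measurable_indic mB) measurable_snd.
  move=> z; rewrite normrM ler_piMr// !indicE.
  by case: (_ \in _); case: (_ \in _);
    rewrite ?mulr1 ?mul1r ?mulr0 ?mul0r ?normr1 ?normr0.
have step1 A d : measurable A ->
    \int[m2]_z (D z * (\1_A z.1 * \1_`]-oo, d] z.2)) = 0.
  move=> mA.
  pose g x := \int[leb]_y (D (x, y) * \1_`]-oo, d] y).
  have iDd : rint m2 (fun z => D z * \1_`]-oo, d] z.2).
    have := rect setT `]-oo, d]%classic measurableT (measurable_itv _).
    by congr (rint _ _); apply/funext => z; rewrite indicE in_setT mul1r.
  have ig : rint leb g := (rfubini1 iDd).1.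
  have gE B : measurable B -> \int[m2]_z (D z * (\1_B z.1 * \1_`]-oo, d] z.2)) =
      \int[leb]_x (g x * \1_B x).
    move=> mB; rewrite -(rfubini1 (rect B _ mB (measurable_itv _))).2 /=.
    apply: eq_Rintegral => x _; rewrite /g.
    rewrite indicE; case: (_ \in _).
      by rewrite mulr1; apply: eq_Rintegral => y _; rewrite mul1r.
    rewrite mulr0 -[RHS](mul0r (fine (leb setT))) -Rintegral_cst//.
    by apply: eq_Rintegral => y _; rewrite mul0r mulr0.
  rewrite gE//.
  have g0 : {ae leb, forall x, g x = 0}.
    apply: ae_eq0_integral_Nyc => // x; rewrite rintegral_restrict//.
    by rewrite -gE// D0.
  rewrite (@rint_ae_eq _ _ _ _ _ (fun=> 0)) ?Rintegral_cst ?mul0r//.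
    by apply: (ae_imp g0) => x ->; rewrite mul0r.
  by apply: measurable_funM => //; exact: rint_meas ig.
move=> A B mA mB.
pose g y := \int[leb]_x (D (x, y) * \1_A x).
have iDA : rint m2 (fun z => D z * \1_A z.1).
  have := rect A setT mA measurableT.
  by congr (rint _ _); apply/funext => z; rewrite [\1_setT _]indicE in_setT mulr1.
have ig : rint leb g := (rfubini2 iDA).1.
have gE S : measurable S -> \int[m2]_z (D z * (\1_A z.1 * \1_S z.2)) =
    \int[leb]_y (g y * \1_S y).
  move=> mS; rewrite -(rfubini2 (rect A _ mA mS)).2 /=.
  apply: eq_Rintegral => y _; rewrite /g.
  rewrite [\1_S _]indicE; case: (_ \in _).
    by rewrite mulr1; apply: eq_Rintegral => x _; rewrite mulr1.
  rewrite mulr0 -[RHS](mul0r (fine (leb setT))) -Rintegral_cst//.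
  by apply: eq_Rintegral => x _; rewrite !mulr0.
rewrite gE//.
have g0 : {ae leb, forall x, g x = 0}.
  apply: ae_eq0_integral_Nyc => // x; rewrite rintegral_restrict//.
  by rewrite -gE// step1.
rewrite (@rint_ae_eq _ _ _ _ _ (fun=> 0)) ?Rintegral_cst ?mul0r//.
  by apply: (ae_imp g0) => x ->; rewrite mul0r.
by apply: measurable_funM => //; exact: rint_meas ig.
Qed.

(** Measurable rectangles form a generating class stable under intersection, and the sets on which
    [D] integrates to 0 form a Dynkin class. *)
Lemma ae_eq0_quadrants (D : R * R -> R) : rint m2 D ->
  (forall b d, \int[m2]_z (D z * (\1_`]-oo, b] z.1 * \1_`]-oo, d] z.2)) = 0) ->
  {ae m2, forall z, D z = 0}.
Proof.
move=> iD D0; apply: ae_eq0_integral_measurable => // S mS.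
have iS X : measurable X -> m2.-integrable X (EFin \o D).
  by move=> mX; exact: integrableS iD.
have rect : forall A B, measurable A -> measurable B ->
    (\int[m2]_(z in A `*` B) (D z)%:E = 0)%E.
  move=> A B mA mB; have mAB := measurableX mA mB.
  rewrite -[LHS]fineK ?(integrable_fin_num _ (iS _ mAB))//; congr (_%:E).
  rewrite -[LHS]/(\int[m2]_(z in A `*` B) D z) rintegral_restrict//.
  rewrite -[RHS](rintegral_setX_eq0 iD D0 mA mB); apply: eq_Rintegral => z _.
  congr (_ * _); rewrite !indicE -natrM mulnb; congr (_%:R).
  by rewrite -in_setX; congr nat_of_bool; congr (_ \in _); case: (z).
have T0 : (\int[m2]_z (D z)%:E = 0)%E by rewrite -setXTT rect.
suff h : (\int[m2]_(z in S) (D z)%:E = 0)%E by rewrite /Rintegral h.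
move: S mS.
pose G : set (set (measurableTypeR R * measurableTypeR R)) :=
  [set A `*` B | A in measurable & B in measurable].
have := @dynkin_induction _ (measurableTypeR R * measurableTypeR R)%type G
  (fun S => \int[m2]_(z in S) (D z)%:E = 0)%E.
rewrite -measurable_prod_measurableType; apply => //.
- move=> _ _ [A1 mA1 [B1 mB1 <-]] [A2 mA2 [B2 mB2 <-]].
  rewrite -setXI; exists (A1 `&` A2); first exact: measurableI.
  by exists (B1 `&` B2) => //; exact: measurableI.
- by move=> _ [A mA [B mB <-]]; exact: rect.
- move=> S mS S0; have mCS := measurableC mS.
  move: T0; rewrite -(setUv S) integral_setU_EFin//.
  + by rewrite S0 add0e.
  + by rewrite setUv; exact: rint_meas iD.
  + exact/disj_setPCl.
- move=> F mF tF F0; have mU : measurable (\bigcup_k F k) by exact: bigcup_measurable.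
  rewrite integral_bigcup//; last exact: iS.
  by apply: eseries0 => n _ _; exact: F0.
Qed.

(* Testing against the Poisson kernels centred at all points, then averaging
   the centres with the weight th *)
Lemma rintegral_test_eq0 (D th : R * R -> R) : rint m2 D ->
  (forall e z0, 0 < e -> \int[m2]_z (D z * pois2 e (aff2 (-1) z0 z)) = 0) ->
  measurable_fun setT th -> (forall z, `|th z| <= 1) ->
  (forall z v, th (aff2 n.+1%:R^-1 z v) @[n --> \oo] --> th z) ->
  \int[m2]_z (D z * th z) = 0.
Proof.
move=> iD D0 mth th1 cth; have mD := rint_meas iD.
pose G (e : R) (p : (R * R) * (R * R)) := D p.1 * th (aff2 e p.1 p.2) * pois2 1 p.2.
have iK : rint m4 (fun p => `|D p.1| * pois2 1 p.2).
  exact: (rint_prod (rint_norm iD) (rint_pois2 ltr01)).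
have mG e : measurable_fun setT (G e).
  apply: measurable_funM; last first.
    exact: measurableT_comp (rint_meas (rint_pois2 ltr01)) measurable_snd.
  apply: measurable_funM; first exact: measurableT_comp mD measurable_fst.
  apply: measurableT_comp mth _.
  exact: measurable_aff2_fun measurable_fst measurable_snd.
have GM e p : `|G e p| <= `|D p.1| * pois2 1 p.2.
  rewrite /G normrM (ger0_norm (pois2_ge0 _ ler01)) normrM.
  by rewrite ler_wpM2r ?pois2_ge0// ler_piMr.
have iG e : rint m4 (G e) by apply: (rint_le _ iK); [exact: mG|exact: GM].
have G0 e : 0 < e -> \int[m4]_p G e p = 0.
  move=> e0; have e1 : e != 0 by rewrite gt_eqF.
  have iF : rint m4 (fun p => th p.1 * (D p.2 * pois2 e (aff2 (-1) p.1 p.2))).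
    have [iC _] := rint_conv2 iD (rint_pois2 e0).
    apply: (rint_le _ (rint_norm iC)).
      apply: measurable_funM; last exact: rint_meas iC.
      exact: measurableT_comp mth measurable_fst.
    by move=> p; rewrite normrM ler_piMl.
  have := rfubini iF; rewrite /=.
  rewrite (@eq_Rintegral _ _ _ _ _ (fun=> 0)); last first.
    move=> z0 _; rewrite RintegralZl//; first by rewrite D0// mulr0.
    have := rint_aff2 z0 (_ : -1 != 0 :> R) (rint_pois2 e0).
    rewrite oppr_eq0 oner_eq0 => /(_ isT) ip.
    apply: (rint_le _ (rintZ ((2 / e) ^+ 2) (rint_norm iD))).
      by apply: measurable_funM => //; exact: rint_meas ip.
    move=> z; rewrite normrM mulrC ler_wpM2r//.
    rewrite ger0_norm ?pois2_ge0 ?(ltW e0)//.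
    have pb x : poisson e x <= 2 / e.
      have h0 : 0 < e ^+ 2 + x ^+ 2 by rewrite ltr_pwDl ?sqr_ge0// exprn_gt0.
      rewrite /poisson ler_pdivrMr// mulrAC ler_pdivlMr//.
      have := sqr_ge0 x; nra.
    by rewrite /pois2 expr2 ler_pM ?poisson_ge0 ?(ltW e0)//.
  rewrite Rintegral_cst// mul0r => /esym hF.
  rewrite -(rfubini1 (iG e)).2 -[RHS]hF; apply: eq_Rintegral => w _ /=.
  have iw : rint m2 (fun z => th z * (D w * pois2 e (aff2 (-1) z w))).
    have := rint_aff2 (- w.1, - w.2) (oner_neq0 R) (rint_pois2 e0).
    move=> /(rintZ (D w))/rint_norm h; apply: (rint_le _ h).
      apply: measurable_funM => //; apply: measurable_funM => //.
      apply: measurableT_comp (rint_meas (rint_pois2 e0)) _.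
      exact: measurable_aff2_fun.
    move=> z; rewrite normrM /aff2 /= !mulN1r !mul1r.
    by rewrite [- w.1 + _]addrC [- w.2 + _]addrC ler_piMl.
  rewrite -(rintegral_aff2 w e1 iw) -RintegralZl//; last exact: (rint_aff2 w e1 iw).
  apply: eq_Rintegral => v _; rewrite /G /=.
  have -> : pois2 e (aff2 (-1) (aff2 e w v) w) = pois2 e (aff2 e (0, 0) v).
    by rewrite /pois2 /aff2 /=; congr (poisson _ _ * poisson _ _); ring.
  by rewrite -(pois2_scale v e0); ring.
have lim0 : \int[m4]_p G n.+1%:R^-1 p @[n --> \oo] --> \int[m4]_p G 0 p.
  have h mF mf cF := @rdct_cvg _ _ R m4 (fun n => G n.+1%:R^-1) (G 0) _ mF mf cF iK.
  apply: (h (fun n => mG _) (mG 0) _ (fun n => GM _)).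
  apply: nearW; case=> w v; rewrite /G /=.
  have -> : aff2 0 w v = w by rewrite /aff2 !mul0r !addr0; case: (w).
  apply: cvgM; last exact: cvg_cst.
  by apply: cvgM; [exact: cvg_cst|exact: cth].
have E0 : \int[m4]_p G 0 p = (\int[m2]_z (D z * th z)) * (2 * pi) ^+ 2.
  have iDth : rint m2 (fun z => D z * th z).
    apply: (rint_le _ (rint_norm iD)); first by apply: measurable_funM.
    by move=> z; rewrite normrM ler_piMr.
  rewrite -(rintegral_pois2 ltr01) -(rintegral_prod iDth (rint_pois2 ltr01)).
  apply: eq_Rintegral; case=> w v _; rewrite /G /=.
  by have -> : aff2 0 w v = w by rewrite /aff2 !mul0r !addr0; case: (w).
have : \int[m4]_p G 0 p = 0.
  rewrite -(cvg_lim _ lim0)//.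
  have -> : (fun n => \int[m4]_p G n.+1%:R^-1 p) = (fun=> 0).
    by apply/funext => n; rewrite G0.
  exact: lim_cst.
rewrite E0 => /eqP; rewrite mulf_eq0 => /orP[/eqP //|].
by rewrite gt_eqF// exprn_gt0// mulr_gt0// pi_gt0.
Qed.

(** Quadrants are reached from the vanishing Poisson integrals through continuous test functions
    bounded by 1 that converge pointwise to their indicators. *)
Lemma ae_eq0_poisson (D : R * R -> R) : rint m2 D ->
  (forall e z0, 0 < e -> \int[m2]_z (D z * pois2 e (aff2 (-1) z0 z)) = 0) ->
  {ae m2, forall z, D z = 0}.
Proof.
move=> iD D0; have mD := rint_meas iD.
apply: ae_eq0_quadrants => // b d.
(* Equal to 1 for x <= b and to e^{-2n(x - b)} for x > b: a continuous approximation of the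
   indicator of the half-line. *)
pose r (b : R) n (x : R) := expR (- (n%:R * (`|x - b| + (x - b)))).
have ppos (b' x : R) : 0 <= `|x - b'| + (x - b').
  by rewrite -lerBlDr sub0r ler_normr lexx orbT.
have r0 b' n x : 0 <= r b' n x by exact: expR_ge0.
have r1 b' n x : r b' n x <= 1.
  by rewrite -expR0 ler_expR oppr_le0 mulr_ge0.
have cr b' n : continuous (r b' n).
  move=> x; apply: continuous_comp; last exact: continuous_expR.
  apply: cvgN; apply: cvgM; first exact: cvg_cst.
  have c0 : (fun y : R => y - b') y @[y --> x] --> x - b'.
    by apply: cvgB; [exact: cvg_id|exact: cvg_cst].
  by apply: cvgD => //; exact: cvg_norm.
have rlim b' x : r b' n x @[n --> \oo] --> (\1_`]-oo, b'] x : R).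
  rewrite indicE; case: (boolP (x \in _)) => [|]; rewrite ?inE ?notin_setE/= in_itv/=.
    move=> xb; have -> : (fun n => r b' n x) = cst 1; last exact: cvg_cst.
    apply/funext => n; rewrite /r ler0_norm ?subr_le0// addrC subrr mulr0 oppr0.
    exact: expR0.
  move=> /negP; rewrite -ltNge => bx.
  have p0 : 0 < `|x - b'| + (x - b').
    by rewrite gtr0_norm ?subr_gt0// addr_gt0 ?subr_gt0.
  have := cvg_expR_decay p0; move/(cvg_comp _ _ (@cvgr_idn R)).
  by apply: cvg_trans; apply: near_eq_cvg; apply: nearW => n; rewrite /r /= mulrC.
have mr b' n : measurable_fun setT (r b' n).
  by apply: continuous_measurable_fun; exact: cr.
have h n : \int[m2]_z (D z * (r b n z.1 * r d n z.2)) = 0.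
  apply: rintegral_test_eq0 => //.
  - apply: measurable_funM.
      exact: measurableT_comp (mr _ _) measurable_fst.
    exact: measurableT_comp (mr _ _) measurable_snd.
  - by move=> z; rewrite ger0_norm ?mulr_ge0// mulr_ile1.
  - move=> z v; rewrite /aff2 /=.
    have c1 (x y : R) : x + k.+1%:R^-1 * y @[k --> \oo] --> x.
      rewrite -[X in _ --> X]addr0 -[X in _ --> x + X](mul0r y).
      apply: cvgD; first exact: cvg_cst.
      by apply: cvgM; [exact: (@cvg_harmonic R)|exact: cvg_cst].
    by apply: cvgM; apply: continuous_cvg; [exact: cr|exact: c1|exact: cr|exact: c1].
have : \int[m2]_z (D z * (r b n z.1 * r d n z.2)) @[n --> \oo] -->
    \int[m2]_z (D z * (\1_`]-oo, b] z.1 * \1_`]-oo, d] z.2)).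
  apply: (rdct_cvg _ _ _ (rint_norm iD)).
  - move=> n; apply: measurable_funM => //; apply: measurable_funM.
      exact: measurableT_comp (mr _ _) measurable_fst.
    exact: measurableT_comp (mr _ _) measurable_snd.
  - apply: measurable_funM => //; apply: measurable_funM.
      apply: measurableT_comp measurable_fst; exact: measurable_indic.
    apply: measurableT_comp measurable_snd; exact: measurable_indic.
  - apply: nearW => z; apply: cvgM; first exact: cvg_cst.
    by apply: cvgM; exact: rlim.
  - move=> n z; rewrite normrM ler_piMr//.
    by rewrite ger0_norm ?mulr_ge0// mulr_ile1.
under eq_fun do rewrite h; move=> /cvg_lim <- //.
by rewrite lim_cst.
Qed.

(** Poisson kernels centred at any point are transforms of modulated exponential weights, so the
    multiplication formula turns [ft D = 0] into the vanishing of all Poisson integrals of [D]. *)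
Lemma ft_eq0_ae (D : R * R -> R[i]) : cinteg m2 D -> (forall z, ft D z = 0) ->
  {ae m2, forall w, D w = 0}.
Proof.
move=> iD D0.
have h e z0 : 0 < e ->
    cint m2 (fun w => (pois2 e (aff2 (-1) z0 w))%:C * D w) = 0.
  move=> e0; pose X (z : R * R) := (expw e z)%:C * expi (dot z z0).
  have iX : cinteg m2 X.
    apply: cinteg_expi; first exact: cinteg_real (rint_expw e0).
    exact: measurable_dot.
  have ftX w : ft X w = (pois2 e (aff2 (-1) z0 w))%:C.
    rewrite -cint_expw//; congr cint; apply/funext => z.
    rewrite /X -mulrA -expiD; congr (_ * expi _); rewrite /dot /aff2 /=; ring.
  under eq_fun do rewrite -ftX.
  rewrite -L1_multiplication//.
  under eq_fun do rewrite D0 mulr0.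
  by rewrite (cint_real m2 (fun=> 0)) Rintegral_cst// mul0r.
have reD : {ae m2, forall z, complex.Re (D z) = 0}.
  apply: ae_eq0_poisson; first by case: iD.
  move=> e z0 e0; have := congr1 (@complex.Re R) (h e z0 e0) => /= <-.
  by apply: eq_Rintegral => z _; rewrite cReM /= mul0r subr0 mulrC.
have imD : {ae m2, forall z, complex.Im (D z) = 0}.
  apply: ae_eq0_poisson; first by case: iD.
  move=> e z0 e0; have := congr1 (@complex.Im R) (h e z0 e0) => /= <-.
  by apply: eq_Rintegral => z _; rewrite cImM /= mul0r addr0 mulrC.
by apply: (ae_imp2 reD imD) => z rz iz; apply: complex_ext.
Qed.

End fourier_uniqueness.

(** * Agreement of the L^1 and L^2 transforms, and inversion *)

Section fourier_inversion.
Context {R : realType}.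
Notation m2 := (lebesgue2 R).
Implicit Types (u : R * R -> R) (U X : R * R -> R[i]).

Lemma rint_ge0_eq0_ae (f : R * R -> R) : rint m2 f -> (forall z, 0 <= f z) ->
  \int[m2]_z f z = 0 -> {ae m2, forall z, f z = 0}.
Proof.
move=> fi f0 h.
have e0 : (\int[m2]_z `|(f z)%:E| = 0)%E.
  under eq_integral do rewrite gee0_abs ?lee_fin//.
  by rewrite rint_EFin// h.
have mf : measurable_fun setT (fun z => (f z)%:E).
  by apply/measurable_EFinP; exact: rint_meas fi.
have := (ae_eq_integral_abs m2 measurableT mf).1 e0.
by move=> h1; apply: (ae_imp h1) => z /(_ I) [].
Qed.

(** This is 4 / ((1 + x^2)(1 + y^2)), the transform of e^{-|x| - |y|}. Being positive, bounded and
    integrable, it serves both as a weight that can be divided out and as a majorant on the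
    plane. *)
Definition kap (z : R * R) : R := pois2 1 z.

Lemma kap_gt0 z : 0 < kap z.
Proof.
by rewrite /kap /pois2 /poisson mulr_gt0// divr_gt0// expr1n ltr_pwDl// sqr_ge0.
Qed.

Lemma kap_le4 z : kap z <= 4.
Proof.
have h (x : R) : poisson 1 x <= 2.
  have h0 : 0 < 1 ^+ 2 + x ^+ 2 by rewrite expr1n ltr_pwDl ?sqr_ge0.
  by rewrite /poisson ler_pdivrMr//; have := sqr_ge0 x; nra.
have -> : 4 = 2 * 2 :> R by ring.
by rewrite ler_pM ?poisson_ge0.
Qed.

Lemma rint_kap : rint m2 kap.
Proof. exact: rint_pois2. Qed.

Lemma cinteg_kap : cinteg m2 (fun z => (kap z)%:C).
Proof. exact: cinteg_real rint_kap. Qed.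

Lemma cnorm1_kap z : cnorm1 (kap z)%:C <= 4.
Proof. by rewrite cnorm1_real gtr0_norm ?kap_gt0// kap_le4. Qed.

Lemma L2C_kap : L2C (fun z => (kap z)%:C).
Proof. exact: L2C_of_cinteg cinteg_kap cnorm1_kap. Qed.

Lemma cmfun_kap : cmfun (fun z => (kap z)%:C).
Proof. exact: cinteg_meas cinteg_kap. Qed.

Lemma cinteg_bndM X U M : cmfun X -> (forall z, cnorm1 (X z) <= M) ->
  cinteg m2 U -> cinteg m2 (fun z => X z * U z).
Proof.
by move=> mX XM iU; under eq_fun do rewrite mulrC; exact: cintegM_bnd iU mX XM.
Qed.

(** Both transforms satisfy the multiplication formula, so their difference is orthogonal to every
    admissible test function, in particular to a weighted conjugate of itself. *)
Lemma is_fourier_L1 u U : is_fourier u U -> rint m2 u ->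
  {ae m2, forall w, U w = ft (fun z => (u z)%:C) w}.
Proof.
move=> fU iu; have [lu lU _] := fU; have icu := cinteg_real iu.
set V := ft _; pose B := 2 * \int[m2]_z cnorm1 (u z)%:C.
have VB w : cnorm1 (V w) <= B by exact: ft_bound.
have mV : cmfun V by exact: ft_meas.
pose Z w := U w - V w.
have mZ : cmfun Z by apply: cmfunB => //; exact: L2C_cmfun.
(* Tested against this, the difference [Z] yields its squared norm with the positive weight [kap].
   The weight restores integrability, since [V] is controlled here by a sup bound only. *)
pose X w := (Z w)^*%C * (kap w)%:C.
have lX0 : L2C (fun w => Z w * (kap w)%:C).
  have l1 : L2C (fun w => U w * (kap w)%:C).
    exact: L2C_bnd lU cmfun_kap cnorm1_kap.
  have l2 : L2C (fun w => (kap w)%:C * V w) by exact: L2C_bnd L2C_kap mV VB.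
  have := L2C_sub l1 l2; congr L2C; apply/funext => w; rewrite /Z; ring.
have iX0 : cinteg m2 (fun w => Z w * (kap w)%:C).
  have i1 := cinteg_L2M lU L2C_kap.
  have i2 : cinteg m2 (fun w => (kap w)%:C * V w) by exact: cintegM_bnd cinteg_kap mV VB.
  have := cintegB i1 i2; congr (cinteg _ _); apply/funext => w; rewrite /Z; ring.
have XE : X = (fun w => (Z w * (kap w)%:C)^*%C).
  by apply/funext => w; rewrite cconjM conjc_real.
have iX : cinteg m2 X by rewrite XE; exact: cinteg_conj.
have lX : L2C X.
  rewrite XE; apply/L2CP; split; first exact: cmfun_conj (L2C_cmfun lX0).
  by under eq_fun do rewrite csq_conj; exact: L2C_rint.
have E1 := fourier_multiplication fU iX lX.
rewrite (L1_multiplication icu iX) in E1.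
have iUX := cinteg_L2M lU lX.
have iVX : cinteg m2 (fun w => V w * X w) by exact: cinteg_bndM mV VB iX.
have Zint : cint m2 (fun w => Z w * X w) = 0.
  rewrite /Z; under eq_fun do rewrite mulrBl.
  by rewrite cintB// -E1 subrr.
have ZXE : (fun w => Z w * X w) = (fun w => (csq (Z w) * kap w)%:C).
  by apply/funext => w; rewrite /X mulrA csq_mulJ -rmorphM.
have iq : rint m2 (fun w => csq (Z w) * kap w).
  have : cinteg m2 (fun w => Z w * X w).
    have := cintegB iUX iVX; congr (cinteg _ _); apply/funext => w.
    by rewrite /Z mulrBl.
  by rewrite ZXE => -[].
have q0 z : 0 <= csq (Z z) * kap z by rewrite mulr_ge0 ?csq_ge0// ltW// kap_gt0.
rewrite ZXE cint_real in Zint; case: Zint => Zint.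
apply: (ae_imp (rint_ge0_eq0_ae iq q0 Zint)) => w /eqP.
rewrite mulf_eq0 (gt_eqF (kap_gt0 w)) orbF => /eqP /csq_eq0 h.
by apply/eqP; rewrite -subr_eq0; apply/eqP.
Qed.

Definition ift U (z : R * R) : R[i] := cint m2 (fun w => U w * expi (dot z w)).

Lemma ift_ft U z : ift U z = ft U (- z.1, - z.2).
Proof.
by congr cint; apply/funext => w; rewrite /dot /= !mulNr -opprD opprK.
Qed.

Lemma cinteg_ift U z : cinteg m2 U -> cinteg m2 (fun w => U w * expi (dot z w)).
Proof. by move=> iU; apply: cinteg_expi => //; exact: measurable_dot. Qed.

Lemma measurable_opp2 : measurable_fun setT (fun z : R * R => (- z.1, - z.2)).
Proof.
have := measurable_aff2 (-1 : R) (0, 0); congr (measurable_fun _ _).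
by apply/funext => z; rewrite /aff2 /= !add0r !mulN1r.
Qed.

Lemma ift_meas U : cinteg m2 U -> cmfun (ift U).
Proof.
move=> iU; have -> : ift U = (fun z => ft U (- z.1, - z.2)).
  by apply/funext => z; exact: ift_ft.
exact: cmfun_comp (ft_meas iU) measurable_opp2.
Qed.

Lemma ift_bound U z : cinteg m2 U ->
  cnorm1 (ift U z) <= 2 * \int[m2]_w cnorm1 (U w).
Proof. by move=> iU; rewrite ift_ft; exact: ft_bound. Qed.

Lemma ray_continuous_expw : ray_continuous (fun w => (expw 1 w)%:C : R[i]).
Proof.
move=> w v; split; last exact: cvg_cst.
have c1 (x y : R) : x + k.+1%:R^-1 * y @[k --> \oo] --> x.
  rewrite -[X in _ --> X]addr0 -[X in _ --> x + X](mul0r y).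
  apply: cvgD; first exact: cvg_cst.
  by apply: cvgM; [exact: (@cvg_harmonic R)|exact: cvg_cst].
apply: cvgM; (apply: continuous_cvg; [exact: continuous_expabs|exact: c1]).
Qed.

Lemma cnorm1_expw w : cnorm1 (expw 1 w)%:C <= 1 :> R.
Proof. by rewrite cnorm1_real ger0_norm ?expw_ge0// expw_le1. Qed.

Lemma ft_expw z : ft (fun w => (expw 1 w)%:C) z = (kap z)%:C.
Proof.
have := cint_expw (- z.1, - z.2) ltr01.
rewrite [RHS](_ : _ = (kap z)%:C); last by rewrite /kap /pois2 /= !poissonN.
move=> <-; congr cint; apply/funext => w; congr (_ * expi _).
by rewrite /dot /=; ring.
Qed.

(** [kap] is the transform of [expw 1], so inversion for this single pair follows from
    [is_fourier_ft] and [is_fourier_L1]; the latter is an almost everywhere statement, hence the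
    form of this one. *)
Lemma ft_kap_ae : {ae m2, forall w,
  ft (fun z => (kap z)%:C) w = ((2 * pi) ^+ 2 * expw 1 w)%:C}.
Proof.
have iX : cinteg m2 (fun w => (expw 1 w)%:C) by exact: cinteg_real (rint_expw ltr01).
have hX w : ((expw 1 (- w.1, - w.2))%:C : R[i]) = ((expw 1 w)%:C)^*%C.
  by rewrite conjc_real /expw /expabs /= !normrN.
have := is_fourier_ft iX cnorm1_expw ray_continuous_expw hX.
have -> : (fun z => complex.Re (ft (fun w => (expw 1 w)%:C) z)) = kap.
  by apply/funext => z; rewrite ft_expw.
move=> /is_fourier_L1/(_ rint_kap) h; apply: (ae_imp h) => w <-.
by rewrite conjc_real -rmorphM.
Qed.

(** Since [u] is only in L^2, both sides are multiplied by [kap] to become integrable. The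
    transforms of the two products are then the same integral of [U] against a translate of
    [expw 1], the first by the multiplication formula and the second by Fubini and inversion for
    [kap]. Injectivity concludes. *)
Lemma fourier_inversion u U : is_fourier u U -> cinteg m2 U ->
  {ae m2, forall z, (u z)%:C = (((2 * pi) ^+ 2)^-1)%:C * ift U z}.
Proof.
move=> fU iU; have [lu lU _] := fU.
set c := ((2 * pi) ^+ 2)^-1.
have c4 : (2 * pi) ^+ 2 != 0 :> R by rewrite gt_eqF// exprn_gt0// mulr_gt0// pi_gt0.
have mP := ift_meas iU.
have n10 : 1 != 0 :> R by rewrite oner_eq0.
have N10 : -1 != 0 :> R by rewrite oppr_eq0 oner_eq0.
have iE : cinteg m2 (fun w => (expw 1 w)%:C) by exact: cinteg_real (rint_expw ltr01).
have i1 : cinteg m2 (fun z => (u z)%:C * (kap z)%:C).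
  exact: cinteg_L2M (L2C_real lu) L2C_kap.
have i2 : cinteg m2 (fun z => (kap z)%:C * ift U z).
  exact: cintegM_bnd cinteg_kap mP (fun z => ift_bound z iU).
pose D z := (u z)%:C * (kap z)%:C - c%:C * ((kap z)%:C * ift U z).
have iD : cinteg m2 D by apply: cintegB => //; exact: cintegZ.
suff D0 h : ft D h = 0.
  apply: (ae_imp (ft_eq0_ae iD D0)) => z /eqP; rewrite /D subr_eq0 => /eqP hz.
  have kz : (kap z)%:C != 0 :> R[i].
    by apply/eqP => -[k0]; have := kap_gt0 z; rewrite k0 ltxx.
  by apply: (mulIf kz); rewrite hz; ring.
(* The translate of [expw 1] centred at [h]; its transform is [kap] modulated by the character of
   frequency [h]. *)
pose Xh w := (expw 1 (aff2 1 (- h.1, - h.2) w))%:C : R[i].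
have iXh : cinteg m2 Xh by exact: (cinteg_aff2 (- h.1, - h.2) n10 iE).
have lXh : L2C Xh by apply: (L2C_of_cinteg iXh) => z; exact: cnorm1_expw.
have ftXh z : ft Xh z = (kap z)%:C * expi (- dot z h).
  rewrite -[LHS]mul1r -[1](_ : (1 ^+ 2)%:C = _); last by rewrite expr1n.
  rewrite -ft_expw /ft -cintZr; last exact: cinteg_ft.
  have := cint_aff2 (- h.1, - h.2) n10 (F := fun w => (expw 1 w)%:C *
    expi (- dot z w) * expi (- dot z h)).
  move=> <-; last first.
    apply: (cintegM_bnd (cinteg_ft z iE) (cmfun_cst _ _)) => w; exact: lexx.
  congr (_ * _); congr cint; apply/funext => w; rewrite /Xh -mulrA -expiD.
  by congr (_ * expi _); rewrite /dot /aff2 /=; ring.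
have A1 : cint m2 (fun z => (u z)%:C * (kap z)%:C * expi (- dot h z)) =
    cint m2 (fun w => U w * Xh w).
  rewrite -(fourier_multiplication fU iXh lXh); congr cint; apply/funext => z.
  by rewrite ftXh mulrA; congr (_ * expi _); rewrite /dot; ring.
have A2 : cint m2 (fun z => (kap z)%:C * ift U z * expi (- dot h z)) =
    ((2 * pi) ^+ 2)%:C * cint m2 (fun w => U w * Xh w).
  have md : measurable_fun setT (fun p : (R * R) * (R * R) =>
      dot p.1 (aff2 (-1) p.2 h)).
    apply: measurable_dot measurable_fst _.
    exact: measurable_aff2_fun measurable_snd (measurable_cst _).
  have iF := cinteg_kernel cinteg_kap iU md.
  transitivity (cint m2 (fun z => cint m2 (fun w => (kap z)%:C * U w *
      expi (dot z (aff2 (-1) w h))))).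
    congr cint; apply/funext => z; rewrite /ift mulrAC -cintZ; last exact: cinteg_ift.
    congr cint; apply/funext => w.
    have -> : dot z (aff2 (-1) w h) = - dot h z + dot z w.
      by rewrite /dot /aff2 /=; ring.
    by rewrite (expiD (- dot h z)); ring.
  rewrite (cfubini iF).
  have E w : cint m2 (fun z => (kap z)%:C * U w * expi (dot z (aff2 (-1) w h))) =
      U w * ft (fun z => (kap z)%:C) (aff2 (-1) h w).
    rewrite /ft -cintZ; last exact: cinteg_ft cinteg_kap.
    congr cint; apply/funext => z.
    have -> : dot z (aff2 (-1) w h) = - dot (aff2 (-1) h w) z.
      by rewrite /dot /aff2 /=; ring.
    by ring.
  under eq_fun do rewrite E.
  pose F w := U w * ft (fun z => (kap z)%:C) (aff2 (-1) h w).
  pose F' w := U w * ((2 * pi) ^+ 2 * expw 1 (aff2 (-1) h w))%:C.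
  have mk : cmfun (ft (fun z => (kap z)%:C)) by exact: ft_meas cinteg_kap.
  have mE : cmfun (fun w => ((2 * pi) ^+ 2 * expw 1 w)%:C : R[i]).
    by apply: cmfun_real; apply: measurable_funM => //; exact: measurable_expw.
  have iF1 : cinteg m2 F.
    apply: (cintegM_bnd iU); first exact: cmfun_comp mk (measurable_aff2 _ _).
    by move=> w; exact: ft_bound cinteg_kap.
  have iF2 : cinteg m2 F'.
    apply: (@cintegM_bnd _ _ _ _ _ _ ((2 * pi) ^+ 2) iU).
      exact: cmfun_comp mE (measurable_aff2 _ _).
    move=> w; rewrite cnorm1_real normrM (ger0_norm (sqr_ge0 _)).
    by rewrite ler_piMr ?sqr_ge0// ger0_norm ?expw_ge0// expw_le1.
  have invol w : aff2 (-1) h (aff2 (-1) h w) = w.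
    by rewrite /aff2 /=; case: w => a b /=; congr pair; ring.
  rewrite -/F -cintZ; last first.
    by apply: (cintegM_bnd iU (cinteg_meas iXh)) => w; exact: cnorm1_expw.
  transitivity (cint m2 F').
    (* Reflecting w into h - w puts the bare variable inside the transform of [kap], so that the
       almost everywhere identity applies without pulling back a null set. *)
    rewrite -(cint_aff2 h N10 iF1) -(cint_aff2 h N10 iF2); congr (_ * _).
    apply: cint_ae_eq.
    - apply: (ae_imp ft_kap_ae) => w hw; rewrite /F /F' invol hw//.
    - exact: cinteg_meas (cinteg_aff2 h N10 iF1).
    - exact: cinteg_meas (cinteg_aff2 h N10 iF2).
  congr cint; apply/funext => w; rewrite /F' /Xh rmorphM mulrCA; congr (_ * (_ * _)).
  congr (_%:C); rewrite /expw /aff2 /= /expabs.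
  by congr (expR (- (1 * _)) * expR (- (1 * _))); rewrite -normrN; congr `|_|; ring.
rewrite /ft /D; under eq_fun do rewrite mulrBl -[X in _ - X]mulrA.
rewrite cintB; last 2 first.
- exact: cinteg_ft.
- by apply: cintegZ; exact: cinteg_ft.
rewrite cintZ; last exact: cinteg_ft.
by rewrite A1 A2 mulrA -rmorphM mulVf// mul1r subrr.
Qed.

End fourier_inversion.

(** * The equation on the Fourier side *)

Section test_functions.
Context {R : realType}.
Notation leb := (@lebesgue_measure R).
Notation m2 := (lebesgue2 R).

(** An integrable majorant of (1 + |x|)^2 e^{-|x|}. The constant is 4^2, from 1 + s <= 4 e^{s/4}. *)
Definition hexp (x : R) : R := 16 * expabs 2^-1 x.

Lemma sqr_expabs_le (x : R) : (1 + `|x|) ^+ 2 * expabs 1 x <= hexp x.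
Proof.
have h : 1 + `|x| <= 4 * expR (`|x| / 4).
  have := @expR_ge1Dx R (`|x| / 4); have := normr_ge0 x; lra.
have h2 : (1 + `|x|) ^+ 2 <= 16 * expR (`|x| / 2).
  have -> : `|x| / 2 = `|x| / 4 + `|x| / 4 by field.
  rewrite expRD; have -> : 16 * (expR (`|x| / 4) * expR (`|x| / 4)) =
    (4 * expR (`|x| / 4)) ^+ 2 by ring.
  by rewrite lerXn2r// nnegrE ?addr_ge0// mulr_ge0 ?expR_ge0.
rewrite /hexp /expabs; have -> : - (2^-1 * `|x|) = `|x| / 2 - 1 * `|x| by field.
by rewrite expRD mulrA ler_wpM2r// expR_ge0.
Qed.

Lemma rint_hexp : rint leb hexp.
Proof. by apply: rintZ; apply: rint_expabs. Qed.

Lemma hexp_le x : hexp x <= 16.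
Proof. by rewrite /hexp ler_piMr// expabs_le1. Qed.

Definition tame (A : R -> R) := continuous A /\ forall x, `|A x| <= hexp x.

Definition sqa (x : R) : R := Num.sqrt `|x|.

Lemma continuous_sqa : continuous sqa.
Proof.
by move=> x; apply: continuous_comp; [exact: norm_continuous|exact: sqrt_continuous].
Qed.

Lemma sqa_ge0 x : 0 <= sqa x. Proof. exact: sqrtr_ge0. Qed.

Lemma sqa_sqr x : sqa x ^+ 2 = `|x|. Proof. by rewrite sqr_sqrtr. Qed.

Lemma sqa_le x : sqa x <= 1 + `|x|.
Proof. have := sqa_sqr x; have := sqr_ge0 (sqa x - 2^-1); nra. Qed.

Lemma tame_expabs_mul (s : R -> R) : continuous s ->
  (forall x, `|s x| <= (1 + `|x|) ^+ 2) -> tame (fun x => s x * expabs 1 x).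
Proof.
move=> cs sb; split.
  by move=> x; apply: cvgM; [exact: cs|exact: continuous_expabs].
move=> x; apply: le_trans (sqr_expabs_le x).
by rewrite normrM (ger0_norm (expabs_ge0 _ _)) ler_wpM2r ?expabs_ge0.
Qed.

(** The four conclusions are exactly what [is_fourier_ft] requires. The character carries the free
    frequency [h], and the last factor 2 of the bound is that of [cnorm1_expi]. *)
Lemma tame_prod_nice (A B : R -> R) (z0 : R[i]) (h : R * R) : tame A -> tame B ->
  let X w := z0 * (A w.1 * B w.2)%:C * expi (- dot h w) in
  (forall w, z0 * (A (- w.1) * B (- w.2))%:C = (z0 * (A w.1 * B w.2)%:C)^*%C) ->
  [/\ cinteg m2 X, (forall w, cnorm1 (X w) <= cnorm1 z0 * (16 * 16) * 2),
      ray_continuous X & (forall w, X (- w.1, - w.2) = (X w)^*%C)].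
Proof.
move=> [cA bA] [cB bB] X hX.
have iA : rint leb A.
  by apply: (rint_le _ rint_hexp) => //; apply: continuous_measurable_fun.
have iB : rint leb B.
  by apply: (rint_le _ rint_hexp) => //; apply: continuous_measurable_fun.
have b16 (s : R -> R) x : (forall x, `|s x| <= hexp x) -> `|s x| <= 16.
  by move=> h1; exact: le_trans (h1 x) (hexp_le x).
split.
- apply: cinteg_ft; apply: cintegZ; apply: cinteg_real.
  exact: (rint_prod iA iB).
- move=> w; apply: le_trans (cnorm1M _ _) _; apply: ler_pM; rewrite ?cnorm1_ge0//.
    apply: le_trans (cnorm1M _ _) _; rewrite cnorm1_real ler_wpM2l ?cnorm1_ge0//.
    by rewrite normrM ler_pM// b16.
  exact: cnorm1_expi.
- move=> w v.
  have c1 (x y : R) : x + k.+1%:R^-1 * y @[k --> \oo] --> x.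
    rewrite -[X in _ --> X]addr0 -[X in _ --> x + X](mul0r y).
    apply: cvgD; first exact: cvg_cst.
    by apply: cvgM; [exact: (@cvg_harmonic R)|exact: cvg_cst].
  have cAB : A (aff2 n.+1%:R^-1 w v).1 * B (aff2 n.+1%:R^-1 w v).2 @[n --> \oo]
      --> A w.1 * B w.2.
    by apply: cvgM; (apply: continuous_cvg; [|exact: c1]); [exact: cA|exact: cB].
  have cd : - dot h (aff2 n.+1%:R^-1 w v) @[n --> \oo] --> - dot h w.
    apply: cvgN; apply: cvgD; (apply: cvgM; [exact: cvg_cst|exact: c1]).
  have cc : cos (- dot h (aff2 n.+1%:R^-1 w v)) @[n --> \oo] --> cos (- dot h w).
    by apply: continuous_cvg; [exact: continuous_cos|exact: cd].
  have cs : sin (- dot h (aff2 n.+1%:R^-1 w v)) @[n --> \oo] --> sin (- dot h w).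
    by apply: continuous_cvg; [exact: continuous_sin|exact: cd].
  have XRe w' : complex.Re (X w') = A w'.1 * B w'.2 *
      (complex.Re z0 * cos (- dot h w') - complex.Im z0 * sin (- dot h w')).
    by rewrite /X !(cReM, cImM) /=; ring.
  have XIm w' : complex.Im (X w') = A w'.1 * B w'.2 *
      (complex.Re z0 * sin (- dot h w') + complex.Im z0 * cos (- dot h w')).
    by rewrite /X !(cReM, cImM) /=; ring.
  split.
  + under eq_fun do rewrite XRe; rewrite XRe.
    apply: cvgM => //; apply: cvgB; apply: cvgM => //; exact: cvg_cst.
  + under eq_fun do rewrite XIm; rewrite XIm.
    apply: cvgM => //; apply: cvgD; apply: cvgM => //; exact: cvg_cst.
- move=> w; rewrite /X /= cconjM -hX -expiN; congr (_ * expi _).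
  by rewrite /dot /=; ring.
Qed.

End test_functions.

(** * Taylor bounds for f and its vanishing at the origin *)

Section taylor_bounds.
Context {R : realType}.
Implicit Types (f : R -> R).

Lemma lipschitz_of_derive f (S u : R) :
  (forall x : R, derivable f x 1) -> (forall x, `|x| <= `|u| -> `|derive1 f x| <= S) ->
  `|f u - f 0| <= S * `|u|.
Proof.
move=> df bf.
have isd (x : R) : is_derive x 1 f (derive1 f x) by rewrite derive1E; exact: derivableP.
have cf a b : {within `[a, b], continuous f}.
  apply: continuous_subspaceT => x; apply: differentiable_continuous.
  exact/derivable1_diffP.
have [->|u0] := eqVneq u 0; first by rewrite subrr !normr0 mulr0.
have [up|un] := ltP 0 u.
- have [c] := MVT up (fun x _ => isd x) (@cf 0 u).
  rewrite in_itv/= => /andP[c0 cu]; rewrite subr0 => ->.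
  rewrite normrM ler_wpM2r//; apply: bf; rewrite !gtr0_norm//; exact: ltW.
- have {}un : u < 0 by rewrite lt_neqAle u0.
  have [c] := MVT un (fun x _ => isd x) (@cf u 0).
  rewrite in_itv/= => /andP[uc c0]; rewrite sub0r => E.
  rewrite -normrN opprB E normrM normrN ler_wpM2r//; apply: bf.
  by rewrite !ltr0_norm// lerN2; exact: ltW.
Qed.

(** The Lipschitz bound is used twice: on the derivative, and then on f minus its linear part, whose
    derivative is therefore at most S |u| between 0 and u. *)
Lemma taylor1_of_derive f (S u : R) : 0 <= S ->
  (forall x : R, derivable f x 1) -> (forall x : R, derivable (derive1 f) x 1) ->
  (forall x, `|x| <= `|u| -> `|derive1 (derive1 f) x| <= S) ->
  `|f u - f 0 - derive1 f 0 * u| <= S * u ^+ 2.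
Proof.
move=> S0 df ddf bf.
pose h x := f x - derive1 f 0 * x.
have isd (x : R) : is_derive x 1 h (derive1 f x - derive1 f 0).
  apply: is_derive_sub; last exact: is_derive_linear.
  by rewrite derive1E; exact: derivableP.
have dh (x : R) : derivable h x 1 by case: (isd x).
have -> : f u - f 0 - derive1 f 0 * u = h u - h 0.
  by rewrite /h mulr0 subr0; ring.
have -> : u ^+ 2 = `|u| * `|u| by rewrite -expr2 real_normK ?num_real.
rewrite mulrA; apply: lipschitz_of_derive => // x xu.
rewrite derive1E; case: (isd x) => _ ->.
apply: le_trans (@lipschitz_of_derive _ S x ddf _) _; last by rewrite ler_wpM2l.
by move=> y yx; apply: bf; exact: le_trans yx xu.
Qed.

Lemma derive1n_continuous f n : smooth f -> continuous (derive1n n f).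
Proof.
move=> sf x; apply: differentiable_continuous; apply/derivable1_diffP; exact: sf.
Qed.

(** With p - 1 > 0 the growth bound gives f(0) = 0. Taylor's bound then yields |f'(0)| u <= S u^2 +
    C u^(p - 1) for small u > 0; dividing by u and using p - 2 > 0, the right side is arbitrarily
    small. *)
Lemma zero_of_growth f (C p S : R) : 2 < p -> smooth f -> 0 < C -> 0 <= S ->
  (forall u, `|f u| <= C * `|u| `^ (p - 1)) ->
  (forall x, `|x| <= 1 -> `|derive1 (derive1 f) x| <= S) ->
  f 0 = 0 /\ derive1 f 0 = 0.
Proof.
move=> p2 sf C0 S0 fg fS.
have f0 : f 0 = 0.
  apply/normr0_eq0/le_anti; rewrite normr_ge0 andbT; apply: le_trans (fg 0) _.
  rewrite normr0 powR0 ?mulr0// gt_eqF// subr_gt0; lra.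
split => //.
have q0 : 0 < p - 2 by rewrite subr_gt0.
have key e : 0 < e -> e <= 1 -> `|derive1 f 0| <= (S + C) * e.
  (* [v] solves v^(p - 2) = e, so the smaller of [e] and [v] makes both u and u^(p - 2) at most
     [e]. *)
  move=> e0 e1; pose v := e `^ (p - 2)^-1.
  have v0 : 0 < v by exact: powR_gt0.
  pose u := Num.min e v.
  have u0 : 0 < u by rewrite /u lt_min e0.
  have ue : u <= e by rewrite /u ge_min lexx.
  have uv : u <= v by rewrite /u ge_min lexx orbT.
  have uq : u `^ (p - 2) <= e.
    apply: (@le_trans _ _ (v `^ (p - 2))).
      by apply: ge0_ler_powR => //; rewrite ?nnegrE ltW.
    by rewrite /v -powRrM mulVf ?gt_eqF// powRr1// ltW.
  have := @taylor1_of_derive f S u S0 (fun x => sf 0 x) (fun x => sf 1 x) _.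
  rewrite f0 subr0 => h.
  have {}h : `|f u - derive1 f 0 * u| <= S * u ^+ 2.
    apply: h => x; rewrite (gtr0_norm u0) => xu; apply: fS.
    exact: le_trans xu (le_trans ue e1).
  have h2 := fg u; rewrite (gtr0_norm u0) in h2.
  have E : u `^ (p - 1) = u * u `^ (p - 2).
    rewrite -[X in X * _]powRr1 ?ltW// -powRD; last by rewrite (gt_eqF u0) implybT.
    by congr (_ `^ _); ring.
  rewrite E in h2.
  have h3 : `|derive1 f 0 * u| <= S * u ^+ 2 + C * (u * u `^ (p - 2)).
    have -> : derive1 f 0 * u = f u - (f u - derive1 f 0 * u) by ring.
    apply: le_trans (ler_normB _ _) _; lra.
  have : `|derive1 f 0| * u <= (S * u + C * u `^ (p - 2)) * u.
    by move: h3; rewrite normrM (gtr0_norm u0); lra.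
  rewrite ler_pM2r// => /le_trans; apply.
  by rewrite mulrDl lerD// ler_wpM2l// ltW.
apply/normr0_eq0/le_anti; rewrite normr_ge0 andbT leNgt; apply/negP => D0.
set D := `|_| in D0 key.
have k0 : 0 < 2 * (S + C + 1) by lra.
(* With this choice (S + C) e is at most D / 2, against [key]. *)
pose e := Num.min 1 (D / (2 * (S + C + 1))).
have e0 : 0 < e by rewrite /e lt_min ltr01 divr_gt0.
have e1 : e <= 1 by rewrite /e ge_min lexx.
have e2 : e * (2 * (S + C + 1)) <= D by rewrite -ler_pdivlMr// /e ge_min lexx orbT.
have := key e e0 e1; nra.
Qed.

End taylor_bounds.

(** * From the weak formulation to an identity between transforms *)

Section weak_form_on_the_fourier_side.
Context {R : realType}.
Notation m2 := (lebesgue2 R).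

(** The inverse of 1 + |xi| + eta^2 / |xi| with numerator and denominator multiplied by |xi|:
    defined everywhere, with value 0 on the axis xi = 0. *)
Definition qinv (w : R * R) : R := `|w.1| / (`|w.1| + w.1 ^+ 2 + w.2 ^+ 2).

(** Factors of the test functions. The power |x| in [A1] absorbs the singular multiplier |x|^(-1/2),
    leaving |x|^(1/2) in [Ah]; multiplying by |x|^(1/2) instead gives [A3]. [B1] carries the factor
    eta of the derivative in y. *)
Let A1 (x : R) : R := `|x| * expabs 1 x.
Let A3 (x : R) : R := (sqa x * `|x|) * expabs 1 x.
Let Ah (x : R) : R := sqa x * expabs 1 x.
Let B0 (x : R) : R := 1 * expabs 1 x.
Let B1 (x : R) : R := x * expabs 1 x.

Let tA1 : tame A1.
Proof.
apply: tame_expabs_mul; first exact: norm_continuous.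
by move=> x; rewrite normr_id; have := normr_ge0 x; nra.
Qed.

Let tA3 : tame A3.
Proof.
apply: tame_expabs_mul.
  by move=> x; apply: cvgM; [exact: continuous_sqa|exact: norm_continuous].
move=> x; rewrite normrM normr_id ger0_norm ?sqa_ge0//.
by have := sqa_le x; have := sqa_ge0 x; have := normr_ge0 x; nra.
Qed.

Let tAh : tame Ah.
Proof.
apply: tame_expabs_mul; first exact: continuous_sqa.
move=> x; rewrite ger0_norm ?sqa_ge0//.
by have := sqa_le x; have := normr_ge0 x; nra.
Qed.

Let tB0 : tame B0.
Proof.
apply: tame_expabs_mul; first by move=> x; exact: cvg_cst.
by move=> x; rewrite normr1; have := normr_ge0 x; nra.
Qed.

Let tB1 : tame B1.
Proof.
apply: tame_expabs_mul; first by move=> x; exact: cvg_id.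
by move=> x; have := normr_ge0 x; nra.
Qed.

(* For each h, the transform of a test function chi is X0 h conjugated, up to a
   constant; X1 h and X2 h play the same role for D_x^{1/2} chi and
   D_x^{-1/2} chi_y. *)
Definition X0 h (w : R * R) : R[i] := 1 * (A1 w.1 * B0 w.2)%:C * expi (- dot h w).
Definition X1 h (w : R * R) : R[i] := 1 * (A3 w.1 * B0 w.2)%:C * expi (- dot h w).
Definition X2 h (w : R * R) : R[i] :=
  (- 'i%C) * (Ah w.1 * B1 w.2)%:C * expi (- dot h w).

Lemma X0_nice h : exists M, [/\ cinteg m2 (X0 h), (forall w, cnorm1 (X0 h w) <= M),
  ray_continuous (X0 h) & (forall w, X0 h (- w.1, - w.2) = (X0 h w)^*%C)].
Proof.
eexists; apply: (tame_prod_nice (z0 := 1) h tA1 tB0) => w.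
by rewrite !mul1r conjc_real /A1 /B0 /expabs !normrN.
Qed.

Lemma X1_nice h : exists M, [/\ cinteg m2 (X1 h), (forall w, cnorm1 (X1 h w) <= M),
  ray_continuous (X1 h) & (forall w, X1 h (- w.1, - w.2) = (X1 h w)^*%C)].
Proof.
eexists; apply: (tame_prod_nice (z0 := 1) h tA3 tB0) => w.
by rewrite !mul1r conjc_real /A3 /B0 /expabs /sqa !normrN.
Qed.

Lemma X2_nice h : exists M, [/\ cinteg m2 (X2 h), (forall w, cnorm1 (X2 h w) <= M),
  ray_continuous (X2 h) & (forall w, X2 h (- w.1, - w.2) = (X2 h w)^*%C)].
Proof.
eexists; apply: (tame_prod_nice (z0 := - 'i%C) h tAh tB1) => w.
rewrite cconjM conjc_real /Ah /B1 /expabs /sqa !normrN.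
by apply: complex_ext; rewrite !(cReM, cImM) /=; ring.
Qed.

Lemma X1E h w : X1 h w = (`|w.1| `^ (2^-1))%:C * X0 h w.
Proof.
rewrite /X1 /X0 powR12_sqrt// -/(sqa w.1) !mul1r mulrA -rmorphM.
by congr (_%:C * _); rewrite /A3 /A1; ring.
Qed.

(** The sign of i is opposite to that of the multiplier because the transform of the test function
    involves the conjugate. On the axis w.1 = 0 both sides vanish. *)
Lemma X2E h w : X2 h w = - 'i%C * (w.2 * `|w.1| `^ (- 2^-1))%:C * X0 h w.
Proof.
have E : `|w.1| `^ (- 2^-1) * `|w.1| = sqa w.1.
  rewrite powRN powR12_sqrt// -/(sqa w.1).
  have [->|s0] := eqVneq (sqa w.1) 0; first by rewrite invr0 mul0r.
  by rewrite -(sqa_sqr w.1) expr2 mulKf.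
rewrite /X2 /X0 mul1r -!mulrA; congr (_ * _); rewrite !mulrA -rmorphM.
by congr (_%:C * _); rewrite /Ah /A1 /B1 /B0 -E; ring.
Qed.

(** Lets the test factor be cancelled from the final identity, off a null line. *)
Lemma X0_neq0 h w : w.1 != 0 -> X0 h w != 0.
Proof.
move=> w0; apply/eqP => /(congr1 (@csq R)); rewrite !csqM csq_expi mulr1 csq_real.
rewrite /csq /= !expr0n /= !addr0 expr1n mul1r => /eqP.
rewrite sqrf_eq0 /A1 /B0 mul1r !mulf_eq0 normr_eq0 (negbTE w0) /=.
by rewrite !gt_eqF// expR_gt0.
Qed.

Lemma ae_neq0_1 : {ae m2, forall w, w.1 != 0}.
Proof.
have m0 : measurable ([set 0] `*` [set: R] : set (R * R)) by exact: measurableX.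
exists ([set 0] `*` [set: R]); split => //.
  rewrite [LHS](product_measure1E _ _ _ _)//= lebesgue_measure_set1.
  by rewrite mul0e.
by move=> w /= /negP; rewrite negbK => /eqP.
Qed.

(** The two half-order multipliers act twice, once on the solution and once on the test function;
    their products are |xi| and eta^2 / |xi|, the signs of i compensating. *)
Lemma qinv_eq (w : R * R) (U V : R[i]) : w.1 != 0 ->
  U + (`|w.1| `^ (2^-1))%:C * ((`|w.1| `^ (2^-1))%:C * U) +
  - 'i%C * (w.2 * `|w.1| `^ (- 2^-1))%:C *
    ('i%C * (w.2 * `|w.1| `^ (- 2^-1))%:C * U) = V -> U = (qinv w)%:C * V.
Proof.
move=> w0 <-; rewrite powRN powR12_sqrt// -/(sqa w.1).
have a0 : `|w.1| != 0 by rewrite normr_eq0.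
have s0 : sqa w.1 != 0 by rewrite -sqrf_eq0 sqa_sqr.
have E : - 'i%C * (w.2 * (sqa w.1)^-1)%:C * ('i%C * (w.2 * (sqa w.1)^-1)%:C * U) =
    (w.2 ^+ 2 / `|w.1|)%:C * U.
  have -> : w.2 ^+ 2 / `|w.1| = (w.2 / sqa w.1) * (w.2 / sqa w.1).
    by rewrite -sqa_sqr; field.
  by apply: complex_ext; rewrite !(cReM, cImM, cReN, cImN) /=; ring.
rewrite E mulrA -rmorphM -expr2 sqa_sqr -[X in X + _ + _]mul1r -!mulrDl -!rmorphD.
rewrite mulrA -rmorphM /qinv [X in X%:C * _](_ : _ = 1) ?mul1r//.
have h : w.1 ^+ 2 = `|w.1| ^+ 2 by rewrite real_normK ?num_real.
rewrite h; have d0 : `|w.1| + `|w.1| ^+ 2 + w.2 ^+ 2 != 0.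
  by rewrite gt_eqF// !ltr_wpDr ?sqr_ge0// lt_def a0 normr_ge0.
by field; rewrite d0 a0.
Qed.

(** The weak form is tested with the transforms of [X0 h] for every [h]. Moved to the Fourier side
    by the multiplication formulas, each instance says that the transform at [h] of one fixed
    function [D] vanishes. Injectivity gives D = 0, and [X0] is divided out. *)
Lemma weak_solution_fourier (f : R -> R) (phi g : R * R -> R) (U : R * R -> R[i]) :
  in_Z phi -> weak_solution f phi -> is_fourier phi U ->
  continuous f -> {ae m2, forall z, f (phi z) = f (g z)} ->
  rint m2 (fun z => f (g z)) ->
  {ae m2, forall w, U w = (qinv w)%:C * ft (fun z => (f (g z))%:C) w}.
Proof.
move=> [lphi [phi1 h1] [phi2 h2]] wsol fU cf fg ifg.
have mphi : measurable_fun setT phi by case/L2P : lphi.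
have [U1 [V1 [fU1 fV1 E1]]] := h1.
have [U2 [V2 [fU2 fV2 E2]]] := h2.
have e1 := is_fourier_unique fU1 fU; have e2 := is_fourier_unique fU2 fU.
have [l1 lV1 _] := fV1; have [l2 lV2 _] := fV2; have [_ lU _] := fU.
set V0 := ft _.
have icf := cinteg_real ifg.
have mV0 : cmfun V0 by exact: ft_meas.
have V0B w : cnorm1 (V0 w) <= _ := ft_bound w icf.
pose D w := (U w * X0 (0, 0) w + V1 w * X1 (0, 0) w + V2 w * X2 (0, 0) w) -
  V0 w * X0 (0, 0) w.
have L2X X M : cinteg m2 X -> (forall w, cnorm1 (X w) <= M) -> L2C X.
  by move=> iX XM; exact: L2C_of_cinteg iX XM.
have parts h : [/\ cinteg m2 (fun w => U w * X0 h w), cinteg m2 (fun w => V1 w * X1 h w),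
    cinteg m2 (fun w => V2 w * X2 h w) & cinteg m2 (fun w => V0 w * X0 h w)].
  have [M0 [i0 b0 _ _]] := X0_nice h; have [M1 [i1 b1 _ _]] := X1_nice h.
  have [M2 [i2 b2 _ _]] := X2_nice h.
  split; try by apply: cinteg_L2M => //; exact: L2X.
  exact: cinteg_bndM mV0 V0B i0.
have iD : cinteg m2 D.
  by have [? ? ? ?] := parts (0, 0); apply: cintegB => //; apply: cintegD => //; exact: cintegD.
(* The test factors depend on [h] through a character only; this is what makes the family of tested
   identities a single Fourier transform. *)
have Xexp h w : [/\ X0 h w = X0 (0, 0) w * expi (- dot h w),
    X1 h w = X1 (0, 0) w * expi (- dot h w) & X2 h w = X2 (0, 0) w * expi (- dot h w)].
  have e0 : expi (- dot (0, 0) w) = 1 :> R[i].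
    by rewrite /dot /= !mul0r addr0 oppr0 expi0.
  by rewrite /X0 /X1 /X2 e0 !mulr1.
have sum3 (a b c d : R) : a + b + c = d -> a%:C + b%:C + c%:C - d%:C = 0 :> R[i].
  by move=> <-; apply: complex_ext => /=; ring.
have D0 h : ft D h = 0.
  have [M0 [i0 b0 c0 s0]] := X0_nice h; have [M1 [i1 b1 c1 s1]] := X1_nice h.
  have [M2 [i2 b2 c2 s2]] := X2_nice h.
  have F0 := is_fourier_ft i0 b0 c0 s0; have F1 := is_fourier_ft i1 b1 c1 s1.
  have F2 := is_fourier_ft i2 b2 c2 s2.
  set chi := (fun z => complex.Re (ft (X0 h) z)) in F0.
  set chi1 := (fun z => complex.Re (ft (X1 h) z)) in F1.
  set chi2 := (fun z => complex.Re (ft (X2 h) z)) in F2.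
  have D1 : is_Dx_half chi chi1.
    eexists; eexists; split; [exact: F0|exact: F1|].
    apply: nearW => w; rewrite X1E cconjM conjc_real; ring.
  have D2 : is_Dx_mhalf_dy chi chi2.
    eexists; eexists; split; [exact: F0|exact: F2|].
    apply: nearW => w; rewrite X2E !cconjM conjc_real.
    have -> : (- 'i%C)^*%C = 'i%C :> R[i] by apply: complex_ext => /=; ring.
    ring.
  have lchi : L2 chi by case: F0.
  have chiZ : in_Z chi by split => //; [exists chi1|exists chi2].
  have wk := wsol phi1 phi2 chi chi1 chi2 h1 h2 chiZ D1 D2.
  have prod u X Mb : L2 u -> cinteg m2 X -> (forall w, cnorm1 (X w) <= Mb) ->
      (forall w, X (- w.1, - w.2) = (X w)^*%C) ->
      rint m2 (fun z => u z * complex.Re (ft X z)) /\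
      cint m2 (fun z => (u z)%:C * ft X z) =
      (\int[m2]_z (u z * complex.Re (ft X z)))%:C.
    move=> lu iX bX sX.
    have E : (fun z => (u z)%:C * ft X z) = (fun z => (u z * complex.Re (ft X z))%:C).
      by apply/funext => z; rewrite rmorphM /= -(ft_real z iX sX).
    split; last by rewrite E cint_real.
    have := cinteg_L2M (L2C_real lu) (L2C_ft iX (L2X _ _ iX bX)).
    by rewrite E => -[].
  have [r0 p0] := prod phi _ _ lphi i0 b0 s0.
  have [r1 p1] := prod phi1 _ _ l1 i1 b1 s1.
  have [r2 p2] := prod phi2 _ _ l2 i2 b2 s2.
  have mchi : measurable_fun setT chi by case/L2P : lchi.
  have rg : rint m2 (fun z => f (g z) * chi z).
    have := cinteg_bndM (ft_meas i0) (fun z => ft_bound z i0) icf.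
    have -> : (fun z => ft (X0 h) z * (f (g z))%:C) = (fun z => (f (g z) * chi z)%:C).
      by apply/funext => z; rewrite (ft_real _ i0 s0) rmorphM mulrC.
    by case.
  have mfphi : measurable_fun setT (fun z => f (phi z)).
    by apply: measurableT_comp mphi; exact: continuous_measurable_fun.
  have aef : {ae m2, forall z, f (g z) * chi z = f (phi z) * chi z}.
    by apply: (ae_imp fg) => z ->.
  have rp : rint m2 (fun z => f (phi z) * chi z).
    by apply: (rint_ae aef _ rg); exact: measurable_funM.
  have wk' : \int[m2]_z (phi z * chi z) + \int[m2]_z (phi1 z * chi1 z) +
      \int[m2]_z (phi2 z * chi2 z) = \int[m2]_z (f (g z) * chi z).
    rewrite -(RintegralD measurableT r0 r1) -(RintegralD measurableT (rintD r0 r1) r2).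
    rewrite (rint_ae_eq aef); [|exact: rint_meas rg|exact: rint_meas rp].
    exact: (congr1 fine wk).
  have [j0 j1 j2 j3] := parts h.
  have -> : ft D h = cint m2 (fun w => U w * X0 h w + V1 w * X1 h w + V2 w * X2 h w -
      V0 w * X0 h w).
    congr cint; apply/funext => w; have [-> -> ->] := Xexp h w; rewrite /D; ring.
  rewrite cintB//; last by apply: cintegD => //; exact: cintegD.
  rewrite cintD//; last exact: cintegD.
  rewrite cintD// -(fourier_multiplication fU i0 (L2X _ _ i0 b0)).
  rewrite -(fourier_multiplication fV1 i1 (L2X _ _ i1 b1)).
  rewrite -(fourier_multiplication fV2 i2 (L2X _ _ i2 b2)).
  rewrite -(L1_multiplication icf i0) p0 p1 p2.
  have -> : (fun z => (f (g z))%:C * ft (X0 h) z) = (fun z => (f (g z) * chi z)%:C).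
    by apply/funext => z; rewrite (ft_real _ i0 s0) rmorphM.
  by rewrite cint_real; exact: sum3 wk'.
have h3 := ae_and (ft_eq0_ae iD D0) ae_neq0_1.
have h4 := ae_and (ae_and e1 e2) (ae_and E1 E2).
apply: (ae_imp2 h3 h4) => w [Dw w0] [[u1 u2] [v1 v2]].
apply: qinv_eq => //; move: Dw; rewrite /D v1 v2 u1 u2 X1E X2E => /eqP.
rewrite subr_eq0 => /eqP hD; apply: (mulIf (X0_neq0 (0, 0) w0)); rewrite -hD.
ring.
Qed.

End weak_form_on_the_fourier_side.

(** * The nonlinear terms on the Fourier side *)

Section directional_derivatives.
Context {R : realType}.
Notation leb := (@lebesgue_measure R).
Notation m2 := (lebesgue2 R).
Implicit Types (U X : R * R -> R[i]) (z w : R * R).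

(** The boolean selects the direction, so that both coordinates go through the same lemmas. *)
Definition coord (b : bool) w : R := if b then w.1 else w.2.

Definition evec (b : bool) (t : R) : R * R := if b then (t, 0) else (0, t).

Definition shift (b : bool) (t : R) z : R * R := aff2 1 (evec b t) z.

Lemma dot_shift b t z w : dot (shift b t z) w = dot z w + t * coord b w.
Proof. by rewrite /dot /shift /aff2 /evec /coord; case: b => /=; ring. Qed.

Lemma dot_shiftr b t z w : dot w (shift b t z) = dot w z + t * coord b w.
Proof. by rewrite /dot /shift /aff2 /evec /coord; case: b => /=; ring. Qed.

Lemma measurable_shift12 b :
  measurable_fun setT (fun p : R * (R * R) => shift b p.1 p.2).
Proof.
apply: (@measurable_aff2_fun R _ (R * (R * R))%type 1 (fun p => evec b p.1) snd).
  have m1 : measurable_fun setT (fun p : R * (R * R) => p.1) := measurable_fst.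
  rewrite /evec; case: b; apply/measurable_fun_pairP.
    by split; [exact: m1|exact: measurable_cst].
  by split; [exact: measurable_cst|exact: m1].
exact: measurable_snd.
Qed.

Lemma shift0 b z : shift b 0 z = z.
Proof. by rewrite /shift /aff2 /evec; case: b => /=; rewrite !mul1r !add0r -surjective_pairing. Qed.

Lemma measurable_coord b : measurable_fun setT (coord b).
Proof. by case: b; [exact: measurable_fst|exact: measurable_snd]. Qed.

Lemma coord_opp b w : coord b (- w.1, - w.2) = - coord b w.
Proof. by case: b. Qed.

Lemma Re_ift_shift U b t z : complex.Re (ift U (shift b t z)) =
  \int[m2]_w (complex.Re (U w) * cos (dot z w + t * coord b w) -
              complex.Im (U w) * sin (dot z w + t * coord b w)).
Proof. by apply: eq_Rintegral => w _; rewrite cReM dot_shift. Qed.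

(** Differentiation under the integral; the derivative of the integrand is dominated by 2 |w_b U(w)|
    uniformly in the parameter, so the window of radius 1 around [t] is arbitrary. *)
Lemma is_derive_ift U b (t : R) z : cinteg m2 U ->
  cinteg m2 (fun w => (coord b w)%:C * U w) ->
  is_derive t 1 (fun s => complex.Re (ift U (shift b s z)))
    (complex.Re (ift (fun w => 'i%C * ((coord b w)%:C * U w)) (shift b t z))).
Proof.
move=> iU iU1.
pose F s w := complex.Re (U w) * cos (dot z w + s * coord b w) -
              complex.Im (U w) * sin (dot z w + s * coord b w).
have -> : (fun s => complex.Re (ift U (shift b s z))) = (fun s => \int[m2]_w F s w).
  by apply/funext => s; rewrite Re_ift_shift.
have dF (s : R) w : is_derive s 1 (F ^~ w)
    (complex.Re (U w) * (- sin (dot z w + s * coord b w) * coord b w) -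
     complex.Im (U w) * (cos (dot z w + s * coord b w) * coord b w)).
  have dl : is_derive s 1 (fun s : R => dot z w + s * coord b w) (coord b w).
    have h := is_derive_add (is_derive_cst (dot z w) s 1)
      (is_derive_mul (is_derive_id s (1 : R)) (is_derive_cst (coord b w) s 1)).
    by apply: is_derive_eq h _; rewrite mulr0 !add0r mulr1.
  have hc := is_derive_comp (g := fun s => dot z w + s * coord b w) (is_derive_cos _) dl.
  have hs := is_derive_comp (g := fun s => dot z w + s * coord b w) (is_derive_sin _) dl.
  exact: (is_derive_sub (is_derive_scale _ hc) (is_derive_scale _ hs)).
have dE s w : partial1of2 F s w =
    complex.Re (('i%C * ((coord b w)%:C * U w)) * expi (dot (shift b s z) w)).
  rewrite partial1of2E; case: (dF s w) => _ ->.
  by rewrite !(cReM, cImM) /= dot_shift; ring.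
have iN := cinteg_cnorm1 iU1.
have Ft : t \in `]t - 1, t + 1[%classic by rewrite inE/= in_itv/=; apply/andP; split; lra.
move: Ft; rewrite inE => Ft.
have iF s : rint m2 (F s).
  have -> : F s = fun w => complex.Re (U w * expi (dot (shift b s z) w)).
    by apply/funext => w; rewrite cReM dot_shift.
  by case: (cinteg_ift (shift b s z) iU).
have G0 w : 0 <= 2 * cnorm1 ((coord b w)%:C * U w) by rewrite mulr_ge0 ?cnorm1_ge0.
have iG := rintZ 2 iN.
have Gub s w : `|partial1of2 F s w| <= 2 * cnorm1 ((coord b w)%:C * U w).
  rewrite dE; apply: le_trans (Re_le_cnorm1 _) _; apply: le_trans (cnorm1M _ _) _.
  by rewrite cnorm1_iM mulrC ler_wpM2r ?cnorm1_ge0// cnorm1_expi.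
have h1 := @derivable_under_integral R _ _ m2 F setT measurableT t (t - 1) (t + 1) Ft
  (fun s _ => iF s) (fun s w _ _ => @ex_derive _ _ _ _ _ _ _ (dF s w)) _ G0 iG
  (fun s w _ _ => Gub s w).
have h2 := @differentiation_under_integral R _ _ m2 F setT measurableT t (t - 1) (t + 1) Ft
  (fun s _ => iF s) (fun s w _ _ => @ex_derive _ _ _ _ _ _ _ (dF s w)) _ G0 iG
  (fun s w _ _ => Gub s w).
apply: DeriveDef; first exact: h1.
rewrite -derive1E h2; apply: eq_Rintegral => w _; exact: dE.
Qed.

(** The interval is encoded by an indicator over the whole line, to fit Fubini on R x R^2. *)
Lemma ftc_indic (F F' : R -> R) (t : R) : 0 < t ->
  (forall s : R, is_derive s 1 F (F' s)) -> continuous F' ->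
  rint leb (fun s => F' s * \1_`[0, t] s) /\
  \int[leb]_s (F' s * \1_`[0, t] s) = F t - F 0.
Proof.
move=> t0 dF cF; have c : {within `[0, t], continuous F'} by exact: continuous_subspaceT.
split.
  have i := @continuous_compact_integrable R F' _ (@segment_compact _ 0 t) c.
  have mI : measurable (`[0, t]%classic : set (measurableTypeR R)) by [].
  have := (integrable_mkcond _ mI).1 i; congr (integrable _ _ _).
  apply/funext => s; rewrite /= patchE indicE.
  by case: (_ \in _); rewrite ?mulr1 ?mulr0.
rewrite -rintegral_restrict//.
have := @continuous_FTC2 R F' F 0 t t0 _ _ _; rewrite /Rintegral => -> //.
- split; first by move=> x _; case: (dF x).
  + by apply: cvg_at_right_filter; exact: is_derive_continuous (dF 0).
  + by apply: cvg_at_left_filter; exact: is_derive_continuous (dF t).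
- by move=> x _; rewrite derive1E; case: (dF x).
Qed.

(* Compare the transforms of r and of its translate by t in direction b, for a t
   with e^{i t coord b w} = -1. *)
Lemma ft_directional_derivative (r r' : R * R -> R) b : rint m2 r -> rint m2 r' ->
  (forall t z, 0 < t ->
    rint leb (fun s => r' (shift b s z) * \1_`[0, t] s) /\
    r (shift b t z) - r z = \int[leb]_s (r' (shift b s z) * \1_`[0, t] s)) ->
  forall w, ft (fun z => (r' z)%:C) w =
    'i%C * (coord b w)%:C * ft (fun z => (r z)%:C) w.
Proof.
move=> ir ir' rr' w; have n10 : 1 != 0 :> R := oner_neq0 R.
set V := ft (fun z => (r z)%:C) w; set V' := ft _ w.
have ftT (q : R * R -> R) t : rint m2 q ->
    cint m2 (fun z => (q (shift b t z))%:C * expi (- dot w z)) =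
    expi (t * coord b w) * ft (fun z => (q z)%:C) w.
  move=> iq; have iq' := cinteg_ft w (cinteg_real iq).
  rewrite /ft -(cint_aff2 (evec b t) n10 iq') expr1n mul1r -cintZ; last first.
    exact: (cinteg_aff2 (evec b t) n10 iq').
  congr cint; apply/funext => z; rewrite mulrCA -expiD.
  congr (_ * expi _); rewrite -/(shift b t z).
  by rewrite dot_shiftr; ring.
(* The integral of e^{i s w_b} for s in [0, t]: writing the increment of [r] as an integral of
   translates of [r'], and using that translation multiplies the transform by a character, gives
   [key]. *)
pose A t := cint leb (fun s => (\1_`[0, t] s)%:C * expi (s * coord b w)).
have iA t : cinteg leb (fun s => (\1_`[0, t] s)%:C * expi (s * coord b w)).
  apply: cinteg_expi; last exact: measurable_funM.
  apply: cinteg_real; apply: rint_indic => //.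
  by rewrite /= lebesgue_measure_itv/=; case: ifP => _ //; rewrite -EFinD ltry.
have key t : 0 < t -> (expi (t * coord b w) - 1) * V = A t * V'.
  move=> t0.
  have i1 := cinteg_ft w (cinteg_real (rint_aff2 (evec b t) n10 ir)).
  have i2 := cinteg_ft w (cinteg_real ir).
  have E1 : cint m2 (fun z => (r (shift b t z) - r z)%:C * expi (- dot w z)) =
      (expi (t * coord b w) - 1) * V.
    rewrite mulrBl mul1r -ftT// /V /ft -cintB//.
    by congr cint; apply/funext => z; rewrite rmorphB mulrBl.
  rewrite -E1.
  have ms := measurable_shift12 b.
  have iI : rint leb (\1_`[0, t] : R -> R).
    apply: rint_indic => //.
    by rewrite /= lebesgue_measure_itv/=; case: ifP => _ //; rewrite -EFinD ltry.
  have iP : rint (leb \x m2)%E (fun p => \1_`[0, t] p.1 * r' (shift b p.1 p.2)).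
    have mP : measurable_fun setT (fun p : R * (R * R) =>
        \1_`[0, t] p.1 * r' (shift b p.1 p.2)).
      apply: measurable_funM; last exact: measurableT_comp (rint_meas ir') ms.
      apply: measurableT_comp measurable_fst; exact: measurable_indic.
    apply/integrable12ltyP; first exact/measurable_EFinP.
    have mnr : measurable_fun setT (fun y => `|r' y|%:E).
      by apply/measurable_EFinP; exact: measurableT_comp (rint_meas ir').
    apply: (@le_lt_trans _ _ (\int[leb]_s ((\int[m2]_z `|r' z|)%:E *
        `|\1_`[0, t] s|%:E)))%E.
      rewrite le_eqVlt; apply/orP; left; apply/eqP.
      apply: eq_integral => s _ /=; under eq_integral do rewrite normrM EFinM.
      rewrite ge0_integralZl//; last first.
        apply/measurable_EFinP; apply: measurableT_comp => //.
        exact: measurableT_comp (rint_meas ir') (measurable_aff2 _ _).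
      rewrite -(rint_EFin (rint_norm ir')) muleC; congr (_ * _)%E.
      rewrite -(ge0_integral_affine2 (evec b s) n10 mnr (fun=> normr_ge0 _)).
      by rewrite expr1n mul1e.
    rewrite ge0_integralZl//; last 2 first.
    - apply/measurable_EFinP; apply: measurableT_comp => //; exact: measurable_indic.
    - by rewrite lee_fin; exact: Rintegral_ge0.
    by rewrite (rint_EFin (rint_norm iI)) -EFinM ltry.
  have iC : cinteg (leb \x m2)%E (fun p => (\1_`[0, t] p.1 * r' (shift b p.1 p.2))%:C *
      expi (- dot w p.2)).
    apply: cinteg_expi; first exact: cinteg_real iP.
    apply: measurableT_comp => //.
    apply: (@measurable_dot R _ (R * (R * R))%type (cst w) snd) => //.
  have E2 : cint leb (fun s => cint m2 (fun z =>
      (\1_`[0, t] s * r' (shift b s z))%:C * expi (- dot w z))) = A t * V'.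
    rewrite /A -cintZr//; congr cint; apply/funext => s.
    rewrite -mulrA -ftT// -cintZ; last first.
      exact: cinteg_ft w (cinteg_real (rint_aff2 (evec b s) n10 ir')).
    by congr cint; apply/funext => z; rewrite rmorphM mulrA.
  rewrite -E2 (cfubini iC) /=; congr cint; apply/funext => z.
  have [iz ->] := rr' t z t0.
  rewrite -cint_real -cintZr; last exact: cinteg_real iz.
  by congr cint; apply/funext => s; rewrite [\1_ _ s * _]mulrC.
(* When w_b = 0 the character is constantly 1: the left side of [key 1] vanishes while A 1 = 1, so
   the transform of [r'] is 0 there. *)
have [w0|w0] := eqVneq (coord b w) 0.
  have := key 1 ltr01; rewrite w0 mulr0 expi0 subrr mul0r mulr0 mul0r => /esym/eqP.
  rewrite mulf_eq0 => /orP[|/eqP //] /eqP A0.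
  have := congr1 (@complex.Re R) A0; rewrite /A /cint /=.
  under eq_Rintegral do rewrite w0 mulr0 cos0 mul0r subr0 mulr1.
  have -> : \int[leb]_x \1_`[0, 1] x = 1 :> R.
    rewrite /Rintegral integral_indic// setIT.
    by rewrite /= lebesgue_measure_itv /= lte_fin ltr01 -EFinB subr0.
  by move=> /eqP; rewrite oner_eq0.
pose t := pi / `|coord b w|.
have t0 : 0 < t by rewrite divr_gt0 ?pi_gt0// normr_gt0.
have et : expi (t * coord b w) = - 1 :> R[i].
  rewrite /t; have [wp|wn] := ltP 0 (coord b w).
    by rewrite gtr0_norm// divfK ?gt_eqF// /expi cospi sinpi; apply: complex_ext => /=; ring.
  rewrite ler0_norm// invrN mulrN mulNr divfK// /expi cosN sinN cospi sinpi.
  by apply: complex_ext => /=; ring.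
(* Multiplying [key] by i w_b makes the same factor e^{i t w_b} - 1 appear on both sides. For the
   chosen [t] it equals -2 and can be cancelled. *)
have EA : 'i%C * (coord b w)%:C * A t = expi (t * coord b w) - 1.
  have dsin (s : R) : is_derive s 1 (fun s => sin (coord b w * s))
      (cos (coord b w * s) * coord b w).
    exact: (is_derive_comp (g := fun s => coord b w * s) (is_derive_sin _)
      (is_derive_linear _ _)).
  have dcos (s : R) : is_derive s 1 (fun s => cos (coord b w * s))
      (- sin (coord b w * s) * coord b w).
    exact: (is_derive_comp (g := fun s => coord b w * s) (is_derive_cos _)
      (is_derive_linear _ _)).
  have FTC (F F' : R -> R) : (forall s : R, is_derive s 1 F (F' s)) -> continuous F' ->
      \int[leb]_s (F' s * \1_`[0, t] s) = F t - F 0.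
    by move=> dF cF; have [] := ftc_indic t0 dF cF.
  have [rA mA] := iA t.
  have c1 := FTC _ _ dsin _; have c2 := FTC _ _ (fun s => is_derive_scale (-1) (dcos s)) _.
  rewrite mulr0 sin0 subr0 in c1; rewrite mulr0 cos0 in c2.
  have E1 : (fun s => complex.Re ((\1_`[0, t] s)%:C * expi (s * coord b w))) =
      (fun s => \1_`[0, t] s * cos (coord b w * s)).
    by apply/funext => s; rewrite cReM /= mul0r subr0 [s * _]mulrC.
  have E2 : (fun s => complex.Im ((\1_`[0, t] s)%:C * expi (s * coord b w))) =
      (fun s => \1_`[0, t] s * sin (coord b w * s)).
    by apply/funext => s; rewrite cImM /= mul0r addr0 [s * _]mulrC.
  rewrite E1 in rA; rewrite E2 in mA.
  have RA : coord b w * complex.Re (A t) = sin (coord b w * t).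
    rewrite -c1; last first.
      move=> x; apply: cvgM; last exact: cvg_cst.
      exact: is_derive_continuous (dcos x).
    rewrite /A /cint /= E1 -(RintegralZl _ measurableT rA).
    by apply: eq_Rintegral => s _; ring.
  have IA : coord b w * complex.Im (A t) = 1 - cos (coord b w * t).
    transitivity (-1 * cos (coord b w * t) - -1 * 1); last by ring.
    rewrite -c2; last first.
      move=> x; apply: cvgM; first exact: cvg_cst.
      apply: cvgM; last exact: cvg_cst.
      by apply: cvgN; exact: is_derive_continuous (dsin x).
    rewrite /A /cint /= E2 -(RintegralZl _ measurableT mA).
    by apply: eq_Rintegral => s _; ring.
  move: RA IA; case: (A t) => x y /= RA IA.
  by apply: complex_ext; rewrite !(cReM, cImM) /= [t * _]mulrC; lra.
have := key t t0; move/(congr1 (fun x => 'i%C * (coord b w)%:C * x)).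
rewrite [RHS]mulrA EA et.
have h2 : -1 - 1 != 0 :> R[i] by apply/eqP => -[h]; lra.
rewrite mulrCA => /(mulfI h2) <-.
by [].
Qed.

End directional_derivatives.

(** * Taylor remainders of the nonlinearity and their transforms *)

Section nonlinear_terms.
Context {R : realType}.
Notation m2 := (lebesgue2 R).
Implicit Types (b : bool) (k : nat) (z w : R * R).

(** The candidate representative, given by a formula at every point; the real part makes it
    real-valued whatever [U] is. *)
Definition profile (U : R * R -> R[i]) z : R :=
  ((2 * pi) ^+ 2)^-1 * complex.Re (ift U z).

Definition icoord b (U : R * R -> R[i]) w : R[i] := 'i%C * ((coord b w)%:C * U w).

Definition taylor_rem (f : R -> R) k (g : R * R -> R) z : R :=
  derive1n k f (g z) - derive1n k f 0 - derive1n k.+1 f 0 * g z.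

Variables (f : R -> R) (U : R * R -> R[i]) (r : R) (S : nat -> R).
Hypotheses (sf : smooth f) (iU : cinteg m2 U)
  (iU1 : forall b, cinteg m2 (fun w => (coord b w)%:C * U w))
  (iU2 : forall b, cinteg m2 (fun w => (coord b w)%:C * ((coord b w)%:C * U w)))
  (lU1 : forall b, L2C (fun w => (coord b w)%:C * U w))
  (hU : forall w, U (- w.1, - w.2) = (U w)^*%C)
  (fU : is_fourier (profile U) U)
  (gr : forall z, `|profile U z| < r)
  (fS : forall n x, `|x| < r -> `|derive1n n f x| <= S n).

Let g := profile U.
Let g' b := profile (icoord b U).
Let rem k := taylor_rem f k g.
(** The chain-rule derivative of [rem k] in direction [b]. The linear Taylor term differentiates
    into the subtracted constant, so this is O(|g g'|), a product of two square-integrable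
    functions. *)
Let rem' b k z : R := (derive1n k.+1 f (g z) - derive1n k.+1 f 0) * g' b z.

Let S_ge0 n : 0 <= S n.
Proof.
apply: le_trans (fS n (_ : `|0| < r)); first exact: normr_ge0.
by rewrite normr0; apply: le_lt_trans (gr (0, 0)).
Qed.

Let iiU b : cinteg m2 (icoord b U).
Proof. exact: (cintegZ 'i%C (iU1 b)). Qed.

Let liU b : L2C (icoord b U).
Proof.
apply/L2CP; split; first exact: cinteg_meas (iiU b).
have := L2C_rint (lU1 b); congr (rint _ _).
apply/funext => w; rewrite /icoord [RHS]csqM.
by rewrite (_ : csq ('i%C : R[i]) = 1) ?mul1r// /csq /= expr0n expr1n add0r.
Qed.

Let is_derive_g b (t : R) z :
  is_derive t 1 (fun s => g (shift b s z)) (g' b (shift b t z)).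
Proof. by apply: is_derive_scale; exact: (is_derive_ift t z iU (iU1 b)). Qed.

Let continuous_g' b z : continuous (fun s => g' b (shift b s z)).
Proof.
move=> t; have i2 : cinteg m2 (fun w => (coord b w)%:C * icoord b U w).
  have := cintegZ 'i%C (iU2 b); congr (cinteg _ _).
  by apply/funext => w; rewrite /icoord mulrCA.
exact: is_derive_continuous (is_derive_scale _ (is_derive_ift t z (iiU b) i2)).
Qed.

Let lg : L2 g. Proof. by case: fU. Qed.

Let mg : measurable_fun setT g. Proof. by have [] := (L2P g).1 lg. Qed.

Let lg' b : L2 (g' b).
Proof.
have N10 : -1 != 0 :> R by rewrite oppr_eq0 oner_eq0.
have [lR _] := L2C_ft (iiU b) (liU b); apply/L2P.
have [mR iR] := (L2P _).1 lR.
have E : g' b = (fun z => ((2 * pi) ^+ 2)^-1 *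
    complex.Re (ft (icoord b U) (aff2 (-1) (0, 0) z))).
  apply/funext => z; rewrite /g' /profile ift_ft; congr (_ * complex.Re (ft _ _)).
  by rewrite /aff2 /= !add0r !mulN1r.
rewrite E; split.
  apply: measurable_funM => //; exact: measurableT_comp mR (measurable_aff2 _ _).
under eq_fun do rewrite exprMn; exact: rintZ (rint_aff2 (0, 0) N10 iR).
Qed.

Let mg' b : measurable_fun setT (g' b). Proof. by have [] := (L2P _).1 (lg' b). Qed.

Let m_derive1n k : measurable_fun setT (fun z => derive1n k f (g z)).
Proof.
apply: measurableT_comp mg; apply: continuous_measurable_fun.
exact: derive1n_continuous.
Qed.

Lemma taylor_rem_bound k z : `|taylor_rem f k g z| <= S k.+2 * g z ^+ 2.
Proof.
apply: (@taylor1_of_derive _ (derive1n k f) (S k.+2) (g z) (S_ge0 _) (@sf k) (@sf k.+1)).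
by move=> x xg; apply: (fS k.+2); exact: le_lt_trans xg (gr z).
Qed.

Lemma rint_taylor_rem k : rint m2 (taylor_rem f k g).
Proof.
have [_ ig] := (L2P _).1 lg.
apply: (rint_le _ (rintZ (S k.+2) ig)).
  apply: measurable_funB; first by apply: measurable_funB => //; exact: m_derive1n.
  by apply: measurable_funM.
by move=> z; exact: taylor_rem_bound.
Qed.

(** Completing to the next remainder closes the recursion: [rem k.+1] is integrable, and what is
    left is a multiple of [g]. *)
Let rem'E b k z : rem' b k z = (rem k.+1 z + derive1n k.+2 f 0 * g z) * g' b z.
Proof. by rewrite /rem' /rem /taylor_rem subrK. Qed.

Let rint_rem' b k : rint m2 (rem' b k).
Proof.
have [_ ig] := (L2P _).1 lg; have [_ ig'] := (L2P _).1 (lg' b).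
have h : rint m2 (fun z => g z * g' b z).
  apply: (rint_sqr_mul _ _ ig ig'); [exact: mg|exact: mg'].
apply: (rint_le _ (rintZ (S k.+2) (rint_norm h))); first apply: measurable_funM; [|exact: mg'|].
  by apply: measurable_funB => //; exact: m_derive1n.
move=> z; rewrite /rem' !(normrM _ (g' b z)) mulrA ler_wpM2r//.
apply: (@lipschitz_of_derive _ (derive1n k.+1 f) _ (g z) (@sf k.+1)).
by move=> x xg; apply: (fS k.+2); exact: le_lt_trans xg (gr z).
Qed.

Let is_derive_rem b k (t : R) z :
  is_derive t 1 (fun s => rem k (shift b s z)) (rem' b k (shift b t z)).
Proof.
have dk (x : R) : is_derive x 1 (derive1n k f) (derive1n k.+1 f x).
  by rewrite -[derive1n k.+1 f]/(derive1 _) derive1E; apply: derivableP; exact: sf.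
have h1 := is_derive_comp (g := fun s => g (shift b s z)) (dk (g (shift b t z)))
  (is_derive_g b t z).
have h2 := is_derive_scale (derive1n k.+1 f 0) (is_derive_g b t z).
have := is_derive_sub (is_derive_sub h1 (is_derive_cst (derive1n k f 0) t 1)) h2.
by move=> h; apply: is_derive_eq h _; rewrite /rem'; ring.
Qed.

Let ft_rem' b k w : ft (fun z => (rem' b k z)%:C) w =
  'i%C * (coord b w)%:C * ft (fun z => (rem k z)%:C) w.
Proof.
apply: ft_directional_derivative; [exact: rint_taylor_rem|exact: rint_rem'|].
move=> t z t0; have c' : continuous (fun s => rem' b k (shift b s z)).
  move=> s; apply: cvgM; last exact: continuous_g'.
  apply: cvgB; last exact: cvg_cst.
  apply: continuous_cvg; first exact: derive1n_continuous.
  exact: is_derive_continuous (is_derive_g b s z).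
have d' (s : R) : is_derive s 1 (fun s => rem k (shift b s z)) (rem' b k (shift b s z)).
  exact: is_derive_rem.
have := ftc_indic t0 d' c'; rewrite shift0 => -[h1 h2]; split => //; exact: esym.
Qed.

(* Multiplication by f'(g) - f'(0) is convolution on the Fourier side; splitting
   off the linear Taylor term keeps all functions integrable. *)
Lemma ft_taylor_rem_step b k w (F : R * R -> R[i]) :
  F = (fun v => (ft (fun z => (taylor_rem f k.+1 g z)%:C) v +
      (derive1n k.+2 f 0)%:C * U v) *
    ((((2 * pi) ^+ 2)^-1)%:C * icoord b U (aff2 (-1) w v))) ->
  cinteg m2 F /\
  'i%C * (coord b w)%:C * ft (fun z => (taylor_rem f k g z)%:C) w = cint m2 F.
Proof.
move=> ->; have N10 : -1 != 0 :> R by rewrite oppr_eq0 oner_eq0.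
set c := ((2 * pi) ^+ 2)^-1; set c2 := derive1n k.+2 f 0.
have [_ lU _] := fU.
(* The transform of this reflected and translated function is [g' b z] times the character at [w]
   ([ftX]), so testing against it produces the transform at [w] of a product with [g']. *)
pose X v : R[i] := c%:C * icoord b U (aff2 (-1) w v).
have iX : cinteg m2 X.
  exact: (cintegZ c%:C (cinteg_aff2 w N10 (iiU b))).
have lX : L2C X.
  have /L2CP[mX _] := liU b; have rX := L2C_rint (liU b); apply/L2CP; split.
    exact: cinteg_meas iX.
  have := rintZ (c ^+ 2) (rint_aff2 w N10 rX); congr (rint _ _).
  by apply/funext => v; rewrite /X csqZR.
have hI v : icoord b U (- v.1, - v.2) = (icoord b U v)^*%C.
  rewrite /icoord hU !cconjM conjc_real coord_opp.
  by apply: complex_ext; rewrite !(cReM, cImM) /=; ring.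
have ftX z : ft X z = (g' b z)%:C * expi (- dot w z).
  pose G v := c%:C * icoord b U v * (expi (dot z v) * expi (- dot w z)).
  have iG : cinteg m2 G.
    have h := cintegZ c%:C (cinteg_ift z (iiU b)).
    have := cintegZ (expi (- dot w z)) h; congr (cinteg _ _).
    by apply/funext => v; rewrite /G mulrC !mulrA.
  transitivity (cint m2 G).
    rewrite -(cint_aff2 w N10 iG) sqrrN expr1n mul1r.
    congr cint; apply/funext => v; rewrite /G /X -expiD; congr (_ * expi _).
    by rewrite /dot /aff2 /=; ring.
  have -> : G = (fun v => c%:C * (icoord b U v * expi (dot z v)) * expi (- dot w z)).
    by apply/funext => v; rewrite /G !mulrA.
  rewrite cintZr; last exact: cintegZ (cinteg_ift z (iiU b)).
  rewrite cintZ; last exact: (cinteg_ift z (iiU b)).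
  congr (_ * _); rewrite /g' /profile rmorphM; congr (_ * _).
  by rewrite -/(ift _ _) ift_ft; exact: ft_real.
have iR1 := cinteg_real (rint_taylor_rem k.+1).
have lfX := L2C_ft iX lX.
have i1 : cinteg m2 (fun z => (rem k.+1 z)%:C * ft X z).
  have h z : cnorm1 (ft X z) <= 2 * \int[m2]_v cnorm1 (X v) by exact: ft_bound.
  exact: (cintegM_bnd iR1 (ft_meas iX) h).
have i2 : cinteg m2 (fun z => (g z)%:C * ft X z) by exact: cinteg_L2M (L2C_real lg) lfX.
have i3 : cinteg m2 (fun v => ft (fun z => (rem k.+1 z)%:C) v * X v).
  have h v : cnorm1 (ft (fun z => (rem k.+1 z)%:C) v) <=
      2 * \int[m2]_z cnorm1 (rem k.+1 z)%:C by exact: ft_bound.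
  exact: (cinteg_bndM (ft_meas iR1) h iX).
have i4 : cinteg m2 (fun v => U v * X v) by exact: cinteg_L2M lU lX.
have FE : (fun v => ft (fun z => (rem k.+1 z)%:C) v * X v + c2%:C * (U v * X v)) =
    (fun v => (ft (fun z => (rem k.+1 z)%:C) v + c2%:C * U v) * X v).
  by apply/funext => v; rewrite mulrDl mulrA.
split; first by have := cintegD i3 (cintegZ c2%:C i4); rewrite FE.
rewrite -[LHS](ft_rem' b k w).
transitivity (cint m2 (fun z => (rem k.+1 z)%:C * ft X z + c2%:C * ((g z)%:C * ft X z))).
  congr cint; apply/funext => z; rewrite rem'E ftX rmorphM rmorphD rmorphM.
  by rewrite !(mulrDl, mulrA).
rewrite cintD//; last exact: cintegZ.
(* The two terms need different multiplication formulas: the remainder is integrable, whereas [g] is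
   only square integrable. *)
rewrite cintZ// (L1_multiplication iR1 iX) (fourier_multiplication fU iX lX).
by rewrite -cintZ// -cintD//; [rewrite FE|exact: cintegZ].
Qed.

End nonlinear_terms.

(** * Factorial bounds for the moments *)

Section factorial_growth.
Context {R : realType}.
Implicit Types F G : nat -> R.

(** Hides the constants during the sup-norm rounds, where finitely many operations are applied to
    sequences in k and the particular [C] and [B] do not matter. *)
Definition factorial_growth F := exists C B : R,
  [/\ 0 <= C, 0 <= B & forall k, F k <= C * B ^+ k * k`!%:R].

Lemma factorial_growth_le F G : (forall k, F k <= G k) ->
  factorial_growth G -> factorial_growth F.
Proof.
by move=> FG [C [B [C0 B0 h]]]; exists C, B; split => // k; exact: le_trans (FG k) (h k).
Qed.

Lemma factorial_growthD F G : factorial_growth F -> factorial_growth G ->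
  factorial_growth (fun k => F k + G k).
Proof.
move=> [C [B [C0 B0 h]]] [C' [B' [C'0 B'0 h']]]; exists (C + C'), (B + B').
split; [exact: addr_ge0|exact: addr_ge0|move=> k].
have k0 : 0 <= k`!%:R :> R by [].
apply: le_trans (lerD (h k) (h' k)) _; rewrite -mulrDl ler_wpM2r// mulrDl.
by apply: lerD; rewrite ler_wpM2l// lerXn2r ?nnegrE ?addr_ge0// ?lerDl ?lerDr.
Qed.

Lemma factorial_growthZ F (a : R) : 0 <= a -> factorial_growth F ->
  factorial_growth (fun k => a * F k).
Proof.
move=> a0 [C [B [C0 B0 h]]]; exists (a * C), B; split => //; first exact: mulr_ge0.
by move=> k; rewrite -!mulrA ler_wpM2l// mulrA.
Qed.

(** The extra factor k + 1 is at most 2^k and is absorbed by doubling [B]. *)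
Lemma factorial_growthS F : factorial_growth F ->
  factorial_growth (fun k => F k.+1).
Proof.
move=> [C [B [C0 B0 h]]]; exists (C * B), (2 * B); split.
- exact: mulr_ge0.
- exact: mulr_ge0.
move=> k; apply: le_trans (h k.+1) _.
have k1 : k.+1%:R <= 2 ^+ k :> R by rewrite -natrX ler_nat ltn_expl.
rewrite factS natrM exprS exprMn.
have -> : C * (B * B ^+ k) * (k.+1%:R * k`!%:R) = (C * B * B ^+ k * k`!%:R) * k.+1%:R.
  by ring.
have -> : C * B * (2 ^+ k * B ^+ k) * k`!%:R = (C * B * B ^+ k * k`!%:R) * 2 ^+ k.
  by ring.
by rewrite ler_wpM2l// !mulr_ge0// exprn_ge0.
Qed.

End factorial_growth.

Section convolution.
Context {R : realType}.
Notation m2 := (lebesgue2 R).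
Local Open Scope ereal_scope.

(** Stated in the extended reals because it is applied to moments whose finiteness is still to be
    proved. *)
Lemma ge0_integral_conv (f g : R * R -> R) : measurable_fun setT f ->
  measurable_fun setT g -> (forall v, 0 <= f v)%R -> (forall v, 0 <= g v)%R ->
  \int[m2 \x m2]_p (f p.2 * g (aff2 (-1) p.1 p.2))%:E =
  (\int[m2]_v (f v)%:E) * (\int[m2]_v (g v)%:E).
Proof.
move=> mf mg f0 g0; have n10 : (1 != 0 :> R)%R by rewrite oner_eq0.
have mg' : measurable_fun setT (fun v => (g v)%:E) by exact/measurable_EFinP.
have mfg : measurable_fun setT
    (fun p : (R * R) * (R * R) => (f p.2 * g (aff2 (-1) p.1 p.2))%:E).
  apply/measurable_EFinP; apply: measurable_funM.
    exact: measurableT_comp mf measurable_snd.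
  apply: measurableT_comp mg _.
  exact: measurable_aff2_fun measurable_fst measurable_snd.
have h0 (p : (R * R) * (R * R)) : 0 <= (f p.2 * g (aff2 (-1) p.1 p.2))%:E.
  by rewrite lee_fin mulr_ge0.
have := @fubini_tonelli2 _ _ _ _ _ m2 m2 _ mfg h0; rewrite /fubini_G /= => ->.
transitivity (\int[m2]_v ((f v)%:E * \int[m2]_w (g w)%:E)).
  apply: eq_integral => v _; under eq_integral do rewrite EFinM.
  have mgv : measurable_fun setT (fun w => (g (aff2 (-1) w v))%:E).
    apply/measurable_EFinP; apply: measurableT_comp mg _.
    exact: (@measurable_aff2_fun R _ (R * R)%type (-1)%R id (cst v)).
  have gv0 w : setT w -> 0 <= (g (aff2 (-1) w v))%:E by rewrite lee_fin.
  have fv0 : 0 <= (f v)%:E by rewrite lee_fin.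
  transitivity ((f v)%:E * \int[m2]_w (g (aff2 (-1) w v))%:E).
    exact: (ge0_integralZl m2 measurableT mgv gv0 fv0).
  congr (_ * _).
  rewrite -(ge0_integral_affine2 (- v.1, - v.2)%R n10 mg' (fun=> g0 _)).
  rewrite expr1n mul1e; apply: eq_integral => w _; congr (g _)%:E.
  by rewrite /aff2 /= !mulN1r !mul1r; congr pair; rewrite addrC.
have mf' : measurable_fun setT (fun v => (f v)%:E) by exact/measurable_EFinP.
have f0' v : setT v -> 0 <= (f v)%:E by rewrite lee_fin.
have G0 : 0 <= \int[m2]_w (g w)%:E by apply: integral_ge0 => w _; rewrite lee_fin.
exact: (ge0_integralZr m2 measurableT mf' f0' G0).
Qed.

End convolution.

(** * Combinatorial estimates for factorial weights *)

Section factorial_sums.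
Context {R : realType}.

(** Strengthened to 2 - 1 / (n + 1) so that the induction telescopes. *)
Lemma sum_inv_sqr (n : nat) : \sum_(j < n) (j.+1%:R ^+ 2)^-1 <= 2 :> R.
Proof.
suff h : \sum_(j < n.+1) (j.+1%:R ^+ 2)^-1 <= 2 - n.+1%:R^-1 :> R.
  case: n h => [|n] h; first by rewrite big_ord0.
  rewrite big_ord_recr /= in h.
  have h1 : 0 <= (n.+2%:R : R)^-1 by rewrite invr_ge0.
  have h2 : 0 <= (n.+2%:R ^+ 2 : R)^-1 by rewrite invr_ge0 exprn_ge0.
  apply: le_trans (le_trans _ (le_trans h _)); last by rewrite gerBl.
    exact: lexx.
  by rewrite lerDl.
elim: n => [|n IH]; first by rewrite big_ord_recr big_ord0 /= expr1n invr1; lra.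
rewrite big_ord_recr /=; apply: le_trans (lerD IH (lexx _)) _.
have n1 : n.+1%:R > 0 :> R by [].
have -> : n.+2%:R = n.+1%:R + 1 :> R by rewrite -natr1.
move: n1; set x := n.+1%:R => x0; rewrite -subr_ge0.
have -> : 2 - (x + 1)^-1 - (2 - x^-1 + ((x + 1) ^+ 2)^-1) = (x * (x + 1) ^+ 2)^-1.
  by field; apply/andP; split; apply: lt0r_neq0; lra.
by rewrite invr_ge0 mulr_ge0 ?sqr_ge0 ?(ltW x0).
Qed.

(** With x = n - j + 1 and y = j + 1, one has x + y = n + 2 and 1 / (x y)^2 <= 2 (x + y)^-2 (x^-2 +
    y^-2). Each of the two resulting sums is at most 2, whence 8. *)
Lemma sum_inv_sqr_conv (n : nat) :
  \sum_(j < n.+1) ((n - j).+1%:R ^+ 2 * j.+1%:R ^+ 2)^-1 <= 8 / n.+2%:R ^+ 2 :> R.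
Proof.
have h : \sum_(j < n.+1) ((n - j).+1%:R ^+ 2 * j.+1%:R ^+ 2)^-1 <=
    \sum_(j < n.+1) 2 / n.+2%:R ^+ 2 * (((n - j).+1%:R ^+ 2)^-1 + (j.+1%:R ^+ 2)^-1) :> R.
  apply: ler_sum => j _.
  have -> : n.+2%:R = (n - j).+1%:R + j.+1%:R :> R.
    by rewrite -natrD; congr (_%:R); rewrite addSn addnS subnK// -ltnS.
  have : (n - j).+1%:R > 0 :> R by []. have : j.+1%:R > 0 :> R by [].
  set x := (n - j).+1%:R; set y := j.+1%:R => y0 x0; rewrite -subr_ge0.
  have -> : 2 / (x + y) ^+ 2 * ((x ^+ 2)^-1 + (y ^+ 2)^-1) - (x ^+ 2 * y ^+ 2)^-1 =
      (x - y) ^+ 2 / ((x + y) * x * y) ^+ 2.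
    by field; rewrite !gt_eqF// addr_gt0.
  by rewrite divr_ge0 ?sqr_ge0.
apply: (le_trans h); rewrite -mulr_sumr big_split /=.
have -> : \sum_(j < n.+1) ((n - j).+1%:R ^+ 2)^-1 = \sum_(j < n.+1) (j.+1%:R ^+ 2)^-1 :> R.
  by rewrite [RHS](reindex_inj rev_ord_inj); apply: eq_bigr => j _; rewrite /= subSS.
have s0 : 0 <= 2 / n.+2%:R ^+ 2 :> R by rewrite divr_ge0 ?exprn_ge0.
have := sum_inv_sqr n.+1; set s := \sum_(_ < _) _ => s2.
have -> : 8 / n.+2%:R ^+ 2 = 2 / n.+2%:R ^+ 2 * 4 :> R by ring.
by rewrite ler_wpM2l//; lra.
Qed.

(** After cancelling common factorials this is the monotonicity of the binomial coefficient in its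
    upper index. *)
Lemma bin_fact_le (n j k : nat) : (j <= n)%N ->
  ('C(n, j) * (n - j + k.+1)`! * j`! <= (n + k.+1)`!)%N.
Proof.
move=> jn; have := bin_fact (leq_addl (n - j) k.+1); rewrite addnK => <-.
have := bin_fact (leq_addl n k.+1); rewrite addnK => <-.
rewrite -(bin_fact jn).
have -> : ('C(n, j) * ('C(n - j + k.+1, k.+1) * (k.+1`! * (n - j)`!)) * j`! =
  'C(n - j + k.+1, k.+1) * (k.+1`! * ('C(n, j) * (j`! * (n - j)`!))))%N by ring.
by rewrite leq_mul2r leq_bin2l ?orbT// leq_add2r leq_subr.
Qed.

Lemma fact_mul_le (n k : nat) : (n`! * k`! <= (n + k)`!)%N.
Proof.
have := bin_fact (leq_addl n k); rewrite addnK => <-.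
by rewrite [(n`! * _)%N]mulnC leq_pmull// bin_gt0 leq_addl.
Qed.

(* The factor (n + 1)^-2 keeps the sum in fact_weight_rec bounded uniformly in n. *)
Definition fact_weight (K L B : R) (n k : nat) : R :=
  K * L ^+ n * B ^+ k * (n + k)`!%:R / n.+1%:R ^+ 2.

(** The sum is quadratic in the weights while the bound is linear: the surplus factor [K], the
    constant 8 of [sum_inv_sqr_conv], [c] and B + A are all paid for by the additional power of [L].
    The factorials agree because n + (k + 1) = (n + 1) + k. *)
Lemma fact_weight_rec (K L A B c : R) (a : nat -> R) (n k : nat) : 0 <= K -> 0 <= A ->
  0 <= B -> 0 <= c -> 8 * c * K * (B + A) <= L ->
  (forall i, 0 <= a i <= A * B ^+ i * i`!%:R) ->
  c * \sum_(j < n.+1) 'C(n, j)%:R *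
    (fact_weight K L B (n - j) k.+1 + a k * fact_weight K L B (n - j) 0) *
    fact_weight K L B j 0 <= fact_weight K L B n.+1 k.
Proof.
move=> K0 A0 B0 c0 Lh ha.
have L0 : 0 <= L by apply: le_trans Lh; rewrite !mulr_ge0 ?addr_ge0.
have Bk : 0 <= B ^+ k by exact: exprn_ge0.
have Ln : 0 <= L ^+ n by exact: exprn_ge0.
(* The part of the bound common to all splittings [j]. *)
pose W := K ^+ 2 * L ^+ n * B ^+ k * (n + k.+1)`!%:R * (B + A).
have W0 : 0 <= W by rewrite !mulr_ge0 ?sqr_ge0 ?addr_ge0.
have h : \sum_(j < n.+1) 'C(n, j)%:R *
    (fact_weight K L B (n - j) k.+1 + a k * fact_weight K L B (n - j) 0) *
    fact_weight K L B j 0 <=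
    \sum_(j < n.+1) W * ((n - j).+1%:R ^+ 2 * j.+1%:R ^+ 2)^-1.
  apply: ler_sum => j _; have jn : (j <= n)%N by rewrite -ltnS.
  have /andP[ak0 ak] := ha k.
  have h1 : 'C(n, j)%:R * (n - j + k.+1)`!%:R * j`!%:R <= (n + k.+1)`!%:R :> R.
    by rewrite -!natrM ler_nat; exact: bin_fact_le.
  have h2 : a k * ('C(n, j)%:R * (n - j)`!%:R * j`!%:R) <= A * B ^+ k * (n + k.+1)`!%:R :> R.
    apply: (@le_trans _ _ (A * B ^+ k * k`!%:R * n`!%:R)).
      rewrite -!natrM -mulnA [((n - j)`! * _)%N]mulnC bin_fact//.
      exact: ler_wpM2r.
    rewrite -mulrA ler_wpM2l ?mulr_ge0// -natrM ler_nat mulnC.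
    apply: leq_trans (fact_mul_le _ _) _; rewrite addnS factS.
    exact: leq_pmull.
  rewrite /fact_weight !addn0.
  have E : 'C(n, j)%:R * (K * L ^+ (n - j) * B ^+ k.+1 * (n - j + k.+1)`!%:R /
      (n - j).+1%:R ^+ 2 + a k * (K * L ^+ (n - j) * B ^+ 0 * (n - j)`!%:R /
      (n - j).+1%:R ^+ 2)) * (K * L ^+ j * B ^+ 0 * j`!%:R / j.+1%:R ^+ 2) =
      K ^+ 2 * (L ^+ (n - j) * L ^+ j) *
      (B ^+ k * B * ('C(n, j)%:R * (n - j + k.+1)`!%:R * j`!%:R) +
       a k * ('C(n, j)%:R * (n - j)`!%:R * j`!%:R)) *
      ((n - j).+1%:R ^+ 2 * j.+1%:R ^+ 2)^-1.
    by rewrite expr0 (exprS B k) (invfM ((n - j).+1%:R ^+ 2)); ring.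
  rewrite {}E -exprD subnK//.
  apply: ler_wpM2r; first by rewrite invr_ge0 mulr_ge0 ?exprn_ge0.
  have -> : W = K ^+ 2 * L ^+ n *
      (B ^+ k * B * (n + k.+1)`!%:R + A * B ^+ k * (n + k.+1)`!%:R).
    by rewrite /W; ring.
  apply: ler_wpM2l; first by apply: mulr_ge0; rewrite ?sqr_ge0.
  by apply: lerD => //; apply: ler_wpM2l => //; exact: mulr_ge0.
apply: (le_trans (ler_wpM2l c0 h)); rewrite -mulr_sumr.
apply: (@le_trans _ _ (c * (W * (8 / n.+2%:R ^+ 2)))).
  by rewrite ler_wpM2l// ler_wpM2l// sum_inv_sqr_conv.
have -> : c * (W * (8 / n.+2%:R ^+ 2)) =
    (8 * c * K * (B + A)) * (K * L ^+ n * B ^+ k * (n + k.+1)`!%:R / n.+2%:R ^+ 2).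
  by rewrite /W; ring.
have -> : fact_weight K L B n.+1 k =
    L * (K * L ^+ n * B ^+ k * (n + k.+1)`!%:R / n.+2%:R ^+ 2).
  by rewrite /fact_weight addSnnS exprS; ring.
apply: ler_wpM2r => //; apply: divr_ge0; last exact: exprn_ge0.
by apply: mulr_ge0 => //; apply: mulr_ge0 => //; apply: mulr_ge0.
Qed.

End factorial_sums.

(** * The recursion for weighted bounds, with |w_e|, |U|, |V_k| and |f^(k+2)(0)| abstracted *)

Section moment_recursion.
Context {R : realType}.
Notation m2 := (lebesgue2 R).
Notation T := (aff2 (-1)).
Variables (m u : R * R -> R) (V : nat -> R * R -> R) (a : nat -> R) (c : R).
Hypotheses (mm : measurable_fun setT m) (mu : measurable_fun setT u)
  (mV : forall k, measurable_fun setT (V k))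
  (m0 : forall w, 0 <= m w) (u0 : forall w, 0 <= u w) (V0 : forall k w, 0 <= V k w)
  (a0 : forall k, 0 <= a k) (c0 : 0 <= c)
  (msub : forall w v, m w <= m v + m (T w v))
  (uV : forall w, u w <= V 0%N w) (muV : forall w, m w * u w <= V 0%N w)
  (step : forall k w, ((m w * V k w)%:E <= c%:E * \int[m2]_v
     ((V k.+1 v + a k * u v) * (m (T w v) * u (T w v)))%:E)%E).

(** Works in the extended reals, so that it applies before any moment is known to be finite. *)
Let step_pow (n k : nat) w (h : R * R -> R) : measurable_fun setT h ->
  (forall v, m w ^+ n * ((V k.+1 v + a k * u v) * (m (T w v) * u (T w v))) <= h v) ->
  ((m w ^+ n.+1 * V k w)%:E <= c%:E * \int[m2]_v (h v)%:E)%E.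
Proof.
move=> mh hle; have n0 : 0 <= m w ^+ n by exact: exprn_ge0.
have mT (q : R * R -> R) : measurable_fun setT q -> measurable_fun setT (fun v => q (T w v)).
  by move=> mq; exact: measurableT_comp mq (measurable_aff2 _ _).
have mF : measurable_fun setT (fun v =>
    ((V k.+1 v + a k * u v) * (m (T w v) * u (T w v)))%:E).
  apply/measurable_EFinP; apply: measurable_funM; last first.
    by apply: measurable_funM; exact: mT.
  by apply: measurable_funD; [exact: mV|exact: measurable_funM].
have F0 v : 0 <= (V k.+1 v + a k * u v) * (m (T w v) * u (T w v)).
  by rewrite mulr_ge0 ?addr_ge0 ?mulr_ge0.
have -> : (m w ^+ n.+1 * V k w)%:E = ((m w ^+ n)%:E * (m w * V k w)%:E)%E.
  by rewrite -EFinM exprSr mulrA.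
apply: le_trans (lee_wpmul2l _ (step k w)) _; first by rewrite lee_fin.
rewrite muleCA; apply: lee_wpmul2l; first by rewrite lee_fin.
have F0' v : setT v -> (0 <= ((V k.+1 v + a k * u v) * (m (T w v) * u (T w v)))%:E)%E.
  by rewrite lee_fin.
have n0' : (0 <= (m w ^+ n)%:E)%E by rewrite lee_fin.
rewrite -(ge0_integralZl m2 measurableT mF F0' n0').
apply: ge0_le_integral => //.
- by move=> v _; apply: mule_ge0 => //; exact: F0'.
- by apply: measurable_funeM; exact: mF.
- exact/measurable_EFinP.
- by move=> v _; rewrite -EFinM lee_fin.
Qed.

(** The weight is split by m(w)^j <= 2^j (m(v)^j + m(w - v)^j). In the first part it is carried by
    V_{k+1} + a_k u, bounded through [F], against the first moment of [u]; in the second it raises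
    the moment of [u] to order j + 1, against the unweighted bounds [F0]. *)
Lemma sup_moment_step (j : nat) (F0 F : nat -> R) :
  rint m2 (fun w => m w * u w) -> rint m2 (fun w => m w ^+ j.+1 * u w) ->
  factorial_growth a -> factorial_growth F0 -> factorial_growth F ->
  (forall k w, V k w <= F0 k) -> (forall k w, m w ^+ j * V k w <= F k) ->
  exists2 F', factorial_growth F' & forall k w, m w ^+ j.+1 * V k w <= F' k.
Proof.
move=> i1 ij ga gF0 gF hF0 hF.
have F0_ge0 k : 0 <= F0 k by exact: le_trans (V0 k (0, 0)) (hF0 _ _).
have F_ge0 k : 0 <= F k.
  by apply: le_trans (hF k (0, 0)); rewrite mulr_ge0 ?exprn_ge0.
(* Bounds V_{k+1} + a_k u when [G] bounds the V_k, since u <= V_0. *)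
pose E (G : nat -> R) k := G k.+1 + G 0%N * a k.
pose I1 := \int[m2]_w (m w * u w); pose Ij := \int[m2]_w (m w ^+ j.+1 * u w).
have I1_ge0 : 0 <= I1 by apply: Rintegral_ge0 => w _; rewrite mulr_ge0.
have Ij_ge0 : 0 <= Ij by apply: Rintegral_ge0 => w _; rewrite mulr_ge0 ?exprn_ge0.
have gE G : (forall k, 0 <= G k) -> factorial_growth G -> factorial_growth (E G).
  move=> G0 gG; apply: factorial_growthD; first exact: factorial_growthS.
  exact: factorial_growthZ.
exists (fun k => c * 2 ^+ j * (I1 * E F k + Ij * E F0 k)).
  apply: factorial_growthZ; first by rewrite mulr_ge0 ?exprn_ge0.
  by apply: factorial_growthD; apply: factorial_growthZ => //; exact: gE.
move=> k w.
pose h x := 2 ^+ j * (E F k * (m x * u x) + E F0 k * (m x ^+ j.+1 * u x)).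
have ih : rint m2 h by apply: rintZ; apply: rintD; exact: rintZ.
have ihT : rint m2 (fun v => h (T w v)).
  by apply: (rint_aff2 w _ ih); rewrite oppr_eq0 oner_eq0.
have EF G : (forall k, 0 <= G k) -> 0 <= E G k.
  by move=> G0; rewrite addr_ge0// mulr_ge0.
have h0 x : 0 <= h x.
  apply: mulr_ge0; first exact: exprn_ge0.
  by apply: addr_ge0; apply: mulr_ge0; rewrite ?EF// mulr_ge0 ?exprn_ge0.
have hle v : m w ^+ j * ((V k.+1 v + a k * u v) * (m (T w v) * u (T w v))) <= h (T w v).
  have mw : m w ^+ j <= 2 ^+ j * (m v ^+ j + m (T w v) ^+ j).
    have mw : m w <= 2 * Num.max (m v) (m (T w v)).
      apply: le_trans (msub w v) _; rewrite mulr_natl mulr2n.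
      by apply: lerD; rewrite le_max lexx ?orbT.
    apply: (@le_trans _ _ ((2 * Num.max (m v) (m (T w v))) ^+ j)).
      by rewrite lerXn2r ?nnegrE// mulr_ge0// le_max m0.
    rewrite exprMn ler_wpM2l ?exprn_ge0//.
    by case: (leP (m v) (m (T w v))) => _; rewrite ?lerDl ?lerDr exprn_ge0.
  have b1 : m v ^+ j * (V k.+1 v + a k * u v) <= E F k.
    rewrite mulrDr; apply: lerD; first exact: hF.
    rewrite mulrCA mulrC; apply: ler_wpM2r => //.
    by apply: le_trans (hF 0%N v); rewrite ler_wpM2l ?exprn_ge0.
  have b0 : V k.+1 v + a k * u v <= E F0 k.
    apply: lerD; first exact: hF0.
    by rewrite mulrC; apply: ler_wpM2r => //; exact: le_trans (uV v) (hF0 _ _).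
  have q0 : 0 <= m (T w v) * u (T w v) by exact: mulr_ge0.
  have p0 : 0 <= V k.+1 v + a k * u v by rewrite addr_ge0 ?mulr_ge0.
  apply: (@le_trans _ _ (2 ^+ j * (m v ^+ j + m (T w v) ^+ j) *
      ((V k.+1 v + a k * u v) * (m (T w v) * u (T w v))))).
    by apply: ler_wpM2r => //; exact: mulr_ge0.
  rewrite /h -mulrA ler_wpM2l ?exprn_ge0// mulrDl.
  apply: lerD; first by rewrite mulrA; apply: ler_wpM2r.
  rewrite mulrCA exprSr -[m _ ^+ j * m _ * _]mulrA; apply: ler_wpM2r => //.
  by rewrite mulr_ge0 ?exprn_ge0.
have := step_pow (rint_meas ihT) hle; rewrite (rint_EFin ihT).
have -> : \int[m2]_v h (T w v) = \int[m2]_v h v.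
  have N10 : -1 != 0 :> R by rewrite oppr_eq0 oner_eq0.
  by have := rintegral_aff2 w N10 ih; rewrite sqrrN expr1n mul1r.
rewrite -EFinM lee_fin /h RintegralZl//; last by apply: rintD; exact: rintZ.
by rewrite RintegralD//; [rewrite !RintegralZl// !mulrA ![E _ _ * _]mulrC|exact: rintZ|exact: rintZ].
Qed.

(** The binomial expansion of (m(v) + m(w - v))^n, with [u] and [m u] both replaced by V_0. This
    second replacement absorbs the factor m(w - v), so no moment of order above n occurs. *)
Let leibniz (n k : nat) (p : (R * R) * (R * R)) : R :=
  \sum_(j < n.+1) 'C(n, j)%:R *
    ((m p.2 ^+ (n - j) * (V k.+1 p.2 + a k * V 0%N p.2)) *
     (m (T p.1 p.2) ^+ j * V 0%N (T p.1 p.2))).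

Let leibniz_ge (n k : nat) w v :
  m w ^+ n * ((V k.+1 v + a k * u v) * (m (T w v) * u (T w v))) <= leibniz n k (w, v).
Proof.
have -> : leibniz n k (w, v) = (m v + m (T w v)) ^+ n *
    ((V k.+1 v + a k * V 0%N v) * V 0%N (T w v)).
  rewrite exprDn mulr_suml; apply: eq_bigr => j _ /=.
  by rewrite -mulr_natl; ring.
have q0 : 0 <= V k.+1 v + a k * u v by rewrite addr_ge0 ?mulr_ge0.
apply: ler_pM; rewrite ?exprn_ge0 ?mulr_ge0//.
  by rewrite lerXn2r ?nnegrE ?addr_ge0.
apply: ler_pM; rewrite ?mulr_ge0// lerD2l.
exact: ler_wpM2l.
Qed.

(** Strong induction on n, for all k simultaneously: integrating the step over [w] turns each term
    of the expansion into a product of two L^1 norms of order at most n, to which the induction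
    hypothesis applies at k + 1 and at 0. *)
Lemma L1_moment_bound (K L A B : R) : 0 <= K -> 0 <= A -> 0 <= B ->
  8 * c * K * (B + A) <= L -> (forall k, a k <= A * B ^+ k * k`!%:R) ->
  (forall k, (\int[m2]_w (V k w)%:E <= (K * B ^+ k * k`!%:R)%:E)%E) ->
  forall n k, (\int[m2]_w (m w ^+ n * V k w)%:E <= (fact_weight K L B n k)%:E)%E.
Proof.
move=> K0 A0 B0 Lh ha hV.
have L0 : 0 <= L by apply: le_trans Lh; rewrite !mulr_ge0 ?addr_ge0.
elim/ltn_ind => -[|n] IH k.
  have -> : fact_weight K L B 0 k = K * B ^+ k * k`!%:R.
    by rewrite /fact_weight expr0 mulr1 expr1n divr1.
  by under eq_integral do rewrite mul1r; exact: hV.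
have mmn i : measurable_fun setT (fun w => m w ^+ i) by exact: measurable_funX.
pose f1 i v := m v ^+ i * (V k.+1 v + a k * V 0%N v).
pose g1 i v := m v ^+ i * V 0%N v.
have mf1 i : measurable_fun setT (f1 i).
  apply: measurable_funM; first exact: mmn.
  by apply: measurable_funD; [exact: mV|apply: measurable_funM => //; exact: mV].
have mg1 i : measurable_fun setT (g1 i).
  by apply: measurable_funM; [exact: mmn|exact: mV].
have f10 i v : 0 <= f1 i v by rewrite mulr_ge0 ?exprn_ge0 ?addr_ge0 ?mulr_ge0.
have g10 i v : 0 <= g1 i v by rewrite mulr_ge0 ?exprn_ge0.
have mfg j : measurable_fun setT (fun p : (R * R) * (R * R) =>
    f1 (n - j)%N p.2 * g1 j (T p.1 p.2)).
  apply: measurable_funM; first exact: measurableT_comp (mf1 _) measurable_snd.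
  apply: measurableT_comp (mg1 j) _.
  exact: measurable_aff2_fun measurable_fst measurable_snd.
have ml : measurable_fun setT (leibniz n k).
  apply: measurable_sum => j; apply: measurable_funM => //; exact: mfg.
have l0 p : 0 <= leibniz n k p.
  apply: sumr_ge0 => j _; apply: mulr_ge0 => //.
  by apply: mulr_ge0; [exact: f10|exact: g10].
pose m4 := (m2 \x m2)%E.
have mlE : measurable_fun setT (fun p => (leibniz n k p)%:E) by exact/measurable_EFinP.
have l0E p : (0 <= (leibniz n k p)%:E)%E by rewrite lee_fin.
have c0E : (0 <= c%:E)%E by rewrite lee_fin.
have E1 : (\int[m2]_w (m w ^+ n.+1 * V k w)%:E <=
    c%:E * \int[m4]_p (leibniz n k p)%:E)%E.
  have -> := @fubini_tonelli1 _ _ _ _ _ m2 m2 _ mlE l0E.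
  have mF := @measurable_fun_fubini_tonelli_F _ _ _ _ _ m2 _ mlE l0E.
  have F0 w : setT w -> (0 <= fubini_F m2 (fun p => (leibniz n k p)%:E) w)%E.
    by move=> _; apply: integral_ge0 => v _; exact: l0E.
  rewrite -(ge0_integralZl m2 measurableT mF F0 c0E).
  apply: ge0_le_integral => //.
  - by move=> w _; rewrite lee_fin mulr_ge0 ?exprn_ge0.
  - by apply/measurable_EFinP; apply: measurable_funM; [exact: mmn|exact: mV].
  - by apply: measurable_funeM; exact: mF.
  - move=> w _; apply: step_pow; last exact: leibniz_ge.
    exact: measurableT_comp ml (measurable_pair1 _).
have E2 : (\int[m4]_p (leibniz n k p)%:E = \sum_(j < n.+1)
    'C(n, j)%:R%:E * ((\int[m2]_v (f1 (n - j)%N v)%:E) * (\int[m2]_v (g1 j v)%:E)))%E.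
  transitivity (\int[m4]_p \sum_(j < n.+1)
      ('C(n, j)%:R%:E * (f1 (n - j)%N p.2 * g1 j (T p.1 p.2))%:E))%E.
    by apply: eq_integral => p _; rewrite /leibniz -sumEFin.
  have mfgE j : measurable_fun setT (fun p : (R * R) * (R * R) =>
      (f1 (n - j)%N p.2 * g1 j (T p.1 p.2))%:E) by apply/measurable_EFinP; exact: mfg.
  have fg0 j (p : (R * R) * (R * R)) : setT p ->
      (0 <= (f1 (n - j)%N p.2 * g1 j (T p.1 p.2))%:E)%E.
    by move=> _; rewrite lee_fin; apply: mulr_ge0; [exact: f10|exact: g10].
  have C0 j : (0 <= 'C(n, j)%:R%:E :> \bar R)%E by rewrite lee_fin ler0n.
  rewrite ge0_integral_sum//.
  - apply: eq_bigr => j _; rewrite -ge0_integral_conv//.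
    exact: (ge0_integralZl m4 measurableT (mfgE j) (fg0 j) (C0 j)).
  - by move=> j; apply: measurable_funeM; exact: mfgE.
  - by move=> j p _; apply: mule_ge0; [exact: C0|exact: fg0].
have Ef i : (i <= n)%N -> (\int[m2]_v (f1 i v)%:E <=
    (fact_weight K L B i k.+1 + a k * fact_weight K L B i 0)%:E)%E.
  move=> ile; have mmV j : measurable_fun setT (fun v => (m v ^+ i * V j v)%:E).
    by apply/measurable_EFinP; apply: measurable_funM; [exact: mmn|exact: mV].
  have mV0 j v : setT v -> (0 <= (m v ^+ i * V j v)%:E)%E.
    by move=> _; rewrite lee_fin mulr_ge0 ?exprn_ge0.
  have ak0 : (0 <= (a k)%:E)%E by rewrite lee_fin.
  have -> : (\int[m2]_v (f1 i v)%:E = \int[m2]_v (m v ^+ i * V k.+1 v)%:E +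
      (a k)%:E * \int[m2]_v (m v ^+ i * V 0%N v)%:E)%E.
    rewrite -(ge0_integralZl m2 measurableT (mmV 0%N) (mV0 0%N) ak0).
    rewrite -ge0_integralD//.
    - by apply: eq_integral => v _; rewrite -EFinM -EFinD; congr EFin; rewrite /f1; ring.
    - by move=> v _; exact: mV0.
    - exact: mmV.
    - by move=> v _; apply: mule_ge0 => //; exact: mV0.
    - by apply: measurable_funeM; exact: mmV.
  rewrite EFinD EFinM; apply: leeD; first exact: IH.
  by rewrite EFinM; apply: lee_wpmul2l => //; exact: IH.
apply: (le_trans E1); rewrite E2.
have ha' i : 0 <= a i <= A * B ^+ i * i`!%:R by rewrite a0 ha.
apply: (@le_trans _ _ (c * \sum_(j < n.+1) 'C(n, j)%:R *
    (fact_weight K L B (n - j) k.+1 + a k * fact_weight K L B (n - j) 0) *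
    fact_weight K L B j 0)%:E); last by rewrite lee_fin; exact: (fact_weight_rec n k K0 A0 B0 c0 Lh ha').
rewrite EFinM; apply: lee_wpmul2l => //; rewrite -sumEFin.
apply: lee_sum => j _; rewrite -mulrA EFinM; apply: lee_wpmul2l.
  by rewrite lee_fin ler0n.
rewrite EFinM; apply: lee_pmul.
- by apply: integral_ge0 => v _; rewrite lee_fin.
- by apply: integral_ge0 => v _; rewrite lee_fin.
- by apply: Ef; exact: leq_subr.
- exact: IH.
Qed.

End moment_recursion.

(** * Factorial bounds for the moments of U *)

Section factorial_moments.
Context {R : realType}.
Notation m2 := (lebesgue2 R).
Implicit Types (b : bool) (k : nat) (z w : R * R).

Let den_ge0 w : 0 <= `|w.1| + w.1 ^+ 2 + w.2 ^+ 2 :> R.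
Proof. by rewrite !addr_ge0 ?sqr_ge0. Qed.

Lemma qinv_ge0 w : 0 <= qinv w.
Proof. exact: divr_ge0. Qed.

Lemma measurable_qinv : measurable_fun setT (@qinv R).
Proof.
(* The quotient is written with a real power, whose measurability covers the zero of the denominator
   as well. *)
have -> : @qinv R = (fun w => `|w.1| * (`|w.1| + w.1 ^+ 2 + w.2 ^+ 2) `^ (-1)).
  by apply/funext => w; rewrite powR_inv1.
have m1 : measurable_fun setT (fun w : R * R => `|w.1|).
  by apply: measurableT_comp => //; exact: measurable_fst.
apply: measurable_funM; first exact: m1.
apply: (@measurableT_comp _ _ _ _ _ _ (fun x : R => x `^ (-1))) => //.
by repeat apply: measurable_funD; [exact: m1|apply: measurable_funX..].
Qed.

Lemma qinv_le1 w : qinv w <= 1.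
Proof.
rewrite /qinv; have [->|d0] := eqVneq (`|w.1| + w.1 ^+ 2 + w.2 ^+ 2) 0.
  by rewrite invr0 mulr0.
have d1 : 0 < `|w.1| + w.1 ^+ 2 + w.2 ^+ 2 by rewrite lt_def d0 den_ge0.
rewrite ler_pdivrMr// mul1r.
by have := sqr_ge0 w.1; have := sqr_ge0 w.2; lra.
Qed.

(** The gain of one full derivative in either direction: |w_b| |w_1| <= w_1^2 + w_2^2. *)
Lemma coord_qinv_le1 b w : `|coord b w| * qinv w <= 1.
Proof.
rewrite /qinv mulrA; have [->|d0] := eqVneq (`|w.1| + w.1 ^+ 2 + w.2 ^+ 2) 0.
  by rewrite invr0 mulr0.
have d1 : 0 < `|w.1| + w.1 ^+ 2 + w.2 ^+ 2 by rewrite lt_def d0 den_ge0.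
rewrite ler_pdivrMr// mul1r -normrM.
apply: (@le_trans _ _ (w.1 ^+ 2 + w.2 ^+ 2)); last first.
  by rewrite -addrA lerDr.
case: b; first by rewrite /= -expr2 normrX real_normK ?num_real// lerDl sqr_ge0.
by rewrite /= mulrC; exact: normM_le_sqrD.
Qed.

Lemma qinv_opp w : qinv (- w.1, - w.2) = qinv w.
Proof. by rewrite /qinv /= normrN !sqrrN. Qed.

Lemma ft_opp_real (q : R * R -> R) w : rint m2 q ->
  ft (fun z => (q z)%:C) (- w.1, - w.2) = (ft (fun z => (q z)%:C) w)^*%C.
Proof.
move=> iq; rewrite /ft -cint_conj; last exact: (cinteg_ft w (cinteg_real iq)).
congr cint; apply/funext => z; rewrite cconjM conjc_real -expiN; congr (_ * expi _).
by rewrite /dot /=; ring.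
Qed.

Variables (f : R -> R) (U : R * R -> R[i]) (r : R) (S : nat -> R).
Hypotheses (sf : smooth f) (f0 : f 0 = 0) (df0 : derive1 f 0 = 0)
  (fU : is_fourier (profile U) U)
  (UE : forall w, U w = (qinv w)%:C * ft (fun z => (f (profile U z))%:C) w)
  (mom : forall b j, (j <= 4)%N -> rint m2 (fun w => `|coord b w| ^+ j * cnorm1 (U w)))
  (gr : forall z, `|profile U z| < r)
  (gS : factorial_growth S)
  (fS : forall n x, `|x| < r -> `|derive1n n f x| <= S n).

Let g := profile U.
Let V k w : R := cnorm1 (ft (fun z => (taylor_rem f k g z)%:C) w).

Let rem0E z : taylor_rem f 0 g z = f (g z).
Proof. by rewrite /taylor_rem /= f0 df0 mul0r !subr0. Qed.

Let mU : cmfun U. Proof. by have [_ /L2CP[]] := fU. Qed.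

Let mcoordn b j : measurable_fun setT (fun w => `|coord b w| ^+ j).
Proof.
apply: measurable_funX; apply: measurableT_comp => //; exact: measurable_coord.
Qed.

Let mcoordC b : cmfun (fun w => (coord b w)%:C).
Proof. exact: cmfun_real (measurable_coord b). Qed.

Let iU : cinteg m2 U.
Proof.
apply: (cinteg_le _ (mom true (leq0n 4))); first exact: mU.
by move=> w; rewrite expr0 mul1r.
Qed.

Let iU1 b : cinteg m2 (fun w => (coord b w)%:C * U w).
Proof.
apply: (cinteg_le _ (mom b (isT : (1 <= 4)%N))).
  exact: (cmfunM (mcoordC b) mU).
by move=> w; rewrite cnorm1ZR.
Qed.

Let iU2 b : cinteg m2 (fun w => (coord b w)%:C * ((coord b w)%:C * U w)).
Proof.
apply: (cinteg_le _ (mom b (isT : (2 <= 4)%N))).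
  exact: (cmfunM (mcoordC b) (cmfunM (mcoordC b) mU)).
by move=> w; rewrite !cnorm1ZR mulrA.
Qed.

Let rg : rint m2 (fun z => f (g z)).
Proof.
have := rint_taylor_rem sf fU gr fS 0; congr (rint _ _).
by apply/funext => z; exact: rem0E.
Qed.

Let V0E w : V 0 w = cnorm1 (ft (fun z => (f (g z))%:C) w).
Proof.
have E : (fun z => (taylor_rem f 0 g z)%:C) = (fun z => (f (g z))%:C).
  by apply/funext => z; rewrite rem0E.
by rewrite /V E.
Qed.

Let UV w : cnorm1 (U w) <= V 0 w.
Proof.
rewrite UE cnorm1ZR V0E ger0_norm ?qinv_ge0//.
by rewrite ler_piMl ?cnorm1_ge0// qinv_le1.
Qed.

Let cUV b w : `|coord b w| * cnorm1 (U w) <= V 0 w.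
Proof.
rewrite UE cnorm1ZR V0E (ger0_norm (qinv_ge0 w)) mulrA.
by rewrite ler_piMl ?cnorm1_ge0// coord_qinv_le1.
Qed.

(** Comes from |R_k| <= S_{k+2} g^2; the factor 2 is that of [ft_bound]. *)
Let F0 k : R := 2 * (S k.+2 * \int[m2]_z (g z ^+ 2)).

Let VF0 k w : V k w <= F0 k.
Proof.
have ir := rint_taylor_rem sf fU gr fS k.
apply: le_trans (ft_bound w (cinteg_real ir)) _; rewrite ler_wpM2l//.
have [lg _ _] := fU; have [_ ig] := (L2P _).1 lg.
rewrite -RintegralZl//; apply: le_Rintegral => //.
- exact: (cinteg_cnorm1 (cinteg_real ir)).
- exact: (rintZ (S k.+2) ig).
- by move=> z _; rewrite cnorm1_real; exact: (taylor_rem_bound sf gr fS).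
Qed.

Let lU1 b : L2C (fun w => (coord b w)%:C * U w).
Proof.
apply: (L2C_of_cinteg (M := F0 0) (iU1 b)) => w; rewrite cnorm1ZR.
exact: le_trans (cUV b w) (VF0 _ _).
Qed.

Let hU w : U (- w.1, - w.2) = (U w)^*%C.
Proof. by rewrite !UE qinv_opp (ft_opp_real w rg) cconjM conjc_real. Qed.

Let c : R := ((2 * pi) ^+ 2)^-1.
Let c0 : 0 <= c. Proof. by rewrite invr_ge0 sqr_ge0. Qed.

Let a k := `|derive1n k.+2 f 0|.

Let mV k : measurable_fun setT (V k).
Proof.
apply: cmfun_cnorm1; apply: ft_meas; apply: cinteg_real.
exact: rint_taylor_rem sf fU gr fS k.
Qed.

(** The convolution identity [ft_taylor_rem_step] with absolute values taken inside; i and the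
    characters disappear, and [c] is the inversion constant. *)
Let step b k w : ((`|coord b w| * V k w)%:E <= c%:E * \int[m2]_v
  ((V k.+1 v + a k * cnorm1 (U v)) *
   (`|coord b (aff2 (-1) w v)| * cnorm1 (U (aff2 (-1) w v))))%:E)%E.
Proof.
have [iF E] := ft_taylor_rem_step (b := b) (k := k) (w := w)
  sf iU iU1 iU2 lU1 hU fU gr fS (erefl _).
have := cnorm1_cint iF; rewrite -E -mulrA cnorm1_iM cnorm1ZR -/(V k w) -lee_fin.
move/le_trans; apply; rewrite -(rint_EFin (cinteg_cnorm1 iF)).
set h := fun v => ((V k.+1 v + a k * cnorm1 (U v)) *
   (`|coord b (aff2 (-1) w v)| * cnorm1 (U (aff2 (-1) w v))))%:E.
have mnU : measurable_fun setT (fun w => cnorm1 (U w)) by exact: cmfun_cnorm1 mU.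
have mh : measurable_fun setT h.
  apply/measurable_EFinP; apply: measurable_funM.
    by apply: measurable_funD; [exact: mV|exact: measurable_funM].
  have mq : measurable_fun setT (fun v => `|coord b v| * cnorm1 (U v)).
    by apply: measurable_funM => //; apply: measurableT_comp => //; exact: measurable_coord.
  exact: measurableT_comp mq (measurable_aff2 _ _).
have h0 v : setT v -> (0 <= h v)%E.
  by move=> _; rewrite lee_fin !(mulr_ge0, addr_ge0, cnorm1_ge0, normr_ge0).
have cE : (0 <= c%:E)%E by rewrite lee_fin.
rewrite -(ge0_integralZl m2 measurableT mh h0 cE).
apply: ge0_le_integral => //.
- by move=> v _; rewrite lee_fin cnorm1_ge0.
- by apply/measurable_EFinP; exact: rint_meas (cinteg_cnorm1 iF).
- by apply: measurable_funeM; exact: mh.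
move=> v _; rewrite /h -EFinM lee_fin; apply: le_trans (cnorm1M _ _) _.
rewrite cnorm1ZR (ger0_norm c0) cnorm1_iM cnorm1ZR mulrCA; apply: ler_wpM2l => //.
apply: ler_wpM2r; first by rewrite mulr_ge0 ?cnorm1_ge0.
by apply: le_trans (cnorm1D _ _) _; rewrite cnorm1ZR.
Qed.

Let ga : factorial_growth a.
Proof.
apply: factorial_growth_le (factorial_growthS (factorial_growthS gS)) => k.
by apply: fS; rewrite normr0; apply: le_lt_trans (gr (0, 0)).
Qed.

Let gF0 : factorial_growth F0.
Proof.
apply: factorial_growthZ => //.
have := factorial_growthZ _ (factorial_growthS (factorial_growthS gS)).
move=> /(_ (\int[m2]_z (g z ^+ 2))) h; apply: factorial_growth_le (h _) => [k|].
  by rewrite mulrC.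
by apply: Rintegral_ge0 => z _; exact: sqr_ge0.
Qed.

Let m_norm_coord b : measurable_fun setT (fun w => `|coord b w|).
Proof. by apply: measurableT_comp => //; exact: measurable_coord. Qed.

Let norm_coord_sub b w v : `|coord b w| <= `|coord b v| + `|coord b (aff2 (-1) w v)|.
Proof.
have -> : coord b w = coord b v + coord b (aff2 (-1) w v).
  by rewrite /coord /aff2; case: b => /=; ring.
exact: ler_normD.
Qed.

Let sup_moment b j : (j <= 4)%N ->
  exists2 F, factorial_growth F & forall k w, `|coord b w| ^+ j * V k w <= F k.
Proof.
elim: j => [|j IH] j4.
  by exists F0 => // k w; rewrite mul1r.
have [F gF hF] := IH (ltnW j4).
have i1 : rint m2 (fun w => `|coord b w| * cnorm1 (U w)) := mom b (isT : (1 <= 4)%N).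
have ij := mom b j4.
exact: (@sup_moment_step R (fun w => `|coord b w|) (fun w => cnorm1 (U w)) V a c
  (m_norm_coord b) (cmfun_cnorm1 mU) mV (fun=> normr_ge0 _) (fun=> cnorm1_ge0 _)
  (fun _ _ => cnorm1_ge0 _) (fun=> normr_ge0 _) c0 (norm_coord_sub b) UV (@step b)
  j F0 F i1 ij ga gF0 gF VF0 hF).
Qed.

(** The sup bounds of orders 0 and 4 in both directions give an integrable majorant of every V_k
    with factorial dependence on k. This initialises the L^1 induction, and its case k = 0 controls
    |U| <= V_0. *)
Lemma factorial_moments : exists K L : R, [/\ 0 <= K, 0 <= L & forall b n,
  (\int[m2]_w (`|coord b w| ^+ n * cnorm1 (U w))%:E <= (K * L ^+ n * n`!%:R)%:E)%E].
Proof.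
have [F1 gF1 hF1] := sup_moment true (leqnn 4).
have [F2 gF2 hF2] := sup_moment false (leqnn 4).
pose G k := 2 * F0 k + F1 k + F2 k.
have gG : factorial_growth G.
  by apply: factorial_growthD => //; apply: factorial_growthD => //; exact: factorial_growthZ.
(* Uses (1 + x^2)(1 + y^2) <= 2 + x^4 + y^4, which explains order 4 and the coefficients of [G]. *)
have VG k w : V k w <= G k * kap w.
  pose d := (1 + w.1 ^+ 2) * (1 + w.2 ^+ 2).
  have Vw : 0 <= V k w := cnorm1_ge0 _.
  have d0 : 0 < d by apply: mulr_gt0; rewrite ltr_pwDl ?sqr_ge0.
  have kE : kap w = 4 / d.
    by rewrite /kap /pois2 /poisson expr1n /d invfM; ring.
  have E4 b : `|coord b w| ^+ 4 = (coord b w ^+ 2) ^+ 2.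
    by rewrite (exprM _ 2 2) real_normK ?num_real.
  have dle : d * V k w <= G k.
    apply: (@le_trans _ _ (2 * V k w + `|coord true w| ^+ 4 * V k w +
        `|coord false w| ^+ 4 * V k w)); last first.
      by apply: lerD; [apply: lerD|]; rewrite ?ler_wpM2l.
    rewrite -!mulrDl; apply: ler_wpM2r => //; rewrite !E4 /= /d.
    by have := sqr_ge0 (w.1 ^+ 2 - w.2 ^+ 2); have := sqr_ge0 (w.1 ^+ 2 - 1);
      have := sqr_ge0 (w.2 ^+ 2 - 1); nra.
  rewrite kE mulrA ler_pdivlMr// mulrC; apply: (le_trans dle).
  have : 0 <= G k by apply: le_trans dle; rewrite mulr_ge0 ?(ltW d0).
  by lra.
pose I := \int[m2]_w kap w.
have I0 : 0 <= I by apply: Rintegral_ge0 => w _; exact: ltW (kap_gt0 w).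
have G0 k : 0 <= G k.
  have := VG k (0, 0); rewrite -(pmulr_lge0 _ (kap_gt0 (0, 0))).
  by apply: le_trans; exact: cnorm1_ge0.
(* One pair of constants for both sequences: [C] will play the roles of [K] and [A] in the
   induction. *)
have [C [B [C0 B0 hCB]]] := factorial_growthD ga (factorial_growthZ I0 gG).
have hV k : (\int[m2]_w (V k w)%:E <= (C * B ^+ k * k`!%:R)%:E)%E.
  apply: (@le_trans _ _ (I * G k)%:E); last first.
    by rewrite lee_fin; apply: le_trans (hCB k); rewrite lerDr /a.
  have iG := rintZ (G k) (@rint_kap R).
  rewrite mulrC -(RintegralZl _ measurableT (@rint_kap R)) -(rint_EFin iG).
  apply: ge0_le_integral => //.
  - by move=> w _; rewrite lee_fin cnorm1_ge0.
  - by apply/measurable_EFinP; exact: mV.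
  - by apply/measurable_EFinP; exact: rint_meas iG.
  - by move=> w _; rewrite lee_fin.
have ha k : a k <= C * B ^+ k * k`!%:R.
  by apply: le_trans (hCB k); rewrite lerDl mulr_ge0.
pose L := 8 * c * C * (B + C).
exists C, L; split => // [|b n]; first by rewrite !mulr_ge0 ?addr_ge0.
have := @L1_moment_bound R (fun w => `|coord b w|) (fun w => cnorm1 (U w)) V a c
  (m_norm_coord b) (cmfun_cnorm1 mU) mV (fun=> normr_ge0 _) (fun=> cnorm1_ge0 _)
  (fun _ _ => cnorm1_ge0 _) (fun=> normr_ge0 _) c0 (norm_coord_sub b) UV (cUV b) (@step b)
  C L C B C0 C0 B0 (lexx _) ha hV n 0%N.
move=> h; apply: le_trans (le_trans _ h) _.
  apply: ge0_le_integral => //.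
  - by move=> w _; rewrite lee_fin mulr_ge0 ?exprn_ge0 ?cnorm1_ge0.
  - apply/measurable_EFinP; apply: measurable_funM; first exact: mcoordn.
    exact: cmfun_cnorm1 mU.
  - by apply/measurable_EFinP; apply: measurable_funM; [exact: mcoordn|exact: mV].
  - by move=> w _; rewrite lee_fin; apply: ler_wpM2l; rewrite ?exprn_ge0.
have L0 : 0 <= L by rewrite !mulr_ge0 ?addr_ge0.
rewrite lee_fin /fact_weight expr0 mulr1 addn0 ler_piMr//.
  by apply: mulr_ge0 => //; apply: mulr_ge0; rewrite ?exprn_ge0.
by rewrite invf_le1 ?exprn_gt0// exprn_ege1// ler1n.
Qed.

End factorial_moments.

(** * Analyticity *)

Section exponential_series.
Context {R : realType}.

(** The k-th term of the series of e^{ix}, with the power of i kept apart so that its parts are the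
    library's coefficients of cosine and sine. *)
Definition iterm (k : nat) (x : R) : R[i] := 'i%C ^+ k * (x ^+ k / k`!%:R)%:C.

Lemma icomplex_exp (k : nat) : 'i%C ^+ k = ((~~ odd k)%:R * (-1) ^+ k./2) +i*
  ((odd k)%:R * (-1) ^+ k.-1./2) :> R[i].
Proof.
have i2 m : 'i%C ^+ m.*2 = ((-1) ^+ m)%:C :> R[i].
  by rewrite -mul2n exprM sqr_i rmorphXn rmorphN1.
have [ko|ke] := boolP (odd k); rewrite -{1}(odd_double_half k).
  rewrite ko exprS i2; apply: complex_ext; rewrite !(cReM, cImM) /=.
    by ring.
  rewrite !(mul0r, mul1r, add0r); congr (_ ^+ _).
  by rewrite -{2}(odd_double_half k) ko /= doubleK.
by rewrite (negbTE ke) i2; apply: complex_ext; rewrite /= ?mul0r ?mul1r.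
Qed.

Lemma Re_iterm k x : complex.Re (iterm k x) = cos_coeff x k.
Proof. by rewrite /iterm icomplex_exp cReM /cos_coeff /= mulr0 subr0 mulrA. Qed.

Lemma Im_iterm k x : complex.Im (iterm k x) = sin_coeff x k.
Proof. by rewrite /iterm icomplex_exp cImM /sin_coeff /= mulr0 add0r mulrA. Qed.

Lemma cnorm1_iterm k x : cnorm1 (iterm k x) = `|x| ^+ k / k`!%:R.
Proof.
rewrite /iterm; have -> : cnorm1 ('i%C ^+ k * (x ^+ k / k`!%:R)%:C) =
    cnorm1 (x ^+ k / k`!%:R)%:C.
  elim: k (x ^+ k / _)%:C => [|k IH] z; first by rewrite mul1r.
  by rewrite exprS -mulrA cnorm1_iM IH.
by rewrite cnorm1_real normrM normrX normfV (ger0_norm (ler0n _ _)).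
Qed.

Lemma itermM (h x : R) k : iterm k (h * x) = (h ^+ k)%:C * iterm k x.
Proof. by rewrite /iterm exprMn -mulrA [in LHS]rmorphM mulrCA. Qed.

Lemma iterm_sum_cvg (x : R) :
  complex.Re (\sum_(k < N) iterm k x) @[N --> \oo] --> cos x /\
  complex.Im (\sum_(k < N) iterm k x) @[N --> \oo] --> sin x.
Proof.
have HR N : complex.Re (\sum_(k < N) iterm k x) = series (cos_coeff x) N.
  rewrite /series /= big_mkord; elim: N => [|N IH]; first by rewrite !big_ord0.
  by rewrite !big_ord_recr cReD IH Re_iterm.
have HI N : complex.Im (\sum_(k < N) iterm k x) = series (sin_coeff x) N.
  rewrite /series /= big_mkord; elim: N => [|N IH]; first by rewrite !big_ord0.
  by rewrite !big_ord_recr cImD IH Im_iterm.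
split.
- under eq_fun do rewrite HR; rewrite unlock; exact: is_cvg_series_cos_coeff.
- under eq_fun do rewrite HI; rewrite unlock; exact: is_cvg_series_sin_coeff.
Qed.

Lemma exp_partial_sum_le (x : R) N : 0 <= x -> \sum_(k < N) x ^+ k / k`!%:R <= expR x.
Proof.
move=> x0; have -> : \sum_(k < N) x ^+ k / k`!%:R = series (exp_coeff x) N.
  by rewrite /series /= big_mkord.
apply: nondecreasing_cvgn_le; last exact: is_cvg_series_exp_coeff.
by apply: nondecreasing_series => n _ _; exact: exp_coeff_ge0.
Qed.

Lemma exp_term_le (x : R) N : 0 <= x -> x ^+ N / N`!%:R <= expR x.
Proof.
move=> x0; apply: le_trans (exp_partial_sum_le N.+1 x0).
rewrite big_ord_recr /= lerDr; apply: sumr_ge0 => k _.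
by apply: divr_ge0; rewrite ?exprn_ge0.
Qed.

Lemma cnorm1_iterm_sum (x : R) N : cnorm1 (\sum_(k < N) iterm k x) <= expR `|x|.
Proof.
apply: le_trans (exp_partial_sum_le N (normr_ge0 x)).
elim: N => [|N IH]; first by rewrite !big_ord0 cnorm1_0.
rewrite !big_ord_recr /=; apply: le_trans (cnorm1D _ _) _.
by rewrite cnorm1_iterm lerD2r.
Qed.

Lemma geometric_sum_le (q : R) N : 0 <= q -> q < 1 -> \sum_(j < N) q ^+ j <= (1 - q)^-1.
Proof.
move=> q0 q1; have d0 : 0 < 1 - q by rewrite subr_gt0.
rewrite -[leRHS]mul1r ler_pdivlMr// mulrC.
have := subrX1 q N; move/(congr1 -%R); rewrite opprB -mulNr opprB => <-.
by rewrite gerBl exprn_ge0.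
Qed.

Lemma esum_geometric (x q : R) : 0 <= x -> 0 <= q -> q < 1 ->
  (\esum_(j in [set: nat]) (x * q ^+ j)%:E <= (x / (1 - q))%:E)%E.
Proof.
move=> x0 q0 q1; have p0 n : 0 <= x * q ^+ n by rewrite mulr_ge0 ?exprn_ge0.
rewrite -nneseries_esumT; last by move=> n; rewrite lee_fin.
apply: lime_le; first by apply: is_cvg_nneseries => n _ _; rewrite lee_fin.
apply: nearW => N; rewrite sumEFin lee_fin big_mkord -mulr_sumr.
by rewrite ler_wpM2l// geometric_sum_le.
Qed.

Lemma summable_geometric2 (t : nat -> nat -> R) (M q : R) : 0 <= M -> 0 <= q -> q < 1 ->
  (forall i j, `|t i j| <= M * q ^+ i * q ^+ j) ->
  summable [set: nat * nat] (fun k => (t k.1 k.2)%:E).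
Proof.
move=> M0 q0 q1 ht; rewrite /summable.
have d0 : 0 <= (1 - q)^-1 by rewrite invr_ge0 subr_ge0 ltW.
have E := @esum_esum R nat nat setT (fun=> setT) (fun i j => `|(t i j)%:E|%E).
have -> : [set: nat * nat] = [set: nat] `*`` (fun=> [set: nat]).
  by apply/seteqP; split => // -[].
rewrite -E; last by move=> i j _ _; exact: abse_ge0.
apply: (@le_lt_trans _ _ (M / (1 - q) / (1 - q))%:E); last exact: ltry.
apply: le_trans (esum_geometric (divr_ge0 M0 _) q0 q1); last by rewrite subr_ge0 ltW.
apply: le_esum => i _.
have Mi : 0 <= M * q ^+ i by rewrite mulr_ge0 ?exprn_ge0.
apply: le_trans (le_trans _ (esum_geometric Mi q0 q1)) _.
  by apply: le_esum => j _; rewrite lee_fin.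
by rewrite lee_fin mulrAC.
Qed.

End exponential_series.

(** * From factorial moments to convergent power series *)

Section analyticity_from_moments.
Context {R : realType}.
Notation m2 := (lebesgue2 R).
Variables (U : R * R -> R[i]) (K L : R).
Hypotheses (iU : cinteg m2 U) (K0 : 0 <= K) (L0 : 0 <= L)
  (mom : forall b n, (\int[m2]_w (`|coord b w| ^+ n * cnorm1 (U w))%:E <=
     (K * L ^+ n * n`!%:R)%:E)%E).

(** Chosen so that 2 d L <= 1/2, which makes the series of exponential moments geometric; the + 1
    covers L = 0. *)
Let d : R := (4 * (L + 1))^-1.

Let d_gt0 : 0 < d. Proof. by rewrite invr_gt0; have := L0; lra. Qed.

Let dL : 2 * d * L <= 2^-1.
Proof.
rewrite -subr_ge0 (_ : _ - _ = (2 * (L + 1))^-1); first by rewrite invr_ge0; have := L0; lra.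
by rewrite /d; field; apply: lt0r_neq0; have := L0; lra.
Qed.

Let mnU : measurable_fun setT (fun w => cnorm1 (U w)).
Proof. exact: cmfun_cnorm1 (cinteg_meas iU). Qed.

Let m_norm_coord b : measurable_fun setT (fun w : R * R => `|coord b w|).
Proof. by apply: measurableT_comp => //; exact: measurable_coord. Qed.

(** Expanding the exponential, the n! of the moment bound cancels that of the series and leaves K (2
    d L)^n. *)
Let rint_exp_coord b : rint m2 (fun w => expR (2 * d * `|coord b w|) * cnorm1 (U w)).
Proof.
have mE : measurable_fun setT (fun w => expR (2 * d * `|coord b w|) * cnorm1 (U w)).
  apply: measurable_funM; last exact: mnU.
  by apply: measurableT_comp => //; apply: measurable_funM => //; exact: m_norm_coord.
apply/rint_ge0P => //.
  by move=> w; rewrite mulr_ge0 ?expR_ge0 ?cnorm1_ge0.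
pose t n w : R := (2 * d) ^+ n / n`!%:R * (`|coord b w| ^+ n * cnorm1 (U w)).
have q0 n : 0 <= (2 * d) ^+ n / n`!%:R.
  by rewrite divr_ge0// exprn_ge0// mulr_ge0// ltW.
have n0 n w : 0 <= `|coord b w| ^+ n * cnorm1 (U w).
  by rewrite mulr_ge0 ?exprn_ge0 ?cnorm1_ge0.
have t0 n w : 0 <= t n w by exact: mulr_ge0.
have mn n : measurable_fun setT (fun w => `|coord b w| ^+ n * cnorm1 (U w)).
  by apply: measurable_funM; [apply: measurable_funX; exact: m_norm_coord|exact: mnU].
have mt n : measurable_fun setT (fun w => (t n w)%:E).
  by apply/measurable_EFinP; apply: measurable_funM => //; exact: mn.
have -> : (\int[m2]_w (expR (2 * d * `|coord b w|) * cnorm1 (U w))%:E =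
    \int[m2]_w \sum_(n <oo) (t n w)%:E)%E.
  apply: eq_integral => w _; apply/esym/cvg_lim => //.
  have -> : (fun n => (\sum_(0 <= k < n) (t k w)%:E)%E) =
      (fun n => (series (exp_coeff (2 * d * `|coord b w|)) n * cnorm1 (U w))%:E).
    apply/funext => n; rewrite sumEFin /series /= mulr_suml; congr EFin.
    by apply: eq_bigr => k _; rewrite /t /exp_coeff /= [(2 * d * _) ^+ k]exprMn; ring.
  apply: cvg_EFin; first exact: nearW.
  apply: cvgM; [exact: is_cvg_series_exp_coeff|exact: cvg_cst].
rewrite integral_nneseries//; last by move=> n w _; rewrite lee_fin.
apply: (@le_lt_trans _ _ (\sum_(n <oo) (K * (2 * d * L) ^+ n)%:E)%E).
  apply: lee_nneseries => [n _ _|n _].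
    by apply: integral_ge0 => w _; rewrite lee_fin.
  have q0E : (0 <= ((2 * d) ^+ n / n`!%:R)%:E)%E by rewrite lee_fin.
  have n0E w : setT w -> (0 <= (`|coord b w| ^+ n * cnorm1 (U w))%:E)%E by rewrite lee_fin.
  have mnE : measurable_fun setT (fun w => (`|coord b w| ^+ n * cnorm1 (U w))%:E).
    exact/measurable_EFinP.
  have := ge0_integralZl m2 measurableT mnE n0E q0E.
  rewrite [X in X = _ -> _](_ : _ = \int[m2]_w (t n w)%:E)%E// => ->.
  apply: le_trans (lee_wpmul2l q0E (mom b n)) _; rewrite -EFinM lee_fin le_eqVlt.
  apply/orP; left; apply/eqP; have f0 : n`!%:R != 0 :> R by rewrite pnatr_eq0 -lt0n fact_gt0.
  by rewrite [(2 * d * L) ^+ n]exprMn; field.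
have r0 : 0 <= 2 * d * L by rewrite !mulr_ge0// ltW.
have r1 : 2 * d * L < 1 by apply: le_lt_trans dL _; lra.
rewrite nneseries_esumT; last by move=> n; rewrite lee_fin mulr_ge0 ?exprn_ge0.
exact: le_lt_trans (esum_geometric K0 r0 r1) (ltry _).
Qed.

(** A majorant for all the series below. Its integrability follows from e^{d|x|} e^{d|y|} <=
    e^{2d|x|} + e^{2d|y|}, whence the factor 2 in [rint_exp_coord]. *)
Let D w : R := expR (d * `|w.1|) * expR (d * `|w.2|) * cnorm1 (U w).

Let rint_D : rint m2 D.
Proof.
apply: (rint_le _ (rintD (rint_exp_coord true) (rint_exp_coord false))).
  apply: measurable_funM; last exact: mnU.
  by apply: measurable_funM; apply: measurableT_comp => //; apply: measurable_funM => //;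
    [exact: (m_norm_coord true)|exact: (m_norm_coord false)].
move=> w; rewrite ger0_norm ?mulr_ge0 ?expR_ge0 ?cnorm1_ge0// -mulrDl.
apply: ler_wpM2r; first exact: cnorm1_ge0.
have E x : expR (2 * d * x) = expR (d * x) ^+ 2 by rewrite -mulrA mulr_natl mulr2n expRD.
rewrite /= !E; apply: le_trans (ler_norm _) _; exact: normM_le_sqrD.
Qed.

Let C (a : R * R) i j : R[i] :=
  cint m2 (fun w => U w * expi (dot a w) * (iterm i w.1 * iterm j w.2)).

Let m_iterm k : cmfun (fun x : measurableTypeR R => iterm k x).
Proof.
apply: cmfunM; first exact: cmfun_cst.
by apply: cmfun_real; apply: measurable_funM => //; exact: measurable_funX.
Qed.

Let m_term (a : R * R) i j :
  cmfun (fun w => U w * expi (dot a w) * (iterm i w.1 * iterm j w.2)).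
Proof.
apply: cmfunM; first exact: cinteg_meas (cinteg_ift a iU).
apply: cmfunM.
- exact: cmfun_comp (m_iterm i) measurable_fst.
- exact: cmfun_comp (m_iterm j) measurable_snd.
Qed.

(** A single term of the exponential series is below its sum, so |x|^k / k! <= d^-k e^{d|x|}. *)
Let term_bound (a : R * R) i j w :
  cnorm1 (U w * expi (dot a w) * (iterm i w.1 * iterm j w.2)) <=
  2 * ((d ^+ i)^-1 * (d ^+ j)^-1) * D w.
Proof.
have h k (x : R) : cnorm1 (iterm k x) <= (d ^+ k)^-1 * expR (d * `|x|).
  rewrite cnorm1_iterm [leRHS]mulrC ler_pdivlMr ?exprn_gt0// mulrC mulrA -exprMn.
  by apply: exp_term_le; rewrite mulr_ge0// ltW.
apply: le_trans (cnorm1M _ _) _.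
apply: (@le_trans _ _ (cnorm1 (U w) * 2 * ((d ^+ i)^-1 * expR (d * `|w.1|) *
   ((d ^+ j)^-1 * expR (d * `|w.2|))))).
  apply: ler_pM; rewrite ?cnorm1_ge0//.
    apply: le_trans (cnorm1M _ _) _; apply: ler_wpM2l; first exact: cnorm1_ge0.
    exact: cnorm1_expi.
  apply: le_trans (cnorm1M _ _) _; apply: ler_pM; rewrite ?cnorm1_ge0//.
by rewrite le_eqVlt /D; apply/orP; left; apply/eqP; ring.
Qed.

Let iterm_int (a : R * R) i j :
  cinteg m2 (fun w => U w * expi (dot a w) * (iterm i w.1 * iterm j w.2)).
Proof.
apply: (cinteg_le _ (rintZ (2 * ((d ^+ i)^-1 * (d ^+ j)^-1)) rint_D)).
  exact: m_term.
by move=> w; exact: term_bound.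
Qed.

Let C_bound (a : R * R) i j :
  cnorm1 (C a i j) <= 2 * ((d ^+ i)^-1 * (d ^+ j)^-1) * \int[m2]_w D w.
Proof.
apply: le_trans (cnorm1_cint (iterm_int a i j)) _.
rewrite -RintegralZl//; apply: le_Rintegral => //.
  exact: (cinteg_cnorm1 (iterm_int a i j)).
exact: (rintZ _ rint_D).
Qed.

Lemma real_analytic_profile : real_analytic (profile U).
Proof.
pose c : R := ((2 * pi) ^+ 2)^-1; have c0 : 0 <= c by rewrite invr_ge0 sqr_ge0.
(* The coefficients grow at most like d^-(i + j), so half of [d] gives a double geometric series of
   ratio 1/2. *)
move=> a; exists (d / 2); first by rewrite divr_gt0.
exists (fun i j => c * complex.Re (C a i j)) => z z1 z2.
split.
  pose I := \int[m2]_w D w.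
  have I0 : 0 <= I.
    by apply: Rintegral_ge0 => w _; rewrite !mulr_ge0 ?expR_ge0 ?cnorm1_ge0.
  apply: (@summable_geometric2 _ (fun i j => c * complex.Re (C a i j) *
     (z.1 - a.1) ^+ i * (z.2 - a.2) ^+ j) (c * (2 * I)) 2^-1) => //.
  - by rewrite !mulr_ge0.
  - by lra.
  move=> i j.
  have hp (h : R) k : `|h| < d / 2 -> `|h| ^+ k <= d ^+ k * 2^-1 ^+ k.
    by move=> hh; rewrite -exprMn lerXn2r ?nnegrE ?mulr_ge0 ?(ltW hh)// ltW.
  have h1 := hp _ i z1; have h2 := hp _ j z2.
  rewrite !normrM !normrX (ger0_norm c0).
  have hC := le_trans (Re_le_cnorm1 _) (C_bound a i j); rewrite -/I in hC.
  have dk k : d ^+ k != 0 by rewrite expf_neq0// lt0r_neq0.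
  apply: (@le_trans _ _ (c * (2 * ((d ^+ i)^-1 * (d ^+ j)^-1) * I) *
     (d ^+ i * 2^-1 ^+ i) * (d ^+ j * 2^-1 ^+ j))); last first.
    rewrite le_eqVlt; apply/orP; left; apply/eqP.
    have := dk i; have := dk j; move: (d ^+ i) (d ^+ j) (2^-1 ^+ i) (2^-1 ^+ j).
    by move=> x y p q y0 x0; field; rewrite y0 x0.
  apply: ler_pM; rewrite ?exprn_ge0 ?mulr_ge0 ?exprn_ge0//.
  apply: ler_pM; rewrite ?exprn_ge0 ?mulr_ge0//.
  exact: ler_wpM2l.
pose h1 := z.1 - a.1; pose h2 := z.2 - a.2.
(* The partial sum over a square, kept under the integral. It tends to the full character at [z] and
   is dominated by 2 D, because |h1| and |h2| are at most [d]. *)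
pose F N w := U w * expi (dot a w) *
  ((\sum_(i < N) iterm i (h1 * w.1)) * (\sum_(j < N) iterm j (h2 * w.2))).
have FE N : F N = (fun w => \sum_(i < N) \sum_(j < N) (h1 ^+ i * h2 ^+ j)%:C *
    (U w * expi (dot a w) * (iterm i w.1 * iterm j w.2))).
  apply/funext => w; rewrite /F mulr_suml mulr_sumr; apply: eq_bigr => i _.
  rewrite mulr_sumr mulr_sumr; apply: eq_bigr => j _.
  by rewrite !itermM rmorphM; ring.
have iF i j : cinteg m2 (fun w => (h1 ^+ i * h2 ^+ j)%:C *
    (U w * expi (dot a w) * (iterm i w.1 * iterm j w.2))).
  exact: (cintegZ _ (iterm_int a i j)).
have Re_sum M (G : 'I_M -> R[i]) :
    complex.Re (\sum_(i < M) G i) = \sum_(i < M) complex.Re (G i).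
  exact: (big_morph (@complex.Re R) (@cReD R) (erefl _)).
have sumE N : \sum_(i < N) \sum_(j < N) c * complex.Re (C a i j) *
    (z.1 - a.1) ^+ i * (z.2 - a.2) ^+ j = c * complex.Re (cint m2 (F N)).
  have S i := cint_sum (index_enum 'I_N) (fun j => iF i (nat_of_ord j)).
  have := (cint_sum (index_enum 'I_N) (fun i => (S (nat_of_ord i)).1)).2.
  rewrite FE => ->; rewrite Re_sum mulr_sumr; apply: eq_bigr => i _.
  rewrite (S i).2 Re_sum mulr_sumr; apply: eq_bigr => j _.
  rewrite cintZ; last exact: iterm_int.
  by rewrite cReM /= mul0r subr0 -/(C a i j) /h1 /h2; ring.
under eq_fun do rewrite sumE.
have h1d : `|h1| <= d by apply: le_trans (ltW z1) _; rewrite ler_pdivrMr//; have := d_gt0; lra.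
have h2d : `|h2| <= d by apply: le_trans (ltW z2) _; rewrite ler_pdivrMr//; have := d_gt0; lra.
have mF N : cmfun (F N).
  rewrite FE.
  have S i := cint_sum (index_enum 'I_N) (fun j => iF i (nat_of_ord j)).
  exact: cinteg_meas (cint_sum (index_enum 'I_N) (fun i => (S (nat_of_ord i)).1)).1.
have mf : cmfun (fun w => U w * expi (dot z w)) by exact: cinteg_meas (cinteg_ift z iU).
have FD N w : cnorm1 (F N w) <= 2 * D w.
  apply: le_trans (cnorm1M _ _) _.
  rewrite (_ : 2 * D w = (cnorm1 (U w) * 2) *
    (expR (d * `|w.1|) * expR (d * `|w.2|))); last by rewrite /D; ring.
  have e (h x : R) M : `|h| <= d -> cnorm1 (\sum_(k < M) iterm k (h * x)) <= expR (d * `|x|).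
    move=> hd; apply: le_trans (cnorm1_iterm_sum _ _) _.
    by rewrite ler_expR normrM ler_wpM2r.
  apply: ler_pM; rewrite ?cnorm1_ge0//.
    apply: le_trans (cnorm1M _ _) _; apply: ler_wpM2l; first exact: cnorm1_ge0.
    exact: cnorm1_expi.
  apply: le_trans (cnorm1M _ _) _; apply: ler_pM; rewrite ?cnorm1_ge0//; exact: e.
have iD2 := rintZ 2 rint_D.
have cF : {ae m2, forall w, complex.Re (F n w) @[n --> \oo] --> complex.Re (U w * expi (dot z w)) /\
    complex.Im (F n w) @[n --> \oo] --> complex.Im (U w * expi (dot z w))}.
  apply: aeW => w.
  have [r1 i1] := iterm_sum_cvg (h1 * w.1); have [r2 i2] := iterm_sum_cvg (h2 * w.2).
  have E : expi (dot z w) = expi (dot a w) * (expi (h1 * w.1) * expi (h2 * w.2)).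
    by rewrite -!expiD; congr expi; rewrite /dot /h1 /h2; ring.
  rewrite E mulrA /F; move: (U w * _) => u.
  split.
    under eq_fun do rewrite cReM cReM cImM; rewrite cReM cReM cImM.
    apply: cvgB; (apply: cvgM; first exact: cvg_cst).
      by apply: cvgB; apply: cvgM.
    by apply: cvgD; apply: cvgM.
  under eq_fun do rewrite cImM cReM cImM; rewrite cImM cReM cImM.
  apply: cvgD; (apply: cvgM; first exact: cvg_cst).
    by apply: cvgD; apply: cvgM.
  by apply: cvgB; apply: cvgM.
have [h _] := @cdct _ _ R m2 F _ _ mF mf cF iD2 FD.
by apply: cvgM; [exact: cvg_cst|exact: h].
Qed.

End analyticity_from_moments.

(** * Changes on null sets, and low moments from Sobolev regularity *)

Section almost_everywhere_representatives.
Context {R : realType}.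
Notation m2 := (lebesgue2 R).
Implicit Types (u : R * R -> R) (U : R * R -> R[i]).

Lemma ft_ae X Y z : {ae m2, forall w, X w = Y w} -> cmfun X -> cmfun Y ->
  ft X z = ft Y z :> R[i].
Proof.
move=> XY mX mY.
have me : cmfun (fun w => expi (- dot z w)).
  by apply: cmfun_expi; apply: measurableT_comp => //; exact: measurable_dot.
apply: cint_ae_eq; [|exact: cmfunM|exact: cmfunM].
by apply: (ae_imp XY) => w ->.
Qed.

Lemma is_fourier_ae u u' U U' : is_fourier u U -> {ae m2, forall z, u z = u' z} ->
  {ae m2, forall w, U w = U' w} -> measurable_fun setT u' -> cmfun U' ->
  is_fourier u' U'.
Proof.
move=> fU uu' UU' mu' mU'; have [lu lU _] := fU.
have mU := L2C_cmfun lU; have [mu iu] := (L2P _).1 lu.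
have lu' : L2 u'.
  apply/L2P; split; first exact: mu'.
  apply: (rint_ae _ _ iu); first by apply: (ae_imp uu') => z ->.
  by apply: measurable_funX; exact: mu'.
have lU' : L2C U'.
  apply/L2CP; split; first exact: mU'.
  apply: (rint_ae _ _ (L2C_rint lU)); first by apply: (ae_imp UU') => w ->.
  exact: cmfun_csq mU'.
apply: is_fourier_intro => //; apply: cvg_trans (is_fourier_cvg fU).
apply: near_eq_cvg; apply: nearW => n.
have mt v : L2 v -> cmfun (trunc v n) by move=> lv; exact: cinteg_meas (cinteg_trunc n lv).
have ftE w : ft (trunc u n) w = ft (trunc u' n) w.
  apply: ft_ae; [|exact: mt|exact: mt].
  by apply: (ae_imp uu') => z; rewrite /trunc => ->.
have mD V v : cmfun V -> L2 v -> measurable_fun setT (fun w => csq (V w - ft (trunc v n) w)).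
  move=> mV lv; apply: cmfun_csq; apply: cmfunB => //.
  by apply: ft_meas; exact: cinteg_trunc.
apply: rint_ae_eq; [|exact: mD|exact: mD].
by apply: (ae_imp UU') => w ->; rewrite ftE.
Qed.

(** With q = 1 + |w|^2, the weight is at most q^2, and q^2 |U| is the product of q^4 |U|, square
    integrable by H^8, with q^-2, whose square is below [kap]. *)
Lemma Hs_moments U b j : (j <= 4)%N ->
  L2C (fun w => ((1 + w.1 ^+ 2 + w.2 ^+ 2) `^ (8 / 2))%:C * U w) -> cmfun U ->
  rint m2 (fun w => `|coord b w| ^+ j * cnorm1 (U w)).
Proof.
move=> j4 lU mU; have /L2CP[_ iU] := lU.
apply: (rint_le _ (rintD (rintZ 2 iU) (@rint_kap R))).
  apply: measurable_funM; last exact: cmfun_cnorm1 mU.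
  apply: measurable_funX; apply: measurableT_comp => //; exact: measurable_coord.
move=> w; set q := 1 + w.1 ^+ 2 + w.2 ^+ 2.
have x0 := sqr_ge0 w.1; have y0 := sqr_ge0 w.2.
have q1 : 1 <= q by rewrite /q; lra.
have -> : q `^ (8 / 2) = q ^+ 4.
  rewrite (_ : 8 / 2 = 4%:R); last by field.
  by rewrite powR_mulrn//; lra.
rewrite ger0_norm ?mulr_ge0 ?exprn_ge0 ?cnorm1_ge0//.
have cj : `|coord b w| ^+ j <= q ^+ 2.
  have c0 : 0 <= `|coord b w| by [].
  have cq : `|coord b w| <= q.
    have : `|coord b w| ^+ 2 <= q - 1.
      by rewrite real_normK ?num_real// /q /coord; case: (b); lra.
    by have := sqr_ge0 (`|coord b w| - 1); lra.
  have cq2 : `|coord b w| ^+ 2 <= q.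
    by rewrite real_normK ?num_real// /q /coord; case: (b); lra.
  case: j j4 => [|[|[|[|[|j]]]]] // _.
  - by rewrite expr0; nra.
  - by rewrite expr1; nra.
  - by nra.
  - by rewrite exprS expr2; apply: ler_pM => //; rewrite exprn_ge0.
  - by rewrite (exprM _ 2 2); apply: lerXn2r => //; rewrite nnegrE ?exprn_ge0//; lra.
have n0 := cnorm1_ge0 (U w).
apply: (le_trans (ler_wpM2r n0 cj)).
have q0 : 0 < q by lra.
have -> : q ^+ 2 * cnorm1 (U w) = (q ^+ 4 * cnorm1 (U w)) * (q ^+ 2)^-1.
  by field; exact: lt0r_neq0.
apply: le_trans (ler_norm _) _; apply: le_trans (normM_le_sqrD _ _) _.
apply: lerD.
  by have := cnorm1_le_csq ((q ^+ 4)%:C * U w); rewrite cnorm1ZR ger0_norm ?exprn_ge0 ?(ltW q0).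
have -> : kap w = 4 / ((1 + w.1 ^+ 2) * (1 + w.2 ^+ 2)).
  by rewrite /kap /pois2 /poisson expr1n invfM; ring.
rewrite expr2 -invfM ler_pdivlMr; last by apply: mulr_gt0; lra.
rewrite mulrC ler_pdivrMr; last by rewrite !mulr_gt0 ?exprn_gt0.
have h1 : (1 + w.1 ^+ 2) * (1 + w.2 ^+ 2) <= q ^+ 2.
  by rewrite /q; nra.
have h2 : 1 <= q ^+ 2 by rewrite expr2; nra.
by nra.
Qed.

End almost_everywhere_representatives.

(** A solution is an L^2 class, so analyticity is asserted of a representative that agrees with it
    almost everywhere. *)
Theorem theorem3p4 (R : realType) (f : R -> R) (C p : R)
  (C_gt0 : 0 < C) (p_gt2 : 2 < p) (p_lt4 : p < 4)
  (f_growth : forall u : R, `|f u| <= C * `|u| `^ (p - 1))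
  (f_smooth : smooth f)
  (f_analytic : forall r : R, 0 < r -> exists2 M : R, 0 < M &
     forall (x : R) (n : nat), `|x| < r ->
       `|derive1n n f x| <= M ^+ n.+1 * n`!%:R)
  (phi : R * R -> R)
  (phi_Z : in_Z phi) (phi_Hoo : in_Hoo phi)
  (phi_sol : weak_solution f phi) :
  exists2 g : R * R -> R,
    real_analytic g & {ae mu2 R, forall z, phi z = g z}.
Proof.
(* Order 8 is what the moments up to order 4 require in [Hs_moments]. *)
have [U0 fU0 lqU0] := phi_Hoo 8 (ler0n R 8).
have [lphi lU0 _] := fU0; have mU0 := L2C_cmfun lU0.
have mom0 b j (j4 : (j <= 4)%N) := Hs_moments b j4 lqU0 mU0.
have iU0 : cinteg (lebesgue2 R) U0.
  apply: (cinteg_le _ (mom0 true 0%N isT)); first exact: mU0.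
  by move=> w; rewrite expr0 mul1r.
pose c : R := ((2 * pi) ^+ 2)^-1; have c0 : 0 <= c by rewrite invr_ge0 sqr_ge0.
pose g := profile U0.
have phig : {ae lebesgue2 R, forall z, phi z = g z}.
  apply: (ae_imp (fourier_inversion fU0 iU0)) => z /(congr1 (@complex.Re R)).
  by rewrite cReM /= mul0r subr0.
have [mift _] := ift_meas iU0.
have mg : measurable_fun setT g by apply: measurable_funM => //; exact: mift.
(* The first summand bounds |g| everywhere. Adding 2 makes the bound strict and gives r > 1, so that
   the derivative bounds also cover |x| <= 1, where the vanishing of f and f' at 0 is tested. *)
pose r : R := c * (2 * \int[lebesgue2 R]_w cnorm1 (U0 w)) + 2.
have I0 : 0 <= \int[lebesgue2 R]_w cnorm1 (U0 w).
  by apply: Rintegral_ge0 => w _; exact: cnorm1_ge0.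
have r1 : 1 < r.
  have : 0 <= c * (2 * \int[lebesgue2 R]_w cnorm1 (U0 w)) by rewrite !mulr_ge0.
  by rewrite /r; lra.
have gr z : `|g z| < r.
  apply: (@le_lt_trans _ _ (c * (2 * \int[lebesgue2 R]_w cnorm1 (U0 w)))).
    rewrite normrM (ger0_norm c0) ler_wpM2l//.
    exact: le_trans (Re_le_cnorm1 _) (ift_bound z iU0).
  by rewrite ltrDl.
have [M M0 hM] := f_analytic r (lt_trans ltr01 r1).
pose S n : R := M ^+ n.+1 * n`!%:R.
have fS n x : `|x| < r -> `|derive1n n f x| <= S n by exact: hM.
have S0 n : 0 <= S n by rewrite mulr_ge0 ?exprn_ge0 ?(ltW M0).
have gS : factorial_growth S.
  exists M, M; split; rewrite ?(ltW M0)// => k; by rewrite /S exprS.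
have [f0 df0] : f 0 = 0 /\ derive1 f 0 = 0.
  apply: (zero_of_growth p_gt2 f_smooth C_gt0 (S0 2%N) f_growth) => x x1.
  by apply: (fS 2%N); exact: le_lt_trans x1 r1.
have cf : continuous f := derive1n_continuous (n := 0) f_smooth.
have [mphi iphi] := (L2P _).1 lphi.
have ig2 : rint (lebesgue2 R) (fun z => g z ^+ 2).
  apply: (rint_ae _ _ iphi); first by apply: (ae_imp phig) => z ->.
  by apply: measurable_funX; exact: mg.
have ifg : rint (lebesgue2 R) (fun z => f (g z)).
  apply: (rint_le _ (rintZ (S 2%N) ig2)).
    by apply: measurableT_comp mg; exact: continuous_measurable_fun.
  move=> z; have := taylor1_of_derive (S0 2%N) (f_smooth 0%N) (f_smooth 1%N) (u := g z).
  rewrite /= f0 df0 mul0r !subr0; apply => x xg.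
  by apply: (fS 2%N); exact: le_lt_trans xg (gr z).
pose V0 := ft (fun z => (f (g z))%:C).
have U0E : {ae lebesgue2 R, forall w, U0 w = (qinv w)%:C * V0 w}.
  apply: weak_solution_fourier phi_Z phi_sol fU0 cf _ ifg.
  by apply: (ae_imp phig) => z ->.
(* Redefining U0 on a null set makes it hermitian at every point. *)
pose U w := (qinv w)%:C * V0 w.
have mU : cmfun U.
  apply: cmfunM; last exact: (ft_meas (cinteg_real ifg)).
  by apply: cmfun_real; exact: measurable_qinv.
(* The inverse transform sees [U] through an integral, so the modification leaves the profile
   unchanged at every point. *)
have gE : profile U = g.
  apply/funext => z; rewrite /g /profile !ift_ft; congr (_ * complex.Re _).
  by apply: ft_ae => //; apply: (ae_imp U0E) => w ->.
have fU : is_fourier (profile U) U by rewrite gE; exact: is_fourier_ae fU0 phig U0E mg mU.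
have mom b j : (j <= 4)%N ->
    rint (lebesgue2 R) (fun w => `|coord b w| ^+ j * cnorm1 (U w)).
  move=> j4; apply: (rint_ae _ _ (mom0 b j j4)).
    by apply: (ae_imp U0E) => w ->.
  apply: measurable_funM; last exact: cmfun_cnorm1 mU.
  by apply: measurable_funX; apply: measurableT_comp => //; exact: measurable_coord.
have iU : cinteg (lebesgue2 R) U.
  apply: (cinteg_le _ (mom true 0%N isT)); first exact: mU.
  by move=> w; rewrite expr0 mul1r.
have UE w : U w = (qinv w)%:C * ft (fun z => (f (profile U z))%:C) w by rewrite gE.
have gr' z : `|profile U z| < r by rewrite gE; exact: gr.
have [K [L [K0 L0 hKL]]] := factorial_moments f_smooth f0 df0 fU UE mom gr' gS fS.
exists (profile U); first exact: real_analytic_profile iU K0 L0 hKL.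
by rewrite gE; exact: phig.
Qed.
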